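(* The CAR algebra $\mathrm{M}_{2^\infty}$ admits a $\mathrm{C}^\ast$-diagonal $(D\subset \mathrm{M}_{2^\infty})$ with Cantor spectrum that is not an AF diagonal.
   Context: The CAR algebra is the UHF algebra $\mathrm{M}_{2^\infty}=\mathrm{M}_2\otimes\mathrm{M}_2\otimes\cdots$ (infinite tensor product of $2\times 2$ complex matrix algebras). For a sub-$\mathrm{C}^\ast$-algebra $D\subset A$, a normaliser of $D$ in $A$ is an element $v\in A$ with $vDv^*\cup v^*Dv\subset D$. A Cartan sub-$\mathrm{C}^\ast$-algebra is a $\mathrm{C}^\ast$-pair $(D\subset A)$ such that $A$ is generated (as a $\mathrm{C}^\ast$-algebra) by the normalisers of $D$ in $A$, $D$ is a maximal abelian sub-$\mathrm{C}^\ast$-algebra (masa) of $A$, and there is a unique faithful conditional expectation $A\to D$. It is a $\mathrm{C}^\ast$-diagonal if moreover it has the unique extension property: every pure state on $D$ extends uniquely to a state on $A$. It has Cantor spectrum if the Gelfand spectrum of $D$ is homeomorphic to the Cantor space. An AF diagonal in an AF algebra $A$ is a sub-$\mathrm{C}^\ast$-algebra $D\subset A$ such that the pair $(D\subset A)$ arises as the inductive limit of a sequence of pairs $(D_k\subset F_k)$, where each $F_k$ is a finite-dimensional $\mathrm{C}^\ast$-algebra, $D_k\subset F_k$ is a masa, and the connecting maps $F_k\to F_{k+1}$ send $D_k$ into $D_{k+1}$ and normalisers of $D_k$ in $F_k$ to normalisers of $D_{k+1}$ in $F_{k+1}$. *)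

(* Defs.v *)
(* The complex numbers are [R[i]] for [R : realType];
   norms on [R[i]]-modules take their (real, nonnegative) values in [R[i]], and the
   topology of the complex plane is found on the copy [R[i]^o]. *)
From HB Require Import structures.
From mathcomp Require Import all_boot all_order all_algebra.
From mathcomp Require Import all_classical all_reals all_analysis.
From mathcomp Require Import complex mxtens.

Set Implicit Arguments.
Unset Strict Implicit.
Unset Printing Implicit Defensive.

Import Order.TTheory GRing.Theory Num.Theory.
Import numFieldNormedType.Exports.

Local Open Scope classical_set_scope.
Local Open Scope ring_scope.

(* C*-algebras, not assumed unital (nor nonzero).  The product is a field of the
   structure because MathComp rings are unital. *)
HB.mixin Record isCStar (R : realType) A of CompleteNormedModule R[i] A := {
  cmul : A -> A -> A ;
  star : A -> A ;
  cmulA : associative cmul ;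
  cmulDl : left_distributive cmul +%R ;
  cmulDr : right_distributive cmul +%R ;
  cmulZl : forall (a : R[i]) x y, cmul (a *: x) y = a *: cmul x y ;
  cmulZr : forall (a : R[i]) x y, cmul x (a *: y) = a *: cmul x y ;
  starD : {morph star : x y / x + y} ;
  starZ : forall (a : R[i]) x, star (a *: x) = Num.conj a *: star x ;
  starM : forall x y, star (cmul x y) = cmul (star y) (star x) ;
  starK : involutive star ;
  normr_cmul : forall x y : A, `|cmul x y| <= `|x| * `|y| ;
  cstar_identity : forall x, `|cmul (star x) x| = `|x| ^+ 2 }.

#[short(type="cstarAlgType")]
HB.structure Definition CStarAlgebra (R : realType) :=
  {A of isCStar R A & CompleteNormedModule R[i] A}.

Infix "**" := cmul (at level 40, left associativity) : ring_scope.

Definition star_hom (R : realType) (A B : cstarAlgType R) (f : A -> B) : Prop :=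
  [/\ linear f, {morph f : x y / x ** y} & {morph f : x / star x}].

Definition finite_dimensional (R : realType) (A : cstarAlgType R) : Prop :=
  exists (n : nat) (e : 'I_n -> A),
    forall x, exists c : 'I_n -> R[i], x = \sum_i c i *: e i.

Section SubAlgebras.
Variables (R : realType) (A : cstarAlgType R).
Implicit Types (B D S : set A) (f : A -> R[i]).

Definition sub_cstar B : Prop :=
  [/\ B 0,
      forall (a : R[i]) x y, B x -> B y -> B (a *: x + y),
      forall x y, B x -> B y -> B (x ** y),
      forall x, B x -> B (star x) &
      closed B].

Definition abelian_set B : Prop := forall x y, B x -> B y -> x ** y = y ** x.

Definition masa D : Prop :=
  [/\ sub_cstar D, abelian_set D &
      forall B, sub_cstar B -> abelian_set B -> D `<=` B -> B = D].

Definition normaliser D : set A :=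
  [set v | forall d, D d -> D (v ** d ** star v) /\ D (star v ** d ** v)].

(* The positive elements Y^* Y of the C*-algebra of n x n matrices over A. *)
Definition mx_pos (n : nat) (X : 'M[A]_n) : Prop :=
  exists Y : 'M[A]_n, X = \matrix_(i, j) \sum_k (star (Y k i) ** Y k j).

(* Contractive completely positive D-bimodule projections of A onto D. *)
Definition cond_exp D (E : A -> A) : Prop :=
  [/\ linear E,
      (forall x, D (E x)) /\ (forall d, D d -> E d = d),
      forall d x d', D d -> D d' -> E (d ** x ** d') = d ** E x ** d',
      forall n (X : 'M[A]_n), mx_pos X -> mx_pos (map_mx E X) &
      forall x, `|E x| <= `|x|].

Definition faithful (E : A -> A) : Prop := forall x, E (star x ** x) = 0 -> x = 0.

Definition cartan D : Prop :=
  [/\ masa D,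
      smallest sub_cstar (normaliser D) = [set: A] &
      exists! E : A -> A, cond_exp D E /\ faithful E].

(* A functional on B is represented by any function on A that agrees with it on B;
   the next four notions depend only on the values of f on B. *)
Definition linear_on B f : Prop :=
  forall (a : R[i]) x y, B x -> B y -> f (a *: x + y) = a * f x + f y.

(* Positive functionals of norm 1. *)
Definition state_on B f : Prop :=
  [/\ linear_on B f,
      forall x, B x -> 0 <= f (star x ** x),
      forall x, B x -> `|f x| <= `|x| &
      forall e : R[i], 0 < e -> exists x, [/\ B x, `|x| <= 1 & 1 - e < `|f x|]].

(* Extreme points of the set of states. *)
Definition pure_state_on B f : Prop :=
  state_on B f /\
  forall g h (t : R[i]), state_on B g -> state_on B h -> 0 < t < 1 ->
    (forall x, B x -> f x = t * g x + (1 - t) * h x) ->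
    forall x, B x -> g x = f x /\ h x = f x.

Definition character_on B f : Prop :=
  [/\ linear_on B f,
      forall x y, B x -> B y -> f (x ** y) = f x * f y &
      exists2 x, B x & f x != 0].

Definition unique_extension D : Prop :=
  forall f, pure_state_on D f ->
    exists! g : A -> R[i], state_on [set: A] g /\ (forall d, D d -> g d = f d).

Definition cstar_diagonal D : Prop := cartan D /\ unique_extension D.

Definition spectrum D : set {ptws D -> R[i]^o} :=
  [set (fun d : D => f (val d)) | f in character_on D].

(* The Gelfand spectrum of D, with the topology of pointwise convergence on D. *)
Definition gelfand_spectrum D : topologicalType :=
  initial_topology (val : @spectrum D -> {ptws D -> R[i]^o}).

End SubAlgebras.

Definition homeomorphic (X Y : topologicalType) : Prop :=
  exists (f : X -> Y) (g : Y -> X),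
    [/\ cancel f g, cancel g f, continuous f & continuous g].

Definition cantor_spectrum (R : realType) (A : cstarAlgType R) (D : set A) : Prop :=
  homeomorphic (gelfand_spectrum D) cantor_space.

(* A is M_2 (x) M_2 (x) ...: the inductive limit of the matrix algebras M_(2^k)
   along the embeddings x |-> x (x) 1_2. *)
Definition is_CAR (R : realType) (A : cstarAlgType R) : Prop :=
  exists mu : forall k : nat, 'M[R[i]]_(2 ^ k) -> A,
  [/\ forall k, [/\ linear (mu k), {morph (mu k) : x y / x *m y >-> x ** y} &
                    forall x, mu k ((map_mx Num.conj x)^T) = star (mu k x)],
      forall k, injective (mu k),
      forall k x, mu k.+1 (castmx (esym (expnSr 2 k), esym (expnSr 2 k))
                             (tensmx x (1%:M : 'M[R[i]]_2))) = mu k x &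
      dense (\bigcup_k range (mu k))].

Fixpoint connect_map (F : nat -> Type) (phi : forall k, F k -> F k.+1) (k n : nat) :
    F k -> F (n + k)%N :=
  if n is n'.+1 then fun x => phi (n' + k)%N (connect_map phi n' x) else id.

(* [mu] exhibits (D in A) as the limit of the system of pairs (DF k in F k) with
   connecting maps [phi]. These are not assumed injective, and the norm in the limit
   is the limit of the norms along the system. *)
Definition pair_limit (R : realType) (F : nat -> cstarAlgType R)
    (DF : forall k, set (F k)) (phi : forall k, F k -> F k.+1)
    (A : cstarAlgType R) (D : set A) (mu : forall k, F k -> A) : Prop :=
  [/\ forall k, star_hom (mu k),
      forall k x, mu k.+1 (phi k x) = mu k x,
      forall k x, (`|connect_map phi n x| : R[i]^o) @[n --> \oo] --> `|mu k x|,
      dense (\bigcup_k range (mu k)) &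
      D = closure (\bigcup_k (mu k @` DF k))].

Definition AF_diagonal (R : realType) (A : cstarAlgType R) (D : set A) : Prop :=
  exists (F : nat -> cstarAlgType R) (DF : forall k, set (F k))
         (phi : forall k, F k -> F k.+1) (mu : forall k, F k -> A),
  [/\ forall k, finite_dimensional (F k) /\ masa (DF k),
      forall k, star_hom (phi k),
      forall k, phi k @` DF k `<=` DF k.+1,
      forall k, phi k @` normaliser (DF k) `<=` normaliser (DF k.+1) &
      pair_limit DF phi D mu].

(* Main.v *)
(* Let commuting 2 x 2 matrix units r^t (t = 0, 1, ...) and unitaries v_t, where v_t commutes
   with r^i for i < t, satisfy v_t = [[0, v_(t+1)], [1, 0]] with respect to r^t at infinitely
   many levels t, and v_t = [[v_(t+1), 0], [0, v_(t+1)^*]] at the other, "flip" levels, and let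
   them generate A.  The diagonal D is the commutant of all diagonal units r^t_cc.  Compressing
   to the blocks of the first T diagonal units converges, as T grows, to a conditional
   expectation E onto D with E (v_t^n) = 0 for n > 0; this makes D a C*-diagonal, and its
   spectrum is the space of all sequences of bits.

   D is not AF.  Otherwise u = v_0 is close to an element x of some finite dimensional F_k, whose
   masa is spanned by orthogonal projections; u then permutes their images, and the compressions
   of x show that u p lies in F_k D for each of these projections p.  Some power u^N fixes a
   nonzero p, and then u^N p lies in D, which contradicts E (u^N) = 0.

   Such a system exists in the CAR algebra: [[v, 0], [0, v^*]] is joined to 1 by a path of
   unitaries, which spread over the 2^s steps of an odometer conjugates s doublings followed by
   a flip to within O(2^-s) of s doublings followed by 1.  With s growing along the blocks, the
   equations for the v_t have a solution as limits of finite stages. *)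
From HB Require Import structures.
From mathcomp Require Import all_boot all_order all_algebra.
From mathcomp Require Import all_classical all_reals all_analysis.
From mathcomp Require Import complex mxtens ring lra zify.
Require Import Defs.

Set Implicit Arguments.
Unset Strict Implicit.
Unset Printing Implicit Defensive.

Import Order.TTheory GRing.Theory Num.Theory.
Import numFieldNormedType.Exports.

Local Open Scope classical_set_scope.
Local Open Scope ring_scope.

(** The two kinds of levels serve opposite ends. With doublings alone, the units and the $v_t$
    generate a Bunce-Deddens algebra, whose $K_1$ is not zero, so it is not AF. A flip sends the
    $K_1$ class of $v_{t+1}$ to $[v]+[v^*]=0$; this is what makes room for the system in a UHF
    algebra. Flips leave exponents alone, whereas a doubling has $v_t^2 = v_{t+1}$: it halves an
    even exponent and moves an odd power off the diagonal. Since doublings never stop, the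
    expectation kills every power of every $v_t$. The trace of the CAR algebra makes the expectation
    computable: its mean over the cylinder of a word $s$ is $2^{|s|}\tau(p_s x)$. Faithfulness,
    complete positivity and the points of the spectrum are all read off these numbers. In the
    construction, the equation of block $k$ is $u_k=\theta_k(u_{k+1})$, where $\theta_k$ is nearly
    constant because its conjugation spreads the flip over the odometer. The conjugating unitaries
    are multiplied up along the blocks; each unit is touched by finitely many of them only, since
    the later ones commute with it. *)

(** * Real-valued norms, closures and limits *)

Section RealNorm.
Variable R : realType.
Implicit Types a b : R[i].

(* Norms are real, nonnegative elements of R[i]; [nrm] is their value in R. *)
Definition nrm (V : normedModType R[i]) (x : V) : R := complex.Re `|x|.
Definition cabs a : R := complex.Re `|a|.

Lemma ReK a : 0 <= a -> (complex.Re a)%:C%C = a.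
Proof. by move=> a0; rewrite RRe_real // ger0_real. Qed.

Lemma cabsE a : `|a| = (cabs a)%:C%C.
Proof. by rewrite ReK. Qed.

Lemma cabs_ge0 a : 0 <= cabs a.
Proof. by rewrite -ler0c -cabsE. Qed.

Lemma cabsM a b : cabs (a * b) = cabs a * cabs b.
Proof. by apply: complexI; rewrite rmorphM /= -!cabsE normrM. Qed.

Lemma cabsD a b : cabs (a + b) <= cabs a + cabs b.
Proof. by rewrite -lecR rmorphD /= -!cabsE ler_normD. Qed.

Lemma cabsN a : cabs (- a) = cabs a.
Proof. by rewrite /cabs normrN. Qed.

Lemma cabsR (r : R) : cabs r%:C%C = `|r|.
Proof. by rewrite /cabs normc_def /= expr0n addr0 sqrtr_sqr. Qed.

Lemma cabs0 : cabs 0 = 0.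
Proof. by rewrite /cabs normr0. Qed.

Lemma cabs1 : cabs 1 = 1.
Proof. by rewrite /cabs normr1. Qed.

Lemma cabs_eq0 a : cabs a = 0 -> a = 0.
Proof. by move=> a0; apply: normr0_eq0; rewrite cabsE a0. Qed.

Lemma cabs_ler_Re a : complex.Re a <= cabs a.
Proof.
have := normc_ge_Re a; rewrite cabsE lecR; apply: le_trans.
exact: ler_norm.
Qed.

Lemma cabs_sum (I : Type) (r : seq I) (P : pred I) (F : I -> R[i]) :
  cabs (\sum_(i <- r | P i) F i) <= \sum_(i <- r | P i) cabs (F i).
Proof.
apply: (big_ind2 (fun x y => cabs x <= y)) => //; first by rewrite cabs0.
by move=> x x' y y' h h'; rewrite (le_trans (cabsD _ _)) // lerD.
Qed.

Lemma cabs_sqr a : (cabs a ^+ 2)%:C%C = a * Num.conj a.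
Proof. by rewrite rmorphXn /= -cabsE -normCK. Qed.

Section Module.
Variable V : normedModType R[i].
Implicit Types (x y z : V) (S : set V).

Lemma nrmE x : `|x| = (nrm x)%:C%C.
Proof. by rewrite ReK. Qed.

Lemma nrm_ge0 x : 0 <= nrm x.
Proof. by rewrite -ler0c -nrmE. Qed.

Lemma nrmD x y : nrm (x + y) <= nrm x + nrm y.
Proof. by rewrite -lecR rmorphD /= -!nrmE ler_normD. Qed.

Lemma nrmN x : nrm (- x) = nrm x.
Proof. by rewrite /nrm normrN. Qed.

Lemma nrmBC x y : nrm (x - y) = nrm (y - x).
Proof. by rewrite /nrm distrC. Qed.

Lemma nrm_eq0 x : nrm x = 0 -> x = 0.
Proof. by move=> x0; apply: normr0_eq0; rewrite nrmE x0. Qed.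

Lemma nrmZ a x : nrm (a *: x) = cabs a * nrm x.
Proof. by apply: complexI; rewrite rmorphM /= -!nrmE -cabsE normrZ. Qed.

Lemma ballE x (e : R) y : ball x e%:C%C y <-> nrm (x - y) < e.
Proof. by rewrite -ball_normE /ball_ /= nrmE ltcR. Qed.

Lemma gt0_realC a : 0 < a -> exists2 e : R, 0 < e & a = e%:C%C.
Proof.
move=> a0; exists (complex.Re a); last by rewrite ReK // ltW.
by move: a0; rewrite ltcE => /andP[].
Qed.

Lemma closureP S x :
  closure S x <-> forall e : R, 0 < e -> exists2 y, S y & nrm (x - y) < e.
Proof.
split=> [cx e e0|h B /nbhs_ballP[e /= /gt0_realC[r r0 ->] sB]].
  have [] := cx (ball x e%:C%C); first by apply: nbhsx_ballx; rewrite ltcR.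
  by move=> y [Sy /ballE xy]; exists y.
by have [y Sy xy] := h _ r0; exists y; split=> //; apply/sB/ballE.
Qed.

Lemma denseP S : dense S <->
  forall x (e : R), 0 < e -> exists2 y, S y & nrm (x - y) < e.
Proof.
split=> [dS x e e0|h O [x Ox] oO].
  have [||y [xy Sy]] := dS (ball x e%:C%C); last by exists y => //; apply/ballE.
    by exists x; apply: ballxx; rewrite ltcR.
  by apply: ball_open; rewrite ltcR.
have /nbhs_ballP[e /= /gt0_realC[r r0 ->] sO] := open_nbhs_nbhs (conj oO Ox).
by have [y Sy xy] := h x _ r0; exists y; split=> //; apply/sO/ballE.
Qed.

End Module.

Lemma nrm_complete (V : completeNormedModType R[i]) (s : nat -> V) :
  (forall e : R, 0 < e -> exists N, forall m n, (N <= m)%N -> (N <= n)%N ->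
    nrm (s m - s n) < e) ->
  exists l, forall e : R, 0 < e -> exists N, forall n, (N <= n)%N ->
    nrm (s n - l) < e.
Proof.
move=> cs; have cF : cauchy (s @ \oo).
  apply: cauchy_exP => a /gt0_realC[e e0 ->]; have [N hN] := cs _ e0.
  exists (s N); exists N => // n /= Nn; apply/ballE; exact: hN.
have /cauchy_cvgP /cvg_ex[l sl] := cF.
move: sl => /cvgrPdist_lt sl; exists l => e e0; have := sl e%:C%C.
rewrite ltcR e0 => /(_ isT)[N _ hN]; exists N => n /hN /=.
by rewrite nrmE ltcR nrmBC.
Qed.

Lemma invr_lt (e : R) : 0 < e -> exists N, forall n, (N <= n)%N -> n.+1%:R^-1 < e.
Proof.
move=> e0; have [N hN] : exists N : nat, e^-1 < N%:R.
  by exists (Num.bound e^-1); apply: archi_boundP; rewrite invr_ge0 ltW.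
exists N => n Nn; rewrite -[e]invrK ltf_pV2 ?posrE ?invr_gt0 ?ltr0n //.
by apply: lt_trans hN _; rewrite ltr_nat ltnS.
Qed.

Lemma exp_half_le n : (2^-1 : R) ^+ n <= n.+1%:R^-1.
Proof.
rewrite exprVn lef_pV2 ?posrE ?exprn_gt0 ?ltr0n //.
by rewrite -natrX ler_nat ltn_expl.
Qed.

Lemma exp_half_lt (C e : R) : 0 < e ->
  exists N, forall n, (N <= n)%N -> C * 2^-1 ^+ n < e.
Proof.
move=> e0; have [C0|C0] := lerP C 0.
  exists 0%N => n _; apply: le_lt_trans e0; apply: mulr_le0_ge0 => //.
have [N hN] := invr_lt (divr_gt0 e0 C0); exists N => n /hN.
rewrite ltr_pdivlMr // mulrC; apply: le_lt_trans.
by rewrite ler_pM2l // exp_half_le.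
Qed.

(** If y < x, Bernoulli's inequality makes (x / y)^n grow at least linearly in n, hence beyond C.
    Multiplicative constants in norm estimates are removed this way. *)
Lemma pow2_bound (x y C : R) : 0 <= x -> 0 <= y ->
  (forall r, x ^+ (2 ^ r) <= C * y ^+ (2 ^ r)) -> x <= y.
Proof.
move=> x0 y0 h; rewrite leNgt; apply/negP => yx.
have xp : 0 < x by apply: le_lt_trans yx.
have [yz|yp] := leP y 0.
  have := h 0%N; rewrite expn0 !expr1 (_ : y = 0) ?mulr0; first lra.
  by apply/eqP; rewrite eq_le yz.
pose t := x / y - 1; have t0 : 0 < t by rewrite subr_gt0 ltr_pdivlMr // mul1r.
have hb n : 1 + n%:R * t <= (x / y) ^+ n.
  elim: n => [|n ih]; first by rewrite mul0r addr0 expr0.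
  have -> : x / y = 1 + t by rewrite /t addrC subrK.
  rewrite exprS; move: ih; rewrite (_ : x / y = 1 + t); last by rewrite /t; lra.
  set a := (1 + t) ^+ n => ih.
  have n0 : 0 <= n%:R * t :> R by rewrite mulr_ge0 // ltW.
  apply: le_trans (_ : (1 + t) * (1 + n%:R * t) <= _).
    by rewrite -natr1; nra.
  by rewrite ler_pM2l //; lra.
have [N hN] : exists N : nat, `|C| / t < N%:R.
  by exists (Num.bound (`|C| / t)); apply: archi_boundP; rewrite divr_ge0 // ltW.
have := h N; rewrite -ler_pdivrMr ?exprn_gt0 // -expr_div_n => hC.
have := hb (2 ^ N)%N; move: hN; rewrite ltr_pdivrMr // => hN.
have : N%:R * t <= (2 ^ N)%:R * t by rewrite ler_pM2r // ler_nat ltnW // ltn_expl.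
have := ler_norm C; lra.
Qed.

End RealNorm.

Lemma conj_realC (R : realType) (k : R) : Num.conj (real_complex R k) = real_complex R k.
Proof. by apply/eqP; rewrite eq_complex /= oppr0 !eqxx. Qed.

(** * Unital C*-algebras *)

(* Unital C*-algebras as rings.  Mixing a ring structure with the normed modules of
   the library is impossible in its hierarchy, whence a structure with its own norm. *)
HB.mixin Record isUnitalCStar (R : realType) A & GRing.Algebra R[i] A := {
  nm : A -> R ;
  adj : A -> A ;
  nmD : forall x y : A, nm (x + y) <= nm x + nm y ;
  nmZ : forall (a : R[i]) (x : A), nm (a *: x) = cabs a * nm x ;
  nm_eq0 : forall x : A, nm x = 0 -> x = 0 ;
  nmM : forall x y : A, nm (x * y) <= nm x * nm y ;
  adjD : {morph adj : x y / x + y} ;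
  adjZ : forall (a : R[i]) (x : A), adj (a *: x) = Num.conj a *: adj x ;
  adjM : forall x y : A, adj (x * y) = adj y * adj x ;
  adjK : involutive adj ;
  nm_cstar : forall x : A, nm (adj x * x) = nm x ^+ 2 ;
  nm_complete : forall s : nat -> A,
    (forall e : R, 0 < e -> exists N, forall m n, (N <= m)%N -> (N <= n)%N ->
      nm (s m - s n) < e) ->
    exists l, forall e : R, 0 < e -> exists N, forall n, (N <= n)%N ->
      nm (s n - l) < e }.

#[short(type="ucstarAlgType")]
HB.structure Definition UnitalCStar (R : realType) :=
  {A of isUnitalCStar R A & GRing.Algebra R[i] A}.

Section UnitalCStarTheory.
Variables (R : realType) (A : ucstarAlgType R).
Implicit Types (x y z : A) (a b : R[i]).

Lemma nm0 : nm (0 : A) = 0.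
Proof. by rewrite -(scale0r (0 : A)) nmZ cabs0 mul0r. Qed.

Lemma nmN x : nm (- x) = nm x.
Proof. by rewrite -scaleN1r nmZ cabsN cabs1 mul1r. Qed.

Lemma nm_ge0 x : 0 <= nm x.
Proof. by have := nmD x (- x); rewrite subrr nm0 nmN; lra. Qed.

Lemma nmBC x y : nm (x - y) = nm (y - x).
Proof. by rewrite -opprB nmN. Qed.

Lemma nm_tri x y z : nm (x - z) <= nm (x - y) + nm (y - z).
Proof. by rewrite -{1}(subrK y x) -addrA nmD. Qed.

Lemma nmB x y : nm (x - y) <= nm x + nm y.
Proof. by rewrite -(nmN y) nmD. Qed.

Lemma nm_le_dist x y : nm x <= nm y + nm (x - y).
Proof. by rewrite -{1}(subrK y x) addrC nmD. Qed.

Lemma nm_sum (I : Type) (r : seq I) (P : pred I) (F : I -> A) :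
  nm (\sum_(i <- r | P i) F i) <= \sum_(i <- r | P i) nm (F i).
Proof.
elim/big_rec2: _ => [|i y x _ ih]; first by rewrite nm0.
by rewrite (le_trans (nmD _ _)) // lerD2l.
Qed.

Lemma nm_small x : (forall e : R, 0 < e -> nm x <= e) -> x = 0.
Proof.
move=> h; apply: nm_eq0; apply/eqP; rewrite eq_le nm_ge0 andbT.
by apply/ler_addgt0Pl => e e0; rewrite addr0 h.
Qed.

Lemma eq_nm_small x y : (forall e : R, 0 < e -> nm (x - y) <= e) -> x = y.
Proof. by move=> /nm_small /eqP; rewrite subr_eq0 => /eqP. Qed.

Lemma adj0 : adj (0 : A) = 0.
Proof. by have := adjZ 0 (0 : A); rewrite rmorph0 !scale0r. Qed.

Lemma adjN x : adj (- x) = - adj x.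
Proof. by rewrite -scaleN1r adjZ rmorphN rmorph1 scaleN1r. Qed.

Lemma adjB x y : adj (x - y) = adj x - adj y.
Proof. by rewrite adjD adjN. Qed.

Lemma adj1 : adj (1 : A) = 1.
Proof. by have := adjM 1 (adj (1 : A)); rewrite adjK mul1r adjK => <-. Qed.

Lemma adj_sum (I : Type) (r : seq I) (P : pred I) (F : I -> A) :
  adj (\sum_(i <- r | P i) F i) = \sum_(i <- r | P i) adj (F i).
Proof. by elim/big_rec2: _ => [|i y x _ <-]; rewrite ?adj0 ?adjD. Qed.

Lemma adjX x n : adj (x ^+ n) = adj x ^+ n.
Proof. by elim: n => [|n ih]; rewrite ?expr0 ?adj1 // exprS exprSr adjM ih. Qed.

Lemma nm_adj x : nm (adj x) = nm x.
Proof.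
have le y : nm y <= nm (adj y).
  have [->|y0] := eqVneq (nm y) 0; first exact: nm_ge0.
  have yp : 0 < nm y by rewrite lt_def y0 nm_ge0.
  by rewrite -(ler_pM2r yp) -expr2 -nm_cstar nmM.
by apply/eqP; rewrite eq_le le andbT; have := le (adj x); rewrite adjK.
Qed.

Lemma nm1 : nm (1 : A) = 1.
Proof.
have h := nm_cstar (1 : A); rewrite adj1 mulr1 in h.
have n0 : nm (1 : A) != 0.
  by apply/eqP => /nm_eq0 /eqP; rewrite oner_eq0.
by apply: (mulfI n0); rewrite mulr1 -expr2 -h.
Qed.

Lemma nm_unitary x : adj x * x = 1 -> nm x = 1.
Proof.
move=> h; have := nm_cstar x; rewrite h nm1 => /esym/eqP.
by rewrite sqrf_eq1 => /orP[/eqP//|/eqP h']; have := nm_ge0 x; rewrite h'; lra.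
Qed.

Lemma nm_sqr_adj x : adj x = x -> nm (x ^+ 2) = nm x ^+ 2.
Proof. by move=> xs; rewrite expr2 -{1}xs nm_cstar. Qed.

Lemma nm_pow2_adj x r : adj x = x -> nm (x ^+ (2 ^ r)) = nm x ^+ (2 ^ r).
Proof.
move=> xs; elim: r => [|r ih]; first by rewrite expn0 !expr1.
by rewrite expnSr !exprM nm_sqr_adj ?ih // adjX xs.
Qed.

Lemma nmX x n : nm (x ^+ n) <= nm x ^+ n.
Proof.
elim: n => [|n ih]; first by rewrite !expr0 nm1.
by rewrite !exprS (le_trans (nmM _ _)) // ler_wpM2l // nm_ge0.
Qed.

Lemma adjxx_eq0 x : adj x * x = 0 -> x = 0.
Proof.
move=> h; apply: nm_eq0; apply/eqP.
by rewrite -sqrf_eq0 -nm_cstar h nm0.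
Qed.

(* Pairwise orthogonal elements: since y = sum y_i satisfies
   (y* y)^n = sum (y_i* y_i)^n, its norm is controlled by the powers n = 2^r. *)
Lemma nm_orth_sum (I : eqType) (r : seq I) (y : I -> A) (C : R) : uniq r -> 0 <= C ->
  {in r &, forall i j, i != j -> adj (y i) * y j = 0 /\ y i * adj (y j) = 0} ->
  {in r, forall i, nm (y i) <= C} ->
  nm (\sum_(i <- r) y i) <= C.
Proof.
move=> ur C0 orth yC; set s := \sum_(i <- r) y i.
have ss : adj s * s = \sum_(i <- r) adj (y i) * y i.
  rewrite /s adj_sum big_distrlr /= big_seq [RHS]big_seq; apply: eq_bigr => i ir.
  rewrite (bigD1_seq i) //= big1_seq ?addr0 // => j /andP[ji jr].
  by have [] := orth i j ir jr; rewrite // eq_sym.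
have sn n : (adj s * s) ^+ n.+1 = \sum_(i <- r) (adj (y i) * y i) ^+ n.+1.
  elim: n => [|n ih]; first by rewrite expr1 ss; apply: eq_bigr => i _; rewrite expr1.
  rewrite exprS ih ss big_distrlr /= big_seq [RHS]big_seq; apply: eq_bigr => i ir.
  rewrite (bigD1_seq i) //= -exprS big1_seq ?addr0 // => j /andP[ji jr].
  rewrite exprS !mulrA -(mulrA (adj (y i))).
  by have [|_ ->] := orth i j ir jr; rewrite 1?eq_sym // mulr0 !mul0r.
rewrite -(@ler_pXn2r _ 2) ?nnegrE ?nm_ge0 // -nm_cstar.
apply: (@pow2_bound _ _ _ (size r)%:R); [exact: nm_ge0|exact: exprn_ge0|].
move=> k; rewrite -nm_pow2_adj; last by rewrite adjM adjK.
rewrite -(prednK (expn_gt0 2 k)) sn (le_trans (nm_sum _ _ _)) //.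
set n := _.-1.+1; have -> : (size r)%:R * C ^+ 2 ^+ n = \sum_(i <- r) C ^+ 2 ^+ n.
  by rewrite big_const_seq count_predT iter_addr_0 mulr_natl.
rewrite big_seq [leRHS]big_seq; apply: ler_sum => i ir.
rewrite (le_trans (nmX _ _)) // lerXn2r ?nnegrE ?nm_ge0 ?exprn_ge0 // nm_cstar.
by rewrite lerXn2r ?nnegrE ?nm_ge0 // yC.
Qed.

Definition ncauchy (s : nat -> A) :=
  forall e : R, 0 < e -> exists N, forall m n, (N <= m)%N -> (N <= n)%N ->
    nm (s m - s n) < e.

Definition ncvg (s : nat -> A) (l : A) :=
  forall e : R, 0 < e -> exists N, forall n, (N <= n)%N -> nm (s n - l) < e.

Lemma ncvg_unique (s : nat -> A) l l' :
  ncvg s l -> ncvg s l' -> l = l'.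
Proof.
move=> h h'; apply: eq_nm_small => e e0.
have [N hN] := h (e / 2) ltac:(lra); have [N' hN'] := h' (e / 2) ltac:(lra).
have := hN (maxn N N') (leq_maxl _ _); have := hN' (maxn N N') (leq_maxr _ _).
by have := nm_tri l (s (maxn N N')) l'; rewrite (nmBC l (s _)); lra.
Qed.

Lemma geometric_ncauchy (s : nat -> A) (C : R) :
  (forall n, nm (s n.+1 - s n) <= C * 2^-1 ^+ n) -> ncauchy s.
Proof.
move=> h.
have C0 : 0 <= C by have := le_trans (nm_ge0 _) (h 0%N); rewrite expr0 mulr1.
(* The exact value of the geometric sum is kept, since a bound free of k would not be inductive. *)
have tl n k : nm (s (n + k)%N - s n) <= 2 * C * (2^-1 ^+ n - 2^-1 ^+ (n + k)).
  elim: k => [|k ih]; first by rewrite addn0 !subrr nm0 mulr0.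
  rewrite addnS; apply: le_trans (nm_tri _ (s (n + k)%N) _) _.
  apply: le_trans (lerD (h _) ih) _; rewrite exprS.
  by set a := _ ^+ _; set b := _ ^+ _; lra.
have tle n k : nm (s (n + k)%N - s n) <= 2 * C * 2^-1 ^+ n.
  apply: le_trans (tl n k) _; rewrite ler_wpM2l ?mulr_ge0 //.
  by rewrite gerBl exprn_ge0 // invr_ge0.
move=> e e0; have [N hN] := exp_half_lt (4 * C) e0.
exists N => m n Nm Nn; have := hN N (leqnn _).
have := nm_tri (s m) (s N) (s n); rewrite (nmBC (s N) (s n)).
have := tle N (m - N)%N; have := tle N (n - N)%N; rewrite !subnKC //.
by set a := _ ^+ _; lra.
Qed.


Lemma geometric_cvg (s : nat -> A) (C : R) :
  (forall n, nm (s n.+1 - s n) <= C * 2^-1 ^+ n) -> exists l, ncvg s l.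
Proof. by move=> /geometric_ncauchy /nm_complete. Qed.

Lemma ncvg_nm_le (s : nat -> A) l C :
  (exists N, forall n, (N <= n)%N -> nm (s n) <= C) -> ncvg s l -> nm l <= C.
Proof.
move=> [N h] sl; apply/ler_addgt0Pl => e /sl[M hM].
have := nm_le_dist l (s (maxn N M)); rewrite nmBC.
by have := hM _ (leq_maxr N M); have := h _ (leq_maxl N M); lra.
Qed.

Lemma ncvg_eq (s s' : nat -> A) l :
  (exists N, forall n, (N <= n)%N -> s n = s' n) -> ncvg s l -> ncvg s' l.
Proof.
move=> [N h] sl e /sl[M hM]; exists (maxn N M) => n.
by rewrite geq_max => /andP[/h <- /hM].
Qed.

Lemma ncvg_cst x : ncvg (fun=> x) x.
Proof. by move=> e e0; exists 0%N => n _; rewrite subrr nm0. Qed.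

Lemma ncvg_lip (s : nat -> A) l (f : A -> A) C :
  (forall n, nm (f (s n) - f l) <= C * nm (s n - l)) -> ncvg s l ->
  ncvg (f \o s) (f l).
Proof.
move=> h sl e e0; have C1 : 0 < `|C| + 1 by have := normr_ge0 C; lra.
have [N hN] := sl _ (divr_gt0 e0 C1); exists N => n /hN.
rewrite ltr_pdivlMr // mulrC => /=; apply: le_lt_trans; apply: le_trans (h n) _.
by rewrite ler_wpM2r ?nm_ge0 //; have := ler_norm C; lra.
Qed.

Lemma ncvgD (s s' : nat -> A) l l' :
  ncvg s l -> ncvg s' l' -> ncvg (fun n => s n + s' n) (l + l').
Proof.
move=> h h' e e0; have [N hN] := h (e / 2) ltac:(lra).
have [M hM] := h' (e / 2) ltac:(lra); exists (maxn N M) => n.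
rewrite geq_max => /andP[/hN h1 /hM h2]; rewrite opprD addrACA.
by rewrite (le_lt_trans (nmD _ _)) //; lra.
Qed.

Lemma ncvgZ a (s : nat -> A) l : ncvg s l -> ncvg (fun n => a *: s n) (a *: l).
Proof. by apply: (@ncvg_lip s l _ (cabs a)) => n; rewrite -scalerBr nmZ. Qed.

Lemma ncvgMl x (s : nat -> A) l : ncvg s l -> ncvg (fun n => x * s n) (x * l).
Proof. by apply: (@ncvg_lip s l _ (nm x)) => n; rewrite -mulrBr nmM. Qed.

Lemma ncvgMr x (s : nat -> A) l : ncvg s l -> ncvg (fun n => s n * x) (l * x).
Proof. by apply: (@ncvg_lip s l (fun y => y * x) (nm x)) => n; rewrite -mulrBl mulrC nmM. Qed.

Lemma ncvgM (s s' : nat -> A) l l' :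
  ncvg s l -> ncvg s' l' -> ncvg (fun n => s n * s' n) (l * l').
Proof.
move=> h h' e e0; have a0 := nm_ge0 l; have b0 := nm_ge0 l'.
have c0 : 0 < nm l + nm l' + 1 by lra.
(* The bound 1 keeps nm (s n) below nm l + 1, so one denominator serves both error terms. *)
have [N hN] := h (Num.min 1 (e / 2 / (nm l + nm l' + 1)))
  ltac:(by rewrite lt_min ltr01 !divr_gt0).
have [M hM] := h' (e / 2 / (nm l + nm l' + 1)) ltac:(by rewrite !divr_gt0).
exists (maxn N M) => n; rewrite geq_max => /andP[/hN + /hM].
rewrite lt_min => /andP[h1 h2] h3.
have -> : s n * s' n - l * l' = s n * (s' n - l') + (s n - l) * l'.
  by rewrite mulrBr mulrBl addrA subrK.
apply: le_lt_trans (nmD _ _) _; apply: le_lt_trans (lerD (nmM _ _) (nmM _ _)) _.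
move: h2 h3; rewrite !ltr_pdivlMr // => h2 h3.
have := nm_le_dist (s n) l; have := nm_ge0 (s' n - l'); have := nm_ge0 (s n - l).
by have := nm_ge0 (s n); nra.
Qed.

Lemma ncvg_sum (I : Type) (q : seq I) (s : I -> nat -> A) (l : I -> A) :
  (forall i, ncvg (s i) (l i)) ->
  ncvg (fun n => \sum_(i <- q) s i n) (\sum_(i <- q) l i).
Proof.
move=> h; elim: q => [|i q ih].
  by apply: ncvg_eq (_ : ncvg (fun=> 0) _); [exists 0%N => n _; rewrite big_nil|
    rewrite big_nil; apply: ncvg_cst].
rewrite big_cons; apply: ncvg_eq (ncvgD (h i) ih).
by exists 0%N => n _; rewrite big_cons.
Qed.

Lemma ncvg_adj (s : nat -> A) l : ncvg s l -> ncvg (fun n => adj (s n)) (adj l).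
Proof.
by apply: (@ncvg_lip s l adj 1) => n; rewrite -adjB nm_adj mul1r.
Qed.

Definition nclosure (S : set A) : set A :=
  [set x | forall e : R, 0 < e -> exists2 y, S y & nm (x - y) < e].

Lemma sub_nclosure S : S `<=` nclosure S.
Proof. by move=> x Sx e e0; exists x; rewrite // subrr nm0. Qed.

Lemma nclosure_sub S S' : S `<=` S' -> nclosure S `<=` nclosure S'.
Proof. by move=> h x cx e /cx[y /h Sy xy]; exists y. Qed.

Lemma nclosure_idem S : nclosure (nclosure S) `<=` nclosure S.
Proof.
move=> x cx e e0; have [y cy xy] := cx (e / 2) ltac:(lra).
have [z Sz yz] := cy (e / 2) ltac:(lra).
by exists z => //; have := nm_tri x y z; lra.
Qed.

Lemma nclosure_seq (S : set A) x : nclosure S x ->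
  exists2 s : nat -> A, (forall n, S (s n)) & ncvg s x.
Proof.
move=> cx; have h n : {y | S y /\ nm (y - x) < n.+1%:R^-1}.
  apply: cid; have [|y Sy xy] := cx n.+1%:R^-1; first by rewrite invr_gt0.
  by exists y; rewrite nmBC.
exists (fun n => projT1 (h n)) => [n|e /invr_lt[N hN]]; first by case: (h n) => ? [].
by exists N => n /hN; apply: lt_trans; case: (h n) => y [].
Qed.

Lemma ncvg_nclosure (S : set A) (s : nat -> A) l :
  (exists N, forall n, (N <= n)%N -> S (s n)) -> ncvg s l -> nclosure S l.
Proof.
move=> [N h] sl e /sl[M hM]; exists (s (maxn N M)).
  exact/h/leq_maxl.
by rewrite nmBC; apply/hM/leq_maxr.
Qed.

End UnitalCStarTheory.

(** * Matrix units and the diagonal *)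

Section LinearSpan.
Variables (R : realType) (A : ucstarAlgType R).
Implicit Types (S V : set A) (x y : A).

Definition lin_closed V := V 0 /\ forall (a : R[i]) x y, V x -> V y -> V (a *: x + y).

(** Impredicative span: a membership proof is its own induction principle, applied directly to the
    linear property at hand. *)
Definition lspan S : set A :=
  [set x | forall V, lin_closed V -> S `<=` V -> V x].

Lemma lspan_ind S V : lin_closed V -> S `<=` V -> lspan S `<=` V.
Proof. by move=> lV SV x; apply. Qed.

Lemma lspan_lin S : lin_closed (lspan S).
Proof.
split=> [V []//|a x y hx hy V lV SV]; have [_ h] := lV.
by apply: h; [apply: hx|apply: hy].
Qed.

Lemma sub_lspan S : S `<=` lspan S.
Proof. by move=> x Sx V _; apply. Qed.

Lemma lin_closedD V x y : lin_closed V -> V x -> V y -> V (x + y).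
Proof. by move=> [_ h] Vx Vy; rewrite -[x]scale1r; apply: h. Qed.

Lemma lin_closedZ V a x : lin_closed V -> V x -> V (a *: x).
Proof. by move=> [h0 h] Vx; rewrite -[_ *: _]addr0; apply: h. Qed.

Lemma lin_closed_sum V (I : eqType) (r : seq I) (F : I -> A) : lin_closed V ->
  {in r, forall i, V (F i)} -> V (\sum_(i <- r) F i).
Proof.
move=> lV h; rewrite big_seq; elim/big_ind: _ => //; first by case: lV.
by move=> x y; apply: lin_closedD.
Qed.

Lemma lspan_mul S : (forall x y, S x -> S y -> lspan S (x * y)) ->
  forall x y, lspan S x -> lspan S y -> lspan S (x * y).
Proof.
move=> h x y hx hy; have [z0 zl] := lspan_lin S.
apply: (hx [set x | lspan S (x * y)]).
  by split=> [|a u w /= hu hw]; rewrite /= ?mul0r // mulrDl -scalerAl; apply: zl.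
move=> u Su /=; apply: (hy [set y | lspan S (u * y)]) => [|w Sw /=]; last exact: h.
by split=> [|a u' w /= hu hw]; rewrite /= ?mulr0 // mulrDr -scalerAr; apply: zl.
Qed.

Lemma lspan_adj S : (forall x, S x -> lspan S (adj x)) ->
  forall x, lspan S x -> lspan S (adj x).
Proof.
move=> h x hx; have [z0 zl] := lspan_lin S.
apply: (hx [set x | lspan S (adj x)]) => //.
by split=> [|a u w /= hu hw]; rewrite /= ?adj0 // adjD adjZ; apply: zl.
Qed.

Definition star_closed V := [/\ lin_closed V, V 1,
  forall x y, V x -> V y -> V (x * y), forall x, V x -> V (adj x) &
  nclosure V `<=` V].

Definition generating S := forall V, star_closed V -> S `<=` V -> V = setT.

Lemma lin_closed_nclosure V : lin_closed V -> lin_closed (nclosure V).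
Proof.
move=> [V0 Vl]; split=> [|a x y hx hy]; first exact: sub_nclosure.
have [s Vs sx] := nclosure_seq hx; have [s' Vs' sy] := nclosure_seq hy.
apply: (@ncvg_nclosure _ _ _ (fun n => a *: s n + s' n)).
  by exists 0%N => n _; apply: Vl.
by apply: ncvgD => //; apply: ncvgZ.
Qed.

Lemma star_closed_nclosure V : lin_closed V -> V 1 ->
  (forall x y, V x -> V y -> V (x * y)) -> (forall x, V x -> V (adj x)) ->
  star_closed (nclosure V).
Proof.
move=> lV V1 VM Va; split; first exact: lin_closed_nclosure.
- exact: sub_nclosure.
- move=> x y hx hy; have [s Vs sx] := nclosure_seq hx.
  have [s' Vs' sy] := nclosure_seq hy.
  apply: nclosure_idem; apply: (@ncvg_nclosure _ _ _ (fun n => s n * y)).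
    exists 0%N => n _; apply: (@ncvg_nclosure _ _ _ (fun m => s n * s' m)).
      by exists 0%N => m _; apply: VM.
    exact: ncvgMl.
  exact: ncvgMr.
- move=> x hx; have [s Vs sx] := nclosure_seq hx.
  apply: (@ncvg_nclosure _ _ _ (fun n => adj (s n))); last exact: ncvg_adj.
  by exists 0%N => n _; apply: Va.
- exact: nclosure_idem.
Qed.

End LinearSpan.

Section Bits.

Fixpoint bits (T : nat) : seq (seq bool) :=
  if T is T'.+1 then [seq rcons s b | s <- bits T', b <- [:: false; true]]
  else [:: [::]].

Lemma mem_bits T s : (s \in bits T) = (size s == T).
Proof.
elim: T s => [|T ih] s; first by rewrite inE; case: s.
apply/allpairsP/eqP => [[[u b] /= [+ _ ->]]|].
  by rewrite ih size_rcons => /eqP ->.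
case/lastP: s => // s b; rewrite size_rcons => -[sT].
by exists (s, b); split; rewrite ?ih ?sT //=; case: b.
Qed.

Lemma bits_uniq T : uniq (bits T).
Proof.
elim: T => // T ih; apply: allpairs_uniq => // -[s b] [u c] _ _ /= h.
by case/rcons_inj: h => -> ->.
Qed.

Lemma sum_bitsS (M : nmodType) T (F : seq bool -> M) :
  \sum_(s <- bits T.+1) F s =
  \sum_(s <- bits T) (F (rcons s false) + F (rcons s true)).
Proof.
rewrite (_ : bits T.+1 = [seq rcons s b | s <- bits T, b <- [:: false; true]]) //.
rewrite big_allpairs_dep; apply: eq_bigr => s _.
by rewrite big_cons big_seq1.
Qed.

End Bits.

Section MatrixUnits.
Variables (R : realType) (A : ucstarAlgType R).

Definition matrix_units (r : nat -> bool -> bool -> A) := [/\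
  forall t a b c d, r t a b * r t c d = if b == c then r t a d else 0,
  forall t a b, adj (r t a b) = r t b a,
  forall t, r t false false + r t true true = 1 &
  forall s t a b c d, s != t -> GRing.comm (r s a b) (r t c d)].

Variable r : nat -> bool -> bool -> A.
Hypothesis hr : matrix_units r.

Let rM t a b c d : r t a b * r t c d = if b == c then r t a d else 0.
Proof. by case: hr. Qed.
Let adj_r t a b : adj (r t a b) = r t b a.
Proof. by case: hr. Qed.
Let sum_r t : r t false false + r t true true = 1.
Proof. by case: hr. Qed.
Let r_comm s t a b c d : s != t -> GRing.comm (r s a b) (r t c d).
Proof. by case: hr => _ _ _; apply. Qed.

(** In the function picture of the diagonal, the indicator of the bit sequences that agree with w
    before T. *)
Fixpoint cylinder (w : nat -> bool) (T : nat) : A :=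
  if T is T'.+1 then cylinder w T' * r T' (w T') (w T') else 1.

Definition proj (s : seq bool) : A := cylinder (nth false s) (size s).

Lemma eq_cylinder w w' T : (forall i, (i < T)%N -> w i = w' i) ->
  cylinder w T = cylinder w' T.
Proof.
elim: T => //= T ih h; rewrite h // ih // => i iT; apply: h; exact: leqW.
Qed.

Lemma proj_rcons s b : proj (rcons s b) = proj s * r (size s) b b.
Proof.
rewrite /proj size_rcons /= nth_rcons ltnn eqxx; congr (_ * _).
by apply: eq_cylinder => i iT; rewrite nth_rcons iT.
Qed.

Lemma projE w T : proj (mkseq w T) = cylinder w T.
Proof.
rewrite /proj size_mkseq; apply: eq_cylinder => i iT.
by rewrite nth_mkseq.
Qed.

Lemma proj_splits s : proj s = proj (rcons s false) + proj (rcons s true).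
Proof. by rewrite !proj_rcons -mulrDr sum_r mulr1. Qed.

Lemma proj_comm_r s t c d : (size s <= t)%N -> GRing.comm (proj s) (r t c d).
Proof.
elim/last_ind: s => [|s b ih]; first by move=> _; apply/commr_sym/commr1.
rewrite size_rcons proj_rcons => st; apply/commr_sym/commrM; apply: commr_sym.
  by apply: ih; apply: ltnW.
by apply: r_comm; rewrite ltn_eqF.
Qed.

Lemma r_diag_comm s t c d : GRing.comm (r s c c) (r t d d).
Proof.
have [<-|/r_comm//] := eqVneq s t.
by rewrite /GRing.comm !rM (eq_sym d); case: eqP => [->|].
Qed.

Lemma proj_comm_diag s t c : GRing.comm (proj s) (r t c c).
Proof.
elim/last_ind: s => [|s b ih]; first by apply/commr_sym/commr1.
by rewrite proj_rcons; apply/commr_sym/commrM; apply: commr_sym => //;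
  apply: r_diag_comm.
Qed.

Lemma proj_comm s s' : GRing.comm (proj s) (proj s').
Proof.
elim/last_ind: s' => [|s' b ih]; first by apply: commr1.
by rewrite proj_rcons; apply: commrM => //; apply: proj_comm_diag.
Qed.

Lemma proj_idem s : proj s * proj s = proj s.
Proof.
elim/last_ind: s => [|s b ih]; first by rewrite /proj /= mulr1.
rewrite proj_rcons -mulrA [r _ _ _ * (_ * _)]mulrA -(proj_comm_diag s).
by rewrite -[proj s * _ * _]mulrA mulrA ih rM eqxx.
Qed.

Lemma adj_proj s : adj (proj s) = proj s.
Proof.
elim/last_ind: s => [|s b ih]; first by rewrite /proj /= adj1.
by rewrite proj_rcons adjM adj_r ih (proj_comm_diag s).
Qed.

Lemma sum_proj T : \sum_(s <- bits T) proj s = 1.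
Proof.
elim: T => [|T ih]; first by rewrite big_seq1.
by rewrite sum_bitsS -{}ih; apply: eq_bigr => s _; rewrite -proj_splits.
Qed.

Lemma proj_orth s s' : size s = size s' -> s != s' -> proj s * proj s' = 0.
Proof.
elim/last_ind: s s' => [|s b ih] s'; first by case: s'.
case/lastP: s' => [|s' b']; rewrite !size_rcons // => -[sz].
rewrite eqseq_rcons negb_and => /orP[ne|ne]; rewrite !proj_rcons.
  rewrite -mulrA [r _ _ _ * (_ * _)]mulrA -(proj_comm_diag s').
  by rewrite -[proj s' * _ * _]mulrA mulrA ih // mul0r.
rewrite sz -mulrA [r _ _ _ * (_ * _)]mulrA -(proj_comm_diag s').
by rewrite -[proj s' * _ * _]mulrA rM (negbTE ne) !mulr0.
Qed.

Lemma proj_mul_diag s t c : (t < size s)%N ->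
  proj s * r t c c = if nth false s t == c then proj s else 0.
Proof.
elim/last_ind: s => // s b ih; rewrite size_rcons ltnS leq_eqVlt => /orP[/eqP ->|ts].
  rewrite proj_rcons nth_rcons ltnn eqxx -mulrA rM; case: eqP => [->|]//.
  by rewrite mulr0.
rewrite proj_rcons nth_rcons ts -mulrA r_diag_comm mulrA ih //.
by case: ifP; rewrite ?mul0r.
Qed.

(** In the function picture, the functions of the first T bits; c is only read at words of length
    T. *)
Definition diag_sum T (c : seq bool -> R[i]) : A := \sum_(s <- bits T) c s *: proj s.

Lemma diag_sumS T c : diag_sum T c = diag_sum T.+1 (fun s => c (take T s)).
Proof.
rewrite /diag_sum sum_bitsS big_seq [RHS]big_seq; apply: eq_bigr => s.
rewrite mem_bits => /eqP sT; rewrite -!cats1 -sT !take_size_cat //.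
by rewrite !cats1 -scalerDr -proj_splits.
Qed.

Lemma diag_sum_proj s : proj s = diag_sum (size s) (fun u => (u == s)%:R).
Proof.
rewrite /diag_sum (bigD1_seq s) ?mem_bits ?bits_uniq //= eqxx scale1r.
by rewrite big1 ?addr0 // => u /negbTE ->; rewrite scale0r.
Qed.

Lemma diag_sum_proj_mul T c s : size s = T -> diag_sum T c * proj s = c s *: proj s.
Proof.
move=> sT; rewrite /diag_sum mulr_suml (bigD1_seq s) ?mem_bits ?bits_uniq ?sT //=.
rewrite -scalerAl proj_idem big_seq_cond big1 ?addr0 // => u /andP[].
by rewrite mem_bits => /eqP uT us; rewrite -scalerAl proj_orth ?scaler0 ?uT.
Qed.

Lemma diag_sumM T c c' :
  diag_sum T c * diag_sum T c' = diag_sum T (fun s => c s * c' s).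
Proof.
rewrite {2 3}/diag_sum mulr_sumr big_seq [RHS]big_seq; apply: eq_bigr => s.
rewrite mem_bits => /eqP sT.
by rewrite -scalerAr diag_sum_proj_mul // scalerA mulrC.
Qed.

Lemma diag_sum_lin T a c c' :
  a *: diag_sum T c + diag_sum T c' = diag_sum T (fun s => a * c s + c' s).
Proof.
rewrite /diag_sum scaler_sumr -big_split; apply: eq_bigr => s _.
by rewrite /= scalerA -scalerDl.
Qed.

Lemma adj_diag_sum T c : adj (diag_sum T c) = diag_sum T (fun s => Num.conj (c s)).
Proof. by rewrite adj_sum; apply: eq_bigr => s _; rewrite adjZ adj_proj. Qed.

Lemma nm_proj_le s : nm (proj s) <= 1.
Proof.
have := nm_cstar (proj s); rewrite adj_proj proj_idem => h.
by rewrite leNgt; apply/negP => x1; move: h; rewrite expr2; nra.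
Qed.

Lemma nm_diag_sum T c C : 0 <= C -> (forall s, size s = T -> cabs (c s) <= C) ->
  nm (diag_sum T c) <= C.
Proof.
move=> C0 h; apply: nm_orth_sum => //; first exact: bits_uniq.
  move=> s u; rewrite !mem_bits => /eqP sT /eqP uT su.
  rewrite !adjZ !adj_proj -!scalerAr -!scalerAl proj_orth ?sT // !scaler0.
  by split.
move=> s; rewrite mem_bits => /eqP/h hs; rewrite nmZ -[leRHS]mulr1.
by rewrite ler_pM ?nm_ge0 ?cabs_ge0 ?nm_proj_le.
Qed.

Definition diag_span : set A := [set x | exists T c, x = diag_sum T c].

Lemma diag_sum_raise T n c : exists c', diag_sum T c = diag_sum (n + T) c'.
Proof.
elim: n => [|n [c' ->]]; first by exists c.
by exists (fun s => c' (take (n + T) s)); rewrite -diag_sumS.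
Qed.

Lemma diag_span2 x y : diag_span x -> diag_span y ->
  exists T c c', x = diag_sum T c /\ y = diag_sum T c'.
Proof.
move=> [T [c ->]] [T' [c' ->]]; exists (T + T')%N.
have [d ->] := diag_sum_raise T T' c; have [d' ->] := diag_sum_raise T' T c'.
by exists d, d'; rewrite addnC.
Qed.

Lemma diag_span_lin : lin_closed diag_span.
Proof.
split=> [|a x y hx hy].
  by exists 0%N, (fun=> 0); rewrite /diag_sum big1 // => s _; rewrite scale0r.
have [T [c [c' [-> ->]]]] := diag_span2 hx hy.
by exists T, (fun s => a * c s + c' s); rewrite diag_sum_lin.
Qed.

Lemma diag_span_mul x y : diag_span x -> diag_span y -> diag_span (x * y).
Proof.
move=> hx hy; have [T [c [c' [-> ->]]]] := diag_span2 hx hy.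
by exists T, (fun s => c s * c' s); rewrite diag_sumM.
Qed.

Lemma diag_span_comm x y : diag_span x -> diag_span y -> GRing.comm x y.
Proof.
move=> hx hy; have [T [c [c' [-> ->]]]] := diag_span2 hx hy.
by rewrite /GRing.comm !diag_sumM; apply: eq_bigr => s _; rewrite mulrC.
Qed.

Lemma diag_span_proj s : diag_span (proj s).
Proof. by rewrite diag_sum_proj; exists (size s), (fun u => (u == s)%:R). Qed.

Lemma diag_span1 : diag_span 1.
Proof. exact: (diag_span_proj [::]). Qed.

Definition diagonal : set A := [set x | forall t c, GRing.comm x (r t c c)].

Lemma diagonal_star_closed : star_closed diagonal.
Proof.
split.
- by split=> [|a x y hx hy] t c; [apply/commr_sym/commr0|];
  rewrite /GRing.comm mulrDl mulrDr -scalerAl -scalerAr hx hy.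
- by move=> t c; apply/commr_sym/commr1.
- by move=> x y hx hy t c; apply/commr_sym/commrM; apply/commr_sym.
- by move=> x hx t c; have := congr1 adj (hx t c); rewrite !adjM adj_r.
- move=> x hx t c; have [s Vs sx] := nclosure_seq hx.
  apply: ncvg_unique (ncvgMr _ sx) _.
  by apply: ncvg_eq (ncvgMl _ sx); exists 0%N => n _; apply/esym/Vs.
Qed.

Lemma proj_diagonal s : diagonal (proj s).
Proof. by move=> t c; apply: proj_comm_diag. Qed.

Lemma diagonal_comm_proj x s : diagonal x -> GRing.comm x (proj s).
Proof.
move=> dx; elim/last_ind: s => [|s b ih]; first by apply: commr1.
by rewrite proj_rcons; apply: commrM.
Qed.

Definition pave T (x : A) : A := \sum_(s <- bits T) proj s * x * proj s.

Lemma pave_lin T (a : R[i]) x y : pave T (a *: x + y) = a *: pave T x + pave T y.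
Proof.
rewrite /pave scaler_sumr -big_split; apply: eq_bigr => s _ /=.
by rewrite mulrDr mulrDl -scalerAr -scalerAl.
Qed.

Lemma pave0 T : pave T 0 = 0.
Proof. by rewrite /pave big1 // => s _; rewrite mulr0 mul0r. Qed.

Lemma paveD T x y : pave T (x + y) = pave T x + pave T y.
Proof. by rewrite -[x in LHS]scale1r pave_lin scale1r. Qed.

Lemma paveB T x y : pave T (x - y) = pave T x - pave T y.
Proof. by rewrite addrC -scaleN1r pave_lin scaleN1r addrC. Qed.

Lemma pave_adj T x : pave T (adj x) = adj (pave T x).
Proof.
by rewrite /pave adj_sum; apply: eq_bigr => s _; rewrite !adjM adj_proj mulrA.
Qed.

Lemma pave_nm T x : nm (pave T x) <= nm x.
Proof.
apply: nm_orth_sum; [exact: bits_uniq|exact: nm_ge0| |].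
  move=> s u; rewrite !mem_bits => /eqP sT /eqP uT su; rewrite !adjM !adj_proj.
  have o : proj s * proj u = 0 by rewrite proj_orth ?sT.
  by rewrite -!mulrA ![proj s * (proj u * _)]mulrA o !(mul0r, mulr0).
move=> s _; rewrite (le_trans (nmM _ _)) // -[leRHS]mulr1.
rewrite ler_pM ?nm_ge0 ?nm_proj_le // (le_trans (nmM _ _)) // -[leRHS]mul1r.
by rewrite ler_pM ?nm_ge0 ?nm_proj_le.
Qed.

Lemma pave_diagonal T d : diagonal d -> pave T d = d.
Proof.
move=> hd; rewrite /pave -[RHS]mulr1 -(sum_proj T) mulr_sumr; apply: eq_bigr => s _.
by rewrite -(diagonal_comm_proj s hd) -mulrA proj_idem.
Qed.

Lemma pave_bimod T d x d' : diagonal d -> diagonal d' ->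
  pave T (d * x * d') = d * pave T x * d'.
Proof.
move=> hd hd'; rewrite /pave mulr_sumr mulr_suml; apply: eq_bigr => s _.
rewrite !mulrA -(diagonal_comm_proj s hd) -!mulrA.
by rewrite (diagonal_comm_proj s hd').
Qed.

(** A word longer than t fixes the bit e at level t, so its projection absorbs r^t_ee on either
    side, and r^t_ee r^t_ac r^t_ee vanishes unless a = c. *)
Lemma pave_unit T t a c x : (t < T)%N -> (forall b d, GRing.comm x (r t b d)) ->
  pave T (r t a c * x) = if a == c then r t a a * pave T x else 0.
Proof.
move=> tT hx; rewrite /pave; have [<-|ac] := eqVneq a c.
  rewrite mulr_sumr; apply: eq_bigr => s _.
  by rewrite !mulrA (proj_comm_diag s).
rewrite big_seq big1 // => s; rewrite mem_bits => /eqP sT.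
set e := nth false s t.
have hs : proj s * r t e e = proj s by rewrite proj_mul_diag ?eqxx // sT.
have hs' : r t e e * proj s = proj s by rewrite -(proj_comm_diag s).
have h0 : r t e e * (r t a c * r t e e) = 0.
  by rewrite rM; case: eqP => [ce|_]; rewrite ?mulr0 // rM -ce eq_sym (negbTE ac).
rewrite -{1}hs -[X in _ * X]hs' !mulrA -(mulrA _ x) hx !mulrA.
by rewrite -2!(mulrA (proj s)) -(mulrA (r t e e)) h0 mulr0 !mul0r.
Qed.

End MatrixUnits.

(** * The conditional expectation *)

Section Odometer.
Variables (R : realType) (A : ucstarAlgType R).
Variables (r : nat -> bool -> bool -> A) (v : nat -> A) (flip : pred nat).

Definition odometer := [/\
  forall t, adj (v t) * v t = 1 /\ v t * adj (v t) = 1,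
  forall i t a b, (i < t)%N -> GRing.comm (v t) (r i a b),
  forall t, v t = if flip t
    then r t false false * v t.+1 + r t true true * adj (v t.+1)
    else r t true false + r t false true * v t.+1,
  forall t, exists2 t', (t <= t')%N & ~~ flip t' &
  generating ([set x | exists t a b, x = r t a b] `|` range v)].

Hypotheses (hr : matrix_units r) (hv : odometer).

Let rM t a b c d : r t a b * r t c d = if b == c then r t a d else 0.
Proof. by case: hr. Qed.
Let adj_r t a b : adj (r t a b) = r t b a.
Proof. by case: hr. Qed.
Let sum_r t : r t false false + r t true true = 1.
Proof. by case: hr. Qed.
Let r_comm s t a b c d : s != t -> GRing.comm (r s a b) (r t c d).
Proof. by case: hr => _ _ _; apply. Qed.
Let vu t : adj (v t) * v t = 1.
Proof. by case: hv => /(_ t)[]. Qed.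
Let vu' t : v t * adj (v t) = 1.
Proof. by case: hv => /(_ t)[]. Qed.
Let v_comm i t a b : (i < t)%N -> GRing.comm (v t) (r i a b).
Proof. by case: hv => _ h _ _ _; apply: h. Qed.
Let v_step t : v t = if flip t
    then r t false false * v t.+1 + r t true true * adj (v t.+1)
    else r t true false + r t false true * v t.+1.
Proof. by case: hv. Qed.
Let adjv_comm i t a b : (i < t)%N -> GRing.comm (adj (v t)) (r i a b).
Proof. by move=> /(@v_comm _ _ b a) /(congr1 adj); rewrite !adjM adj_r. Qed.

Lemma double_sqr t : ~~ flip t -> v t ^+ 2 = v t.+1.
Proof.
move=> /negbTE ft; rewrite expr2 v_step ft.
have c := v_comm _ _ (ltnSn t).
rewrite mulrDl !mulrDr !mulrA !rM /= add0r -!mulrA c [r _ _ _ * (_ * _)]mulrA rM.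
by rewrite [v _ * (_ * _)]mulrA c -mulrA [r _ _ _ * (r _ _ _ * _)]mulrA rM /= mul0r
  addr0 -mulrDl addrC sum_r mul1r.
Qed.

Lemma flip_pow t n : flip t ->
  v t ^+ n = r t false false * v t.+1 ^+ n + r t true true * adj (v t.+1) ^+ n.
Proof.
move=> ft; elim: n => [|n ih]; first by rewrite !expr0 !mulr1 sum_r.
have c := v_comm _ _ (ltnSn t); have c' := adjv_comm _ _ (ltnSn t).
rewrite exprS ih [X in X * _]v_step ft mulrDl !mulrDr -!mulrA.
rewrite ![v t.+1 * (r _ _ _ * _)]mulrA ![adj _ * (r _ _ _ * _)]mulrA !c !c' !mulrA.
by rewrite !rM /= !mul0r addr0 add0r -!mulrA -!exprS.
Qed.

Lemma comm_vpow t n i a b : (i < t)%N -> GRing.comm (v t ^+ n) (r i a b).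
Proof. by move=> it; apply/commr_sym/commrX/commr_sym/v_comm. Qed.

(** Strong induction on n, and inside it on the distance k to the next doubling level. At a
    doubling, v_t^n is v_(t+1)^(n/2) for even n, and v_t times a power of v_(t+1), hence
    off-diagonal, for odd n. At a flip the n-th powers of v_(t+1) and of its adjoint stand on the
    diagonal, and the doubling is one level closer. *)
Lemma pave_vpow n t : (0 < n)%N ->
  exists T0, forall T, (T0 <= T)%N -> pave r T (v t ^+ n) = 0.
Proof.
have [m] := ubnP n; elim: m n t => // m ihm n t; rewrite ltnS => nm n0.
have nf u : ~~ flip u ->
    exists T0, forall T, (T0 <= T)%N -> pave r T (v u ^+ n) = 0.
  move=> fu; rewrite -(odd_double_half n) -mul2n exprD exprM double_sqr //.
  have [on|en] := boolP (odd n).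
    exists u.+1 => T uT; rewrite expr1 {1}v_step (negbTE fu) mulrDl -!mulrA -exprS.
    by rewrite paveD !(pave_unit hr) //= ?addr0 // => b d; apply: comm_vpow.
  rewrite expr0 mul1r; apply: ihm.
    by apply: leq_trans nm; rewrite -[ltnRHS](odd_double_half n) (negbTE en); lia.
  by rewrite half_gt0; case: n n0 en {nm} => [|[]].
have [t' tt' ft'] : exists2 t', (t <= t')%N & ~~ flip t' by case: hv => _ _ _ h _; apply: h.
rewrite -(subnK tt') addnC in ft'; move: {t' tt'} (t' - t)%N ft' => k.
elim: k t => [|k ihk] t; first by rewrite addn0; apply: nf.
have [ft|/nf//] := boolP (flip t).
rewrite addnS -addSn => /ihk[T0 hT]; exists (maxn T0 t.+1) => T.
rewrite geq_max => /andP[/hT h tT]; rewrite flip_pow // paveD.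
rewrite !(pave_unit hr) //= ?h ?mulr0 ?add0r; last first.
- by move=> b d; apply: comm_vpow.
- by move=> b d; apply/commr_sym/commrX/commr_sym/adjv_comm.
by rewrite -adjX (pave_adj hr) h adj0 mulr0.
Qed.

(** The matrix units of the copy of M_(2^T) formed by the first T levels. *)
Fixpoint words (T : nat) : set A :=
  if T is T'.+1 then [set x | exists w a b, words T' w /\ x = w * r T' a b]
  else [set 1].

Lemma word_comm T w i a b : words T w -> (T <= i)%N -> GRing.comm w (r i a b).
Proof.
elim: T w => [|T ih] w /=; first by move=> -> _; apply/commr_sym/commr1.
move=> [w' [c [d [hw ->]]]] Ti; apply/commr_sym/commrM; apply/commr_sym.
  by apply: ih => //; apply: ltnW.
by apply: r_comm; rewrite ltn_eqF.
Qed.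

Lemma word_comm_v T w : words T w -> GRing.comm w (v T) /\ GRing.comm w (adj (v T)).
Proof.
have h k : (k <= T)%N -> forall w, words k w ->
    GRing.comm w (v T) /\ GRing.comm w (adj (v T)).
  elim: k => [|k ih] kT u /=.
    by move=> ->; split; apply/commr_sym/commr1.
  move=> [u' [c [d [hu ->]]]]; have [h1 h2] := ih (ltnW kT) _ hu.
  by split; apply/commr_sym/commrM; (try by apply/commr_sym);
    [apply: v_comm|apply: adjv_comm].
exact: (h T (leqnn T) w).
Qed.

Lemma lspan_word_mul T x a b : lspan (words T) x -> lspan (words T.+1) (x * r T a b).
Proof.
move=> hx; have [z0 zl] := lspan_lin (words T.+1).
apply: (hx [set x | lspan (words T.+1) (x * r T a b)]).
  by split=> [|c u w /= hu hw]; rewrite /= ?mul0r // mulrDl -scalerAl; apply: zl.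
by move=> w hw; apply: sub_lspan; exists w, a, b.
Qed.

Lemma words_mul T x y : words T x -> words T y -> lspan (words T) (x * y).
Proof.
elim: T x y => [|T ih] x y; first by move=> -> ->; apply: sub_lspan; rewrite /= mulr1.
move=> [w [a [b [hw ->]]]] [w' [c [d [hw' ->]]]].
rewrite -mulrA [r _ _ _ * (_ * _)]mulrA -(word_comm a b hw') // -mulrA mulrA rM.
case: eqP => _; last by rewrite mulr0; case: (lspan_lin (words T.+1)).
by apply: lspan_word_mul; apply: ih.
Qed.

Lemma word_adj T x : words T x -> words T (adj x).
Proof.
elim: T x => [|T ih] x; first by move=> ->; rewrite /= adj1.
move=> [w [a [b [hw ->]]]]; exists (adj w), b, a; split; first exact: ih.
by rewrite adjM adj_r (word_comm b a (ih _ hw)).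
Qed.

Lemma word_raise T x : words T x -> lspan (words T.+1) x.
Proof.
move=> hx; rewrite -[x]mulr1 -(sum_r T) mulrDr.
by apply: (lin_closedD (lspan_lin _)); apply: lspan_word_mul; apply: sub_lspan.
Qed.

Lemma words1 T : lspan (words T) 1.
Proof.
elim: T => [|T ih]; first exact: sub_lspan.
by apply: (lspan_ind (lspan_lin _) _ ih) => x; apply: word_raise.
Qed.

Definition powers T : set A :=
  [set x | exists n, x = v T ^+ n \/ x = adj (v T) ^+ n].

(** Words commute with v_T, and products of powers of the unitary v_T and its adjoint are again such
    powers, so these elements already span a star-algebra. *)
Definition wpowers T : set A := [set x | exists w y, [/\ words T w, powers T y & x = w * y]].

Lemma powers_mul T x y : powers T x -> powers T y -> powers T (x * y).
Proof.
have h n m : v T ^+ n * adj (v T) ^+ m = if (m <= n)%N then v T ^+ (n - m)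
    else adj (v T) ^+ (m - n).
  elim: n m => [|n ih] [|m]; rewrite ?expr0 ?mul1r ?mulr1 ?subn0 //.
  by rewrite exprSr exprS mulrA -(mulrA _ (v T)) vu' mulr1 ih ltnS subSS.
have h' n m : adj (v T) ^+ n * v T ^+ m = if (m <= n)%N then adj (v T) ^+ (n - m)
    else v T ^+ (m - n).
  elim: n m => [|n ih] [|m]; rewrite ?expr0 ?mul1r ?mulr1 ?subn0 //.
  by rewrite exprSr exprS mulrA -(mulrA _ (adj _)) vu mulr1 ih ltnS subSS.
move=> [n [->|->]] [m [->|->]].
- by exists (n + m)%N; left; rewrite exprD.
- by rewrite h; case: ifP => _; [exists (n - m)%N; left|exists (m - n)%N; right].
- by rewrite h'; case: ifP => _; [exists (n - m)%N; right|exists (m - n)%N; left].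
- by exists (n + m)%N; right; rewrite exprD.
Qed.

Lemma powers_adj T x : powers T x -> powers T (adj x).
Proof.
by move=> [n [->|->]]; exists n; rewrite adjX ?adjK; [right|left].
Qed.

Lemma powers_comm_word T x w : powers T x -> words T w -> GRing.comm x w.
Proof.
by move=> [n [->|->]] /word_comm_v[h1 h2]; apply/commr_sym/commrX.
Qed.

Lemma powers_comm T x i a b : powers T x -> (i < T)%N -> GRing.comm x (r i a b).
Proof.
by move=> [n [->|->]] iT; apply/commr_sym/commrX/commr_sym; [apply: v_comm|apply: adjv_comm].
Qed.

Lemma lspan_wpow T x y : lspan (words T) x -> powers T y -> lspan (wpowers T) (x * y).
Proof.
move=> hx hy; have [z0 zl] := lspan_lin (wpowers T).
apply: (hx [set x | lspan (wpowers T) (x * y)]).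
  by split=> [|c u w /= hu hw]; rewrite /= ?mul0r // mulrDl -scalerAl; apply: zl.
by move=> w hw; apply: sub_lspan; exists w, y.
Qed.

Lemma wpowers_mul T x y :
  lspan (wpowers T) x -> lspan (wpowers T) y -> lspan (wpowers T) (x * y).
Proof.
move: x y; apply: lspan_mul => _ _ [w [y [hw hy ->]]] [w' [y' [hw' hy' ->]]].
rewrite -mulrA [y * (_ * _)]mulrA (powers_comm_word hy hw') -mulrA mulrA.
by apply: lspan_wpow; [apply: words_mul|apply: powers_mul].
Qed.

Lemma wpowers_adj T x : lspan (wpowers T) x -> lspan (wpowers T) (adj x).
Proof.
move: x; apply: lspan_adj => _ [w [y [hw hy ->]]]; apply: sub_lspan.
exists (adj w), (adj y); split; [exact: word_adj|exact: powers_adj|].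
by rewrite adjM (powers_comm_word (powers_adj hy) (word_adj hw)).
Qed.

Lemma powers1 T : powers T 1.
Proof. by exists 0%N; left; rewrite expr0. Qed.

Lemma wpowers_word T x : lspan (words T) x -> lspan (wpowers T) x.
Proof. by move=> hx; rewrite -[x]mulr1; apply: lspan_wpow => //; apply: powers1. Qed.

Lemma wpowers_v T : lspan (wpowers T) (v T).
Proof.
rewrite -[v T]mul1r; apply: lspan_wpow; first exact: words1.
by exists 1%N; left; rewrite expr1.
Qed.

Lemma wpowers_r T a b : lspan (wpowers T.+1) (r T a b).
Proof. by rewrite -[r _ _ _]mul1r; apply: wpowers_word; apply: lspan_word_mul; apply: words1. Qed.

Lemma wpowers_step T : lspan (wpowers T.+1) (v T).
Proof.
rewrite v_step; have l := lspan_lin (wpowers T.+1).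
case: ifP => _; apply: (lin_closedD l); try exact: wpowers_r;
  apply: wpowers_mul; try exact: wpowers_r; try exact: wpowers_v.
by apply: wpowers_adj; apply: wpowers_v.
Qed.

Lemma wpowers1 T : lspan (wpowers T) 1.
Proof. by apply: wpowers_word; apply: words1. Qed.

Lemma wpowers_raise T x : lspan (wpowers T) x -> lspan (wpowers T.+1) x.
Proof.
apply: lspan_ind; first exact: lspan_lin.
move=> _ [w [y [hw hy ->]]]; apply: wpowers_mul.
  apply: wpowers_word; exact: word_raise.
have hX z n : lspan (wpowers T.+1) z -> lspan (wpowers T.+1) (z ^+ n).
  move=> hz; elim: n => [|n ih]; first by rewrite expr0; apply: wpowers1.
  by rewrite exprS; apply: wpowers_mul.
by case: hy => n [->|->]; apply: hX; rewrite -?/(adj _); [|apply: wpowers_adj];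
  apply: wpowers_step.
Qed.

Definition odo_alg : set A := [set x | exists T, lspan (wpowers T) x].

Lemma odo_alg_raise T T' x : (T <= T')%N -> lspan (wpowers T) x -> lspan (wpowers T') x.
Proof.
by move=> /subnK <-; elim: (T' - T)%N => // n ih /ih; apply: wpowers_raise.
Qed.

Lemma odo_alg_dense x : nclosure odo_alg x.
Proof.
case: hv => _ _ _ _ /(_ (nclosure odo_alg)) -> //.
  apply: star_closed_nclosure.
  - split; first by exists 0%N; case: (lspan_lin (wpowers 0)).
    move=> a y z [T hy] [T' hz]; exists (maxn T T').
    case: (lspan_lin (wpowers (maxn T T'))) => _; apply.
      by apply: odo_alg_raise hy; apply: leq_maxl.
    by apply: odo_alg_raise hz; apply: leq_maxr.
  - by exists 0%N; apply: wpowers1.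
  - move=> y z [T hy] [T' hz]; exists (maxn T T'); apply: wpowers_mul.
      by apply: odo_alg_raise hy; apply: leq_maxl.
    by apply: odo_alg_raise hz; apply: leq_maxr.
  - by move=> y [T hy]; exists T; apply: wpowers_adj.
move=> y [[t [a [b ->]]]|[t _ <-]]; apply: sub_nclosure.
  by exists t.+1; apply: wpowers_r.
by exists t; apply: wpowers_v.
Qed.

(** The witness d is w itself when all its units are diagonal, and 0 otherwise. *)
Lemma pave_word T w : words T w -> exists2 d, diag_span r d &
  forall T' x, (T <= T')%N -> (forall i a b, (i < T)%N -> GRing.comm x (r i a b)) ->
    pave r T' (w * x) = d * pave r T' x.
Proof.
elim: T w => [|T ih] w /=.
  by move=> ->; exists 1 => [|T' x _ _]; [apply: diag_span1|rewrite !mul1r].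
move=> [w' [a [b [/ih[d hd h] ->]]]].
exists (if a == b then d * r T a a else 0).
  case: ifP => _; last by case: (diag_span_lin hr).
  apply: (diag_span_mul hr) => //.
  have -> : r T a a = \sum_(s <- bits T) proj r (rcons s a).
    rewrite -[LHS]mul1r -(sum_proj hr T) mulr_suml big_seq [RHS]big_seq.
    by apply: eq_bigr => s; rewrite mem_bits proj_rcons => /eqP ->.
  apply: lin_closed_sum; first exact: diag_span_lin.
  by move=> s _; apply: diag_span_proj.
move=> T' x TT' hx; rewrite -mulrA h ?(ltnW TT') //; last first.
  move=> i c e iT; apply/commr_sym/commrM; apply/commr_sym.
    by apply: r_comm; rewrite gtn_eqF.
  by apply: hx; apply: ltnW.
rewrite (pave_unit hr) //; last by move=> c e; apply: hx.
by case: ifP => _; rewrite ?mulr0 ?mul0r // mulrA.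
Qed.

(** On a word times a power of v_T, paving leaves the diagonal part of the word if the power is 1,
    and is eventually 0 otherwise. *)
Lemma pave_odo_alg x : odo_alg x ->
  exists2 d, diag_span r d & exists T0, forall T, (T0 <= T)%N -> pave r T x = d.
Proof.
move=> [T]; apply: (@lspan_ind _ _ _ [set x | exists2 d, diag_span r d &
    exists T0, forall T, (T0 <= T)%N -> pave r T x = d]).
  split; first by exists 0; [case: (diag_span_lin hr)|exists 0%N => ? _; rewrite pave0].
  move=> a y z [d hd [N hN]] [d' hd' [N' hN']]; exists (a *: d + d').
    by case: (diag_span_lin hr) => _; apply.
  exists (maxn N N') => T0; rewrite geq_max => /andP[/hN h1 /hN' h2].
  by rewrite pave_lin h1 h2.
move=> _ [w [y [/pave_word[d hd h] hy ->]]] /=.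
have hc i a b : (i < T)%N -> GRing.comm y (r i a b) by apply: powers_comm.
have [n0|[n [n0 hn]]] : y = 1 \/ exists n, (0 < n)%N /\ (y = v T ^+ n \/ y = adj (v T ^+ n)).
- case: hy => -[|n] hy; first by left; case: hy => ->; rewrite expr0.
  by right; exists n.+1; split=> //; rewrite adjX.
- exists d => //; exists T => T' /h -> //.
  by rewrite n0 (pave_diagonal hr) ?mulr1 // => t c; apply/commr_sym/commr1.
- exists 0; first by case: (diag_span_lin hr).
  have [T0 hT] := pave_vpow T n0; exists (maxn T T0) => T'.
  rewrite geq_max => /andP[/h -> // /hT]; case: hn => ->.
    by move=> ->; rewrite mulr0.
  by rewrite (pave_adj hr) => ->; rewrite adj0 mulr0.
Qed.

(** Pavings are contractive, so eventual constancy on a dense set gives convergence everywhere. *)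
Lemma pave_cvg x : exists2 d, nclosure (diag_span r) d & ncvg (fun T => pave r T x) d.
Proof.
have hc : ncauchy (fun T => pave r T x).
  move=> e e0; have [|y /pave_odo_alg[d _ [N hN]] xy] := odo_alg_dense x (e := e / 2).
    lra.
  exists N => m n /hN hm /hN hn; have := nm_tri (pave r m x) d (pave r n x).
  have := pave_nm hr m (x - y); have := pave_nm hr n (x - y).
  by rewrite !paveB hm hn (nmBC d); lra.
have [d hd] := nm_complete _ hc; exists d => // e e0.
have [|y /pave_odo_alg[d' hd' [N hN]] xy] := odo_alg_dense x (e := e / 2); first lra.
exists d' => //; have [|M hM] := hd (e / 2); first lra.
have := hM _ (leq_maxr N M); have := pave_nm hr (maxn N M) (x - y).
rewrite paveB (hN _ (leq_maxl _ _)); have := nm_tri d (pave r (maxn N M) x) d'.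
by rewrite (nmBC d (pave _ _ _)); lra.
Qed.

Definition cexp (x : A) : A := projT1 (cid2 (pave_cvg x)).

Lemma cexp_closure x : nclosure (diag_span r) (cexp x).
Proof. by rewrite /cexp; case: cid2. Qed.

Lemma cexp_cvg x : ncvg (fun T => pave r T x) (cexp x).
Proof. by rewrite /cexp; case: cid2. Qed.

Lemma diag_span_diagonal : diag_span r `<=` diagonal r.
Proof.
move=> _ [T [c ->]]; have [lin _ _ _ _] := diagonal_star_closed hr.
apply: (lin_closed_sum lin) => s _; apply: (lin_closedZ _ lin).
exact: proj_diagonal.
Qed.

(** An element that commutes with the diagonal units is fixed by every paving, hence equals its
    expectation, which lies in the closure. *)
Lemma closure_diag_span : nclosure (diag_span r) = diagonal r.
Proof.
apply/seteqP; split=> [x /(nclosure_sub diag_span_diagonal)|x hx].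
  by case: (diagonal_star_closed hr) => _ _ _ _; apply.
suff <- : cexp x = x by exact: cexp_closure.
apply: ncvg_unique (cexp_cvg x) _; apply: ncvg_eq (ncvg_cst x).
by exists 0%N => T _; rewrite (pave_diagonal hr).
Qed.

Lemma cexp_diagonal x : diagonal r (cexp x).
Proof. by rewrite -closure_diag_span; apply: cexp_closure. Qed.

Lemma cexp_id d : diagonal r d -> cexp d = d.
Proof.
move=> hd; apply: ncvg_unique (cexp_cvg d) _; apply: ncvg_eq (ncvg_cst d).
by exists 0%N => T _; rewrite (pave_diagonal hr).
Qed.

Lemma cexp_lin (a : R[i]) x y : cexp (a *: x + y) = a *: cexp x + cexp y.
Proof.
apply: ncvg_unique (cexp_cvg _) _.
apply: ncvg_eq (ncvgD (ncvgZ a (cexp_cvg x)) (cexp_cvg y)).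
by exists 0%N => T _; rewrite pave_lin.
Qed.

Lemma cexp_bimod d x d' : diagonal r d -> diagonal r d' ->
  cexp (d * x * d') = d * cexp x * d'.
Proof.
move=> hd hd'; apply: ncvg_unique (cexp_cvg _) _.
apply: ncvg_eq (ncvgMr d' (ncvgMl d (cexp_cvg x))).
by exists 0%N => T _; rewrite pave_bimod.
Qed.

Lemma cexp_nm x : nm (cexp x) <= nm x.
Proof.
by apply: ncvg_nm_le (cexp_cvg x); exists 0%N => T _; apply: (pave_nm hr).
Qed.

Lemma diagonal_comm x y : diagonal r x -> diagonal r y -> GRing.comm x y.
Proof.
rewrite -closure_diag_span => hx hy.
have [s hs sx] := nclosure_seq hx; have [s' hs' sy] := nclosure_seq hy.
have h n : GRing.comm x (s' n).
  apply: ncvg_unique (ncvgMr _ sx) _; apply: ncvg_eq (ncvgMl (s' n) sx).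
  by exists 0%N => m _; apply: (diag_span_comm hr).
apply: ncvg_unique (ncvgMl _ sy) _; apply: ncvg_eq (ncvgMr x sy).
by exists 0%N => m _; rewrite h.
Qed.

Lemma cexp_vpow t n : (0 < n)%N -> cexp (v t ^+ n) = 0.
Proof.
move=> /(pave_vpow t)[N hN]; apply: ncvg_unique (cexp_cvg _) _.
by apply: ncvg_eq (ncvg_cst 0); exists N => T /hN.
Qed.

End Odometer.

(** * Normalisers of the diagonal *)

Lemma comm_mulA (R : pzRingType) (x y z : R) : GRing.comm x y -> x * (y * z) = y * (x * z).
Proof. by move=> xy; rewrite mulrA xy mulrA. Qed.

Section Normalisers.
Variables (R : realType) (A : ucstarAlgType R).
Variables (r : nat -> bool -> bool -> A) (v : nat -> A) (flip : pred nat).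
Hypotheses (hr : matrix_units r) (hv : odometer r v flip).
Local Notation D := (diagonal r).

Let DM x y : D x -> D y -> D (x * y).
Proof. by case: (diagonal_star_closed hr) => _ _ h _ _; apply: h. Qed.
Let DD x y : D x -> D y -> D (x + y).
Proof. by case: (diagonal_star_closed hr) => h _ _ _ _; apply: lin_closedD. Qed.
Let Dr t c : D (r t c c).
Proof. by move=> s d; apply: r_diag_comm. Qed.

Lemma unit_normalises t a b x : D x -> D (r t a b * x * r t b a).
Proof.
case: (hr) => rM _ _ rC hx i c; have [->|it] := eqVneq i t.
  rewrite /GRing.comm !mulrA rM -!mulrA rM.
  by rewrite (eq_sym c); case: eqP => [->|_]; rewrite ?mulr0 ?mul0r.
by apply/commr_sym; apply: commrM; [apply: commrM => //; [apply: rC|apply: commr_sym]|apply: rC].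
Qed.

(** Units before level t commute with v_t, and those of level t are fixed or exchanged. A later unit
    is conjugated by v_(t+1) inside the blocks of level t, whence the induction on i - t. *)
Lemma conj_unit t i c :
  D (adj (v t) * r i c c * v t) /\ D (v t * r i c c * adj (v t)).
Proof.
case: (hr) => rM adj_r sum_r rC; case: (hv) => vu vC vS _ _.
have vC' u j a b : (j < u)%N -> GRing.comm (adj (v u)) (r j a b).
  by move=> /(vC _ _ b a) /(congr1 adj); rewrite !adjM adj_r.
have rMA u a b b' d z : r u a b * (r u b' d * z) = if b == b' then r u a d * z else 0.
  by rewrite mulrA rM; case: ifP; rewrite ?mul0r.
have [it|ti] := ltnP i t.
  have [h1 h2] := vu t; split; rewrite -mulrA.
    by rewrite -(vC _ _ _ _ it) mulrA h1 mul1r.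
  by rewrite -(vC' _ _ _ _ it) mulrA h2 mul1r.
rewrite -(subnK ti); move: {ti} (i - t)%N => k; elim: k t => [|k ih] t.
  rewrite add0n; have := vS t; have [y1 y2] := vu t.+1.
  have cy a b := vC _ _ a b (ltnSn t); have cy' a b := vC' _ _ a b (ltnSn t).
  have cyA a b z := comm_mulA z (cy a b); have cyA' a b z := comm_mulA z (cy' a b).
  case: ifP => _ ->; rewrite !(adjD, adjM, adjK, adj_r) !(mulrDl, mulrDr) -!mulrA;
    case: c; do 4! rewrite ?(cy, cyA, cy', cyA', rM, rMA)
      /= ?(mulr0, mul0r, addr0, add0r, y1, y2, mulr1);
    by split; apply: Dr.
have [ih1 ih2] := ih t.+1; move: ih1 ih2; rewrite addnS -addSn.
set X := r _ c c => ih1 ih2; have := vS t.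
have cX a b : GRing.comm X (r t a b) by apply: rC; rewrite gtn_eqF // addSn ltnS leq_addl.
have cXA a b z := comm_mulA z (cX a b).
have cy a b := vC _ _ a b (ltnSn t); have cy' a b := vC' _ _ a b (ltnSn t).
have cyA a b z := comm_mulA z (cy a b); have cyA' a b z := comm_mulA z (cy' a b).
case: ifP => _ ->; rewrite !(adjD, adjM, adjK, adj_r) !(mulrDl, mulrDr) -!mulrA;
  do 4! rewrite ?(cX, cXA, cy, cyA, cy', cyA', rM, rMA) /= ?(mulr0, mul0r, addr0, add0r);
  rewrite !mulrA in ih1 ih2 *; split; apply: DD; rewrite -?mulrA; apply: DM => //;
  rewrite ?mulrA //; apply: Dr.
Qed.

(** As D is a commutant, v x v^* lies in D once x commutes with each v^* r^i_cc v; these lie in D,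
    which is abelian. *)
Lemma odo_normalises t x : D x -> D (v t * x * adj (v t)) /\ D (adj (v t) * x * v t).
Proof.
case: (hv) => vu _ _ _ _ hx; have [h1 h2] := vu t.
split=> i c; have [c1 c2] := conj_unit t i c.
  have := congr1 (fun z => v t * z * adj (v t)) (diagonal_comm hr hv hx c1).
  rewrite /GRing.comm !mulrA h2 mul1r -!mulrA.
  by rewrite h2 mulr1.
have := congr1 (fun z => adj (v t) * z * v t) (diagonal_comm hr hv hx c2).
rewrite /GRing.comm !mulrA h1 mul1r -!mulrA.
by rewrite h1 mulr1.
Qed.

End Normalisers.

(** * The trace and the coefficients of the expectation *)

Section Trace.
Variables (R : realType) (A : ucstarAlgType R).

Definition tracial_state (tau : A -> R[i]) := [/\
  forall (a : R[i]) x y, tau (a *: x + y) = a * tau x + tau y,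
  tau 1 = 1,
  forall x y, tau (x * y) = tau (y * x),
  forall x, 0 <= tau (adj x * x) /\ tau (adj x) = Num.conj (tau x) &
  forall x, cabs (tau x) <= nm x].

Variables (r : nat -> bool -> bool -> A) (tau : A -> R[i]).
Hypotheses (hr : matrix_units r) (ht : tracial_state tau).

Let tau_lin (a : R[i]) x y : tau (a *: x + y) = a * tau x + tau y.
Proof. by case: ht. Qed.
Let tauC x y : tau (x * y) = tau (y * x).
Proof. by case: ht. Qed.

Lemma tau0 : tau 0 = 0.
Proof. by have := tau_lin (-1) 0 0; rewrite scaler0 addr0 mulN1r addNr. Qed.

Lemma tauD x y : tau (x + y) = tau x + tau y.
Proof. by rewrite -[x in LHS]scale1r tau_lin mul1r. Qed.

Lemma tauZ a x : tau (a *: x) = a * tau x.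
Proof. by rewrite -[a *: x]addr0 tau_lin tau0 addr0. Qed.

Lemma tau_sum (I : Type) (s : seq I) (F : I -> A) :
  tau (\sum_(i <- s) F i) = \sum_(i <- s) tau (F i).
Proof.
by elim: s => [|i s ih]; rewrite ?big_nil ?tau0 // !big_cons tauD ih.
Qed.

(* The element sum_c r_cb x r_bc has norm at most |x| and doubles the trace. *)
Lemma tau_proj_le s x : cabs (tau (proj r s * x)) <= 2^-1 ^+ size s * nm x.
Proof.
case: (hr) => rM adj_r sum_r rC.
elim/last_ind: s x => [|s b ih] x.
  by rewrite /proj /= mul1r expr0 mul1r; case: ht.
rewrite proj_rcons size_rcons; set t := size s.
pose y c := r t c b * x * r t b c.
have nr c d : nm (r t c d) <= 1.
  have h : nm (r t d d) = nm (r t d d) ^+ 2 by rewrite -nm_cstar adj_r rM eqxx.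
  have h' : nm (r t c d) ^+ 2 = nm (r t d d) by rewrite -nm_cstar adj_r rM eqxx.
  have h1 : nm (r t d d) <= 1.
    by rewrite leNgt; apply/negP => x1; move: h; rewrite expr2; nra.
  by rewrite leNgt; apply/negP => x1; move: h'; rewrite expr2; nra.
have ny : nm (\sum_(c <- [:: false; true]) y c) <= nm x.
  apply: nm_orth_sum => //; first exact: nm_ge0.
    move=> c d _ _ cd; rewrite /y !adjM !adj_r -!mulrA.
    have h z : r t b c * (r t d b * z) = 0 by rewrite mulrA rM (negbTE cd) mul0r.
    by rewrite !h !mulr0.
  move=> c _; rewrite /y (le_trans (nmM _ _)) // -[leRHS]mulr1 ler_pM ?nm_ge0 //.
  by rewrite (le_trans (nmM _ _)) // -[leRHS]mul1r ler_pM ?nm_ge0.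
have ty c : tau (proj r s * y c) = tau (proj r s * r t b b * x).
  rewrite /y !mulrA tauC !mulrA -(proj_comm_r hr (s := s)) //.
  by rewrite -mulrA -mulrA [r t b c * _]mulrA rM eqxx mulrA.
have := ih (\sum_(c <- [:: false; true]) y c).
have -> : tau (proj r s * \sum_(c <- [:: false; true]) y c) =
    2 * tau (proj r s * r t b b * x).
  by rewrite mulr_sumr tau_sum !big_cons big_nil addr0 !ty mulr_natl.
rewrite cabsM.
have -> : cabs (2 : R[i]) = 2 by rewrite -(rmorph_nat (real_complex R)) cabsR normr_nat.
move=> h; rewrite -(@ler_pM2l _ 2) // (le_trans h) // exprS !mulrA divff // mul1r.
by rewrite ler_wpM2l // exprn_ge0 // invr_ge0.
Qed.

Lemma tau_proj s : tau (proj r s) = 2^-1 ^+ size s.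
Proof.
case: (hr) => rM adj_r sum_r rC.
elim/last_ind: s => [|s b ih]; first by rewrite /proj expr0; case: ht.
set t := size s in ih *; rewrite size_rcons -/t exprS -ih.
have h c : tau (proj r (rcons s c)) = tau (proj r (rcons s false)).
  rewrite !proj_rcons -/t.
  have -> : r t c c = r t c false * r t false c by rewrite rM.
  by rewrite mulrA tauC mulrA -(proj_comm_r hr) // -mulrA rM eqxx.
rewrite (proj_splits hr s) tauD (h true) (h b); set a := tau _.
by rewrite -mulr2n -[a *+ 2]mulr_natl mulKf // pnatr_eq0.
Qed.

(** The mean value over the cylinder of s of the function E x, for the measure that gives each
    cylinder of length T the mass 2^-T. *)
Definition coef (s : seq bool) (x : A) : R[i] := 2 ^+ size s * tau (proj r s * x).

Lemma coef_lin s a x y : coef s (a *: x + y) = a * coef s x + coef s y.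
Proof. by rewrite /coef mulrDr -scalerAr tau_lin mulrDr mulrCA. Qed.

Lemma coef_nm s x : cabs (coef s x) <= nm x.
Proof.
rewrite /coef cabsM; have -> : cabs ((2 : R[i]) ^+ size s) = 2 ^+ size s.
  by rewrite -(rmorph_nat (real_complex R)) -rmorphXn cabsR ger0_norm ?exprn_ge0.
apply: le_trans (_ : 2 ^+ size s * (2^-1 ^+ size s * nm x) <= _).
  by rewrite ler_wpM2l ?tau_proj_le // exprn_ge0.
by rewrite mulrA exprVn divff ?mul1r // expf_neq0.
Qed.

Lemma coef_diag_sum s T c : size s = T -> coef s (diag_sum r T c) = c s.
Proof.
move=> sT; rewrite /coef -[proj r s * _](_ : diag_sum r T c * proj r s = _); last first.
  apply: (diag_span_comm hr); last exact: diag_span_proj.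
  by exists T, c.
rewrite (diag_sum_proj_mul hr) // tauZ tau_proj mulrCA exprVn divff ?mulr1 //.
Qed.

Lemma coef_pos s x : 0 <= coef s (adj x * x).
Proof.
rewrite /coef mulr_ge0 ?exprn_ge0 ?ler0n //.
have -> : tau (proj r s * (adj x * x)) = tau (adj (x * proj r s) * (x * proj r s)).
  by rewrite adjM (adj_proj hr) -{1}(proj_idem hr) -mulrA tauC !mulrA.
by case: ht => _ _ _ h _; case: (h (x * proj r s)).
Qed.

(** The trace only sees diagonal blocks. In the limit, coefficients do not change under the
    expectation. *)
Lemma coef_pave s T x : coef s (pave r T x) = coef s x.
Proof.
congr (_ * _); rewrite mulr_sumr tau_sum -[in RHS](mul1r x) -(sum_proj hr T).
rewrite mulr_suml mulr_sumr tau_sum; apply: eq_bigr => u _.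
by rewrite !mulrA tauC !mulrA (proj_comm hr u) -mulrA -mulrA [proj r u * (_ * _)]mulrA
  (proj_idem hr) !mulrA.
Qed.

Lemma coefB s x y : coef s (x - y) = coef s x - coef s y.
Proof. by rewrite addrC -scaleN1r coef_lin mulN1r addrC. Qed.

Lemma coef_ncvg s (f : nat -> A) x l :
  (forall n, coef s (f n) = l) -> ncvg f x -> coef s x = l.
Proof.
move=> h fx; apply/eqP; rewrite -subr_eq0; apply/eqP/cabs_eq0.
apply/eqP; rewrite eq_le cabs_ge0 andbT; apply/ler_addgt0Pl => e /fx[N hN].
rewrite addr0 -(h N) -coefB (le_trans (coef_nm _ _)) //.
by rewrite nmBC; apply/ltW/hN.
Qed.

Variables (v : nat -> A) (flip : pred nat).
Hypothesis hv : odometer r v flip.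

Lemma coef_cexp s x : coef s (cexp hr hv x) = coef s x.
Proof. by apply: coef_ncvg (cexp_cvg hr hv x) => n; apply: coef_pave. Qed.

(** Take any function of T bits close to d: its values are its own coefficients, and coefficients
    are contractive, so the function formed from the coefficients of d is as close to it. *)
Lemma diag_sum_coef_cvg d : diagonal r d ->
  ncvg (fun T => diag_sum r T (coef^~ d)) d.
Proof.
rewrite -(closure_diag_span hr hv) => cd e e0.
have [|_ [T0 [c ->]] dc] := cd (e / 2); first lra.
exists T0 => T TT; have [c' hc'] := diag_sum_raise hr T0 (T - T0) c.
move: hc' dc; rewrite subnK // => -> dc.
apply: le_lt_trans (nm_tri _ (diag_sum r T c') _) _.
rewrite (nmBC _ d); suff : nm (diag_sum r T (coef^~ d) - diag_sum r T c') <= e / 2 by lra.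
rewrite -[_ - _]addrC -scaleN1r (diag_sum_lin r).
apply: (nm_diag_sum hr); first lra.
move=> s sT; rewrite mulN1r addrC -(coef_diag_sum c' sT) -coefB.
by rewrite (le_trans (coef_nm _ _)) // ltW.
Qed.

Hypothesis tau_faithful : forall x, tau (adj x * x) = 0 -> x = 0.

(** The coefficient of the empty word is the trace itself, so the expectation preserves the faithful
    trace. *)
Lemma cexp_faithful x : cexp hr hv (adj x * x) = 0 -> x = 0.
Proof.
move=> h; apply: tau_faithful; have := coef_cexp [::] (adj x * x).
by rewrite h /coef /proj /= expr0 !mul1r tau0 => <-.
Qed.

End Trace.

(** * Square roots of positive semidefinite matrices *)

Section PositiveSqrt.
Variable C : numClosedFieldType.
Local Open Scope sesquilinear_scope.

Definition psd n (M : 'M[C]_n) : Prop :=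
  M^t* = M /\ forall u : 'rV[C]_n, 0 <= (u *m M *m u^t*) 0 0.

Definition psd_sqrt n (M : 'M[C]_n) : 'M[C]_n :=
  (spectralmx M)^t* *m diag_mx (map_mx sqrtC (spectral_diag M)) *m spectralmx M.

Lemma ctM m n p (X : 'M[C]_(m, n)) (Y : 'M[C]_(n, p)) : (X *m Y)^t* = Y^t* *m X^t*.
Proof. by rewrite trmx_mul map_mxM. Qed.

Lemma hermitian_spectral n (M : 'M[C]_n) : M^t* = M ->
  M = (spectralmx M)^t* *m diag_mx (spectral_diag M) *m spectralmx M.
Proof.
move=> hM; rewrite -invmx_unitary ?spectral_unitarymx //; apply/orthomx_spectralP.
by apply/normalmxP; rewrite hM.
Qed.

Lemma unitary_row_form n (P X : 'M[C]_n) i :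
  (P *m X *m P^t*) i i = (row i P *m X *m (row i P)^t*) 0 0.
Proof.
rewrite !mxE; apply: eq_bigr => j _; rewrite !mxE; congr (_ * _).
by apply: eq_bigr => k _; rewrite !mxE.
Qed.

Lemma psd_spectral_ge0 n (M : 'M[C]_n) i : psd M -> 0 <= spectral_diag M 0 i.
Proof.
move=> [hM pM]; have := pM (row i (spectralmx M)).
rewrite -unitary_row_form {2}(hermitian_spectral hM) !mulmxA.
have /unitarymxP uM := spectral_unitarymx M.
by rewrite uM mul1mx -mulmxA uM mulmx1 mxE eqxx mulr1n.
Qed.

Lemma psd_sqrt_psd n (M : 'M[C]_n) : psd M -> psd (psd_sqrt M).
Proof.
move=> pM; rewrite /psd_sqrt; set P := spectralmx M; split.
  rewrite !ctM trmxCK mulmxA; congr (_ *m _ *m _).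
  rewrite tr_diag_mx map_diag_mx; congr diag_mx; apply/rowP => i; rewrite !mxE.
  by apply: geC0_conj; rewrite sqrtC_ge0 psd_spectral_ge0.
move=> u; rewrite !mulmxA -mulmxA -[P *m _]trmxCK ctM trmxCK.
set w := u *m _; rewrite mul_mx_diag mxE; apply: sumr_ge0 => i _.
by rewrite !mxE mulrAC mulr_ge0 ?mul_conjC_ge0 // sqrtC_ge0 psd_spectral_ge0.
Qed.

Lemma psd_sqrtK n (M : 'M[C]_n) : psd M -> psd_sqrt M *m psd_sqrt M = M.
Proof.
move=> [hM pM]; rewrite [RHS](hermitian_spectral hM) /psd_sqrt.
have /unitarymxP uM := spectral_unitarymx M; set P := spectralmx M in uM *.
rewrite !mulmxA; congr (_ *m _); rewrite -!mulmxA [P *m (_ *m _)]mulmxA uM mul1mx.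
congr (_ *m _); rewrite mulmx_diag; congr diag_mx.
by apply/rowP => i; rewrite !mxE -expr2 sqrtCK.
Qed.

Lemma unitary_entry_le1 n (P : 'M[C]_n) i j : P \is unitarymx -> `|P i j| <= 1.
Proof.
move=> /unitarymxP /matrixP /(_ i i); rewrite !mxE eqxx => h.
rewrite -(@ler_pXn2r _ 2) ?nnegrE // expr1n -[leRHS]/(true%:R) -h (bigD1 j) //= !mxE -normCK lerDl.
by apply: sumr_ge0 => k _; rewrite !mxE mul_conjC_ge0.
Qed.

Lemma form_entries_le n (X : 'M[C]_n) (v : 'rV[C]_n) (e : C) :
  (forall j, `|v 0 j| <= 1) -> (forall j k, `|X j k| <= e) ->
  `|(v *m X *m v^t*) 0 0| <= (n ^ 2)%:R * e.
Proof.
move=> hv hX; rewrite mxE (le_trans (ler_norm_sum _ _ _)) //.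
have -> : (n ^ 2)%:R * e = \sum_(j < n) \sum_(k < n) e.
  by rewrite !sumr_const card_ord -mulrnA mulnn mulr_natl.
apply: ler_sum => j _; rewrite !mxE mulr_suml (le_trans (ler_norm_sum _ _ _)) //.
apply: ler_sum => k _; rewrite !normrM norm_conjC -[leRHS]mulr1 ler_pM ?mulr_ge0 //.
by rewrite -[leRHS]mul1r ler_pM.
Qed.

(* An eigenvector v of S - T with eigenvalue l, for S = sqrt M and T = sqrt N, gives
   |v (M - N) v*| = |l| v (S + T) v* >= |l| |v (S - T) v*| = |l|^2. *)
Lemma psd_sqrt_continuous n (M N : 'M[C]_n) (e L : C) : psd M -> psd N ->
  (forall j k, `|M j k - N j k| <= e) -> 0 <= L -> (n ^ 2)%:R * e <= L ^+ 2 ->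
  forall j k, `|psd_sqrt M j k - psd_sqrt N j k| <= n%:R * L.
Proof.
move=> pM pN hMN L0 hL; set S := psd_sqrt M; set T := psd_sqrt N.
have [hS pS] := psd_sqrt_psd pM; have [hT pT] := psd_sqrt_psd pN.
have SS := psd_sqrtK pM; have TT := psd_sqrtK pN.
rewrite -/S in hS pS SS; rewrite -/T in hT pT TT; clearbody S T; pose X := S - T.
have hX : X^t* = X by rewrite /X linearB map_mxB hS hT.
set Q := spectralmx X; set l := spectral_diag X.
have hQ : Q \is unitarymx by apply: spectral_unitarymx.
have /unitarymxP uQ := hQ.
have eX : X = Q^t* *m diag_mx l *m Q by apply: hermitian_spectral.
have lreal i : Num.conj (l 0 i) = l 0 i.
  have := hX; rewrite eX !ctM trmxCK mulmxA => /(congr1 (fun Z => (Q *m Z *m Q^t*) i i)).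
  rewrite !mulmxA uQ !mul1mx -!mulmxA uQ !mulmx1 tr_diag_mx map_diag_mx.
  by rewrite !mxE eqxx !mulr1n.
have le_l i : `|l 0 i| <= L.
  pose v := row i Q.
  have vX : v *m X = l 0 i *: v.
    rewrite /v rowE eX !mulmxA -[_ *m Q *m Q^t*]mulmxA uQ mulmx1.
    by rewrite -(rowE i (diag_mx l)) row_diag_mx -scalemxAl.
  have Xv : X *m v^t* = l 0 i *: v^t*.
    have := congr1 (fun Z => Z^t*) vX; rewrite ctM hX => ->.
    by apply/matrixP => j k; rewrite !mxE rmorphM /= lreal.
  have vv : (v *m v^t*) 0 0 = 1.
    by have := unitary_row_form Q 1%:M i; rewrite !mulmx1 uQ mxE eqxx => <-.
  pose a := (v *m S *m v^t*) 0 0; pose b := (v *m T *m v^t*) 0 0.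
  have ab : a - b = l 0 i.
    rewrite /a /b; have -> : (v *m S *m v^t*) 0 0 - (v *m T *m v^t*) 0 0 = (v *m X *m v^t*) 0 0.
      by rewrite /X mulmxBr mulmxBl [RHS]mxE [X in _ = _ + X]mxE.
    by rewrite vX -scalemxAl mxE vv mulr1.
  have MN : M - N = S *m X + X *m T.
    by rewrite /X mulmxBr mulmxBl SS TT addrA subrK.
  have form : (v *m (M - N) *m v^t*) 0 0 = l 0 i * (a + b).
    rewrite MN mulmxDr mulmxDl mxE -!mulmxA Xv !mulmxA vX -scalemxAr -!scalemxAl.
    by rewrite [X in X + _]mxE [X in _ + X = _]mxE -mulrDr.
  have v1 j : `|v 0 j| <= 1 by rewrite mxE unitary_entry_le1.
  have hMN' j k : `|(M - N) j k| <= e by rewrite !mxE.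
  have := form_entries_le v1 hMN'; rewrite form => h.
  have a0 : 0 <= a := pS _; have b0 : 0 <= b := pT _.
  rewrite -(@ler_pXn2r _ 2) ?nnegrE // (le_trans _ hL) // (le_trans _ h) //.
  rewrite normrM expr2 ler_wpM2l // -ab (le_trans (ler_normB _ _)) //.
  by rewrite !ger0_norm ?addr_ge0.
move=> j k; have -> : S j k - T j k = X j k by rewrite !mxE.
rewrite eX -mulmxA mul_diag_mx mxE (le_trans (ler_norm_sum _ _ _)) //.
rewrite mulr_natl -[n in leRHS]card_ord -sumr_const ler_sum // => i _.
rewrite !mxE !normrM norm_conjC -[leRHS]mul1r ler_pM ?mulr_ge0 ?unitary_entry_le1 //.
by rewrite -[leRHS]mulr1 ler_pM // unitary_entry_le1.
Qed.

End PositiveSqrt.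

(** * Complete positivity of the expectation *)

Section CompletePositivity.
Variables (R : realType) (A : ucstarAlgType R).
Variables (r : nat -> bool -> bool -> A) (v : nat -> A) (flip : pred nat).
Variable tau : A -> R[i].
Hypotheses (hr : matrix_units r) (hv : odometer r v flip) (ht : tracial_state tau).
Local Notation coef := (coef r tau).
Local Notation cexp := (cexp hr hv).

Lemma eventually_all (I : finType) (P : I -> nat -> Prop) :
  (forall i, exists N, forall n, (N <= n)%N -> P i n) ->
  exists N, forall i n, (N <= n)%N -> P i n.
Proof.
move=> /choice[N hN]; exists (\max_i N i)%N => i n hn; apply: hN.
by apply: leq_trans hn; apply: leq_bigmax.
Qed.

Lemma diag_sum_take T T' c : (T <= T')%N ->
  diag_sum r T c = diag_sum r T' (fun s => c (take T s)).
Proof.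
move=> /subnK <-; elim: (T' - T)%N => [|k ih].
  rewrite /diag_sum big_seq [RHS]big_seq; apply: eq_bigr => s.
  by rewrite mem_bits => /eqP {1}<-; rewrite take_size.
rewrite ih addSn (diag_sumS hr); apply: eq_bigr => s _; congr (c _ *: _).
by rewrite take_takel // leq_addl.
Qed.

Lemma tau_adj_coef s x : coef s (adj x) = Num.conj (coef s x).
Proof.
case: (ht) => _ _ tauC tauA _; rewrite /(coef _ _) rmorphM rmorphXn /= conjC_nat.
congr (_ * _); case: (tauA (proj r s * x)) => _ <-; rewrite adjM (adj_proj hr); exact: tauC.
Qed.

Lemma coef_sum s (I : Type) (q : seq I) (F : I -> A) :
  coef s (\sum_(i <- q) F i) = \sum_(i <- q) coef s (F i).
Proof. by rewrite /coef mulr_sumr (tau_sum ht) mulr_sumr. Qed.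

Lemma coefZ s a x : coef s (a *: x) = a * coef s x.
Proof. by rewrite /coef -scalerAr (tauZ ht) mulrCA. Qed.

Variables (n : nat) (Y : 'M[A]_n).
Let X i j := \sum_k adj (Y k i) * Y k j.
Let cm s : 'M[R[i]]_n := \matrix_(i, j) coef s (X i j).

Local Open Scope sesquilinear_scope.

Lemma coef_gram_psd s : psd (cm s).
Proof.
split.
  apply/matrixP => i j; rewrite !mxE -tau_adj_coef; congr (coef _ _).
  by rewrite /X adj_sum; apply: eq_bigr => k _; rewrite adjM adjK.
move=> u; rewrite mxE.
pose y k := \sum_i Num.conj (u 0 i) *: Y k i.
suff -> : \sum_j (u *m cm s) 0 j * (u^t*) j 0 = \sum_k coef s (adj (y k) * y k).
  by apply: sumr_ge0 => k _; apply: (coef_pos hr ht).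
transitivity (\sum_j \sum_i \sum_k u 0 i * Num.conj (u 0 j) * coef s (adj (Y k i) * Y k j)).
  apply: eq_bigr => j _; rewrite !mxE mulr_suml; apply: eq_bigr => i _.
  by rewrite !mxE /X coef_sum mulrAC mulr_sumr.
under eq_bigr do rewrite exchange_big; rewrite exchange_big /=; apply: eq_bigr => k _.
rewrite /y adj_sum big_distrlr /= coef_sum exchange_big /=; apply: eq_bigr => i _.
rewrite coef_sum; apply: eq_bigr => j _.
by rewrite adjZ conjCK -[in RHS]scalerAl -[in RHS]scalerAr [in RHS]scalerA coefZ.
Qed.

Let d i j := cexp (X i j).

Lemma coef_gram s i j : coef s (d i j) = cm s i j.
Proof. by rewrite mxE (coef_cexp hr ht). Qed.

(** Uniform continuity on the Cantor set of the matrix-valued function [cm]: the functions of T bits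
    formed from the coefficients converge in norm, with one rank for the finitely many entries. *)
Lemma gram_uniform (e : R) : 0 < e ->
  exists T0, forall T s, (T0 <= T)%N -> (T <= size s)%N ->
    forall i j, cabs (cm (take T s) i j - cm s i j) <= e.
Proof.
move=> e0; have [N hN] : exists N, forall ij : 'I_n * 'I_n, forall T T', (N <= T)%N ->
    (N <= T')%N -> nm (diag_sum r T (coef^~ (d ij.1 ij.2)) -
      diag_sum r T' (coef^~ (d ij.1 ij.2))) < e.
  have [|N hN] := @eventually_all _ (fun (ij : 'I_n * 'I_n) T => nm (diag_sum r T
      (coef^~ (d ij.1 ij.2)) - d ij.1 ij.2) < e / 2).
    move=> ij; apply: (diag_sum_coef_cvg hr ht hv); last by lra.
    exact: cexp_diagonal.
  exists N => ij T T' /(hN ij) h /(hN ij) h'.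
  by apply: le_lt_trans (nm_tri _ (d ij.1 ij.2) _) _; rewrite (nmBC (d _ _)); lra.
exists N => T s NT Ts i j; have := hN (i, j) T (size s) NT (leq_trans NT Ts) => /=.
move=> /ltW; apply: le_trans; apply: le_trans (coef_nm hr ht s _).
by rewrite (coefB r ht) (diag_sum_take _ Ts) !(coef_diag_sum hr ht) // !coef_gram.
Qed.

Let z T i j := diag_sum r T (fun s => psd_sqrt (cm s) i j).

Lemma sqrt_gram_cauchy i j : ncauchy (fun T => z T i j).
Proof.
(* L and eta are such that n L <= e / 2 and n^2 eta <= L^2, as the estimate on square roots asks; n
   + 1 avoids a division by 0. *)
move=> e e0; pose L := e / 2 / n.+1%:R.
have L0 : 0 < L by rewrite /L !divr_gt0.
pose eta := L ^+ 2 / n.+1%:R ^+ 2.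
have eta0 : 0 < eta by rewrite divr_gt0 ?exprn_gt0.
have [N hN] := gram_uniform eta0; exists N.
have main T T' : (N <= T)%N -> (T <= T')%N -> nm (z T i j - z T' i j) < e.
  move=> NT TT'; rewrite /z (diag_sum_take _ TT') addrC -scaleN1r (diag_sum_lin r).
  apply: le_lt_trans (_ : e / 2 < e); last lra.
  apply: (nm_diag_sum hr); first lra.
  move=> s sT; rewrite mulN1r addrC -lecR -cabsE.
  apply: le_trans (_ : n%:R * L%:C%C <= _).
    apply: (@psd_sqrt_continuous _ _ _ _ eta%:C%C); try exact: coef_gram_psd.
    - by move=> k l; rewrite cabsE lecR; apply: hN; rewrite // sT.
    - by rewrite ler0c ltW.
    rewrite -(rmorph_nat (real_complex R)) -rmorphM -rmorphXn lecR.
    rewrite /eta mulrA ler_pdivrMr ?exprn_gt0 // mulrC ler_wpM2l ?exprn_ge0 ?ltW //.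
    by rewrite -natrX ltr_nat ltn_exp2r.
  rewrite -(rmorph_nat (real_complex R)) -rmorphM lecR /L mulrA ler_pdivrMr //.
  by rewrite mulrC ler_wpM2l ?ler_nat //; lra.
move=> T T' NT NT'; have [TT'|/ltnW T'T] := leqP T T'; first exact: main.
by rewrite nmBC; apply: main.
Qed.

(** The expectation of a Gram matrix is a function on the Cantor set with positive semidefinite
    values. Its pointwise square root is continuous, hence a matrix Z over D, and the square of this
    Hermitian root is a Gram matrix again. *)
Lemma cexp_gram : exists Z : 'M[A]_n, (forall i j, diagonal r (Z i j)) /\
  forall i j, cexp (X i j) = \sum_k adj (Z k i) * Z k j.
Proof.
have /choice[Z hZ] : forall ij : 'I_n * 'I_n, exists l, ncvg (fun T => z T ij.1 ij.2) l.
  by move=> ij; apply/nm_complete/sqrt_gram_cauchy.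
exists (\matrix_(i, j) Z (i, j)); split=> [i j|i j].
  rewrite mxE -(closure_diag_span hr hv); apply: ncvg_nclosure (hZ (i, j)).
  by exists 0%N => T _; exists T, (fun s => psd_sqrt (cm s) i j).
apply: ncvg_unique (diag_sum_coef_cvg hr ht hv (cexp_diagonal hr hv (X i j))) _.
have e T : diag_sum r T (coef^~ (cexp (X i j))) = \sum_k adj (z T k i) * z T k j.
  under eq_bigr do rewrite (adj_diag_sum hr) (diag_sumM hr) /diag_sum.
  rewrite exchange_big; apply: eq_bigr => s _ /=; rewrite -scaler_suml; congr (_ *: _).
  have pS := coef_gram_psd s; have [hS _] := psd_sqrt_psd pS.
  rewrite (coef_gram s i j) -[in LHS](psd_sqrtK pS) mxE; apply: eq_bigr => k _; congr (_ * _).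
  by rewrite -[in LHS]hS !mxE.
apply: ncvg_eq (_ : ncvg (fun T => \sum_k adj (z T k i) * z T k j) _).
  by exists 0%N => T _; rewrite e.
rewrite (_ : \sum_k _ = \sum_k adj (Z (k, i)) * Z (k, j)).
  apply: ncvg_sum => k; apply: ncvgM; first exact/ncvg_adj/(hZ (k, i)).
  exact: (hZ (k, j)).
by apply: eq_bigr => k _; rewrite !mxE.
Qed.

End CompletePositivity.

(** * From normed modules with a unit to unital algebras *)

(** An alias of A that carries the unit and its laws as parameters: instances for it can find them,
    and since it is convertible to A, elements and sets pass between the two views freely. *)
Definition unitalize (R : realType) (A : cstarAlgType R) (e : A)
  (el : left_id e cmul) (er : right_id e cmul) (e0 : e != 0) : Type := A.

Section Unitalize.
Variables (R : realType) (A : cstarAlgType R) (e : A).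
Variables (el : left_id e (@cmul R A)) (er : right_id e (@cmul R A)) (e0 : e != 0).
Local Notation B := (unitalize el er e0).

HB.instance Definition _ := GRing.Lmodule.copy B A.
HB.instance Definition _ :=
  GRing.Zmodule_isNzRing.Build B (@cmulA R A) el er (@cmulDl R A) (@cmulDr R A) e0.
HB.instance Definition _ := GRing.Lmodule_isLalgebra.Build R[i] B
  (fun a x y => esym (cmulZl a x y)).
HB.instance Definition _ := GRing.Lalgebra_isAlgebra.Build R[i] B
  (fun a x y => esym (cmulZr a x y)).

Lemma nrm_cmul (x y : A) : nrm (x ** y) <= nrm x * nrm y.
Proof. by rewrite -lecR rmorphM /= -!nrmE normr_cmul. Qed.

Lemma nrm_cstar (x : A) : nrm (star x ** x) = nrm x ^+ 2.
Proof. by apply: complexI; rewrite rmorphXn /= -!nrmE cstar_identity. Qed.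

HB.instance Definition _ := isUnitalCStar.Build R B (@nrmD R A) (@nrmZ R A)
  (@nrm_eq0 R A) nrm_cmul (@starD R A) (@starZ R A) (@starM R A) (@starK R A)
  nrm_cstar (@nrm_complete R A).

End Unitalize.

Section Transfer.
Variables (R : realType) (A : cstarAlgType R) (e : A).
Variables (el : left_id e (@cmul R A)) (er : right_id e (@cmul R A)) (e0 : e != 0).
Local Notation B := (unitalize el er e0).

Lemma nclosureE (S : set A) : nclosure (S : set B) = closure S.
Proof. by apply/seteqP; split=> x /closureP. Qed.

Lemma star_closed_sub (V : set A) : star_closed (V : set B) -> sub_cstar V.
Proof.
move=> [[V0 Vl] V1 VM Va Vc]; split=> //.
by move=> x; rewrite -(nclosureE V); apply: Vc.
Qed.

End Transfer.

(** * Positive functionals *)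

Section PositiveFunctionals.
Variables (R : realType) (A : ucstarAlgType R) (S : set A) (f : A -> R[i]).
Hypotheses (hS : star_closed S)
  (f_lin : forall (a : R[i]) x y, S x -> S y -> f (a *: x + y) = a * f x + f y)
  (f_pos : forall x, S x -> 0 <= f (adj x * x)).

Let S_lin : lin_closed S. Proof. by case: hS. Qed.
Let SM x y : S x -> S y -> S (x * y). Proof. by case: hS => _ _ h _ _; apply: h. Qed.
Let Sa x : S x -> S (adj x). Proof. by case: hS => _ _ _ h _; apply: h. Qed.
Let S1 : S 1. Proof. by case: hS. Qed.
Let S0 : S 0. Proof. by case: S_lin. Qed.

Lemma pf0 : f 0 = 0.
Proof. by have := f_lin (-1) S0 S0; rewrite scaler0 addr0 mulN1r addNr. Qed.

Lemma pfD x y : S x -> S y -> f (x + y) = f x + f y.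
Proof. by move=> Sx Sy; rewrite -[x in LHS]scale1r f_lin // mul1r. Qed.

Lemma pfZ a x : S x -> f (a *: x) = a * f x.
Proof. by move=> Sx; rewrite -[a *: x]addr0 f_lin // pf0 addr0. Qed.

Lemma pfB x y : S x -> S y -> f (x - y) = f x - f y.
Proof. by move=> Sx Sy; rewrite addrC -scaleN1r f_lin // mulN1r addrC. Qed.

Lemma pf_sum (I : eqType) (q : seq I) (F : I -> A) : (forall i, S (F i)) ->
  f (\sum_(i <- q) F i) = \sum_(i <- q) f (F i).
Proof.
move=> h; elim: q => [|i q ih]; first by rewrite !big_nil pf0.
by rewrite !big_cons pfD ?ih //; apply: (lin_closed_sum S_lin).
Qed.

Lemma pf_expand a x y : S x -> S y ->
  f (adj (x + a *: y) * (x + a *: y)) = f (adj x * x) + a * f (adj x * y)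
    + Num.conj a * f (adj y * x) + a * Num.conj a * f (adj y * y).
Proof.
move=> Sx Sy; have [Sax Say] := (Sa Sx, Sa Sy).
rewrite adjD adjZ mulrDl !mulrDr -!scalerAl -!scalerAr scalerA.
rewrite !pfD ?pfZ -?addrA //; try by do ?[apply: (lin_closedD S_lin)
  | apply: (lin_closedZ _ S_lin) | apply: SM].
by rewrite [a *: (_ * _)](_ : _ = a * (Num.conj a * f (adj y * y))) //; ring.
Qed.

(** Positivity on x + a y makes a w + conj(a) w' real for every scalar a; a = 1 and a = i together
    give w' = conj(w). *)
Lemma pf_conj x y : S x -> S y -> f (adj y * x) = Num.conj (f (adj x * y)).
Proof.
move=> Sx Sy; have px := f_pos Sx; have py := f_pos Sy.
set w := f (adj x * y); set w' := f (adj y * x).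
have h a : a * w + Num.conj a * w' \is Num.real.
  have Sa' : S (x + a *: y).
    by apply: (lin_closedD S_lin) => //; apply: (lin_closedZ _ S_lin).
  have := f_pos Sa'; rewrite (pf_expand _ Sx Sy) => /ger0_real.
  rewrite -[_ + a * f _ + _]addrA addrAC => hr.
  have -> : a * w + Num.conj a * w' = f (adj x * x) + a * Num.conj a * f (adj y * y)
     + (a * w + Num.conj a * w') - (f (adj x * x) + a * Num.conj a * f (adj y * y)).
    by rewrite addrAC subrr add0r.
  apply: realB => //; apply: ger0_real.
  by rewrite addr_ge0 // mulr_ge0 // -normCK exprn_ge0.
have h1 := h 1; have h2 := h 'i; rewrite conjCi rmorph1 !mul1r in h1 h2.
move/CrealP: h1; rewrite rmorphD /= => h1; move/CrealP: h2.
rewrite rmorphD !rmorphM rmorphN /= conjCi => h2.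
have {}h2 : Num.conj w - Num.conj w' = w' - w.
  by apply: (mulfI (neq0Ci _)); move: h2; set i := 'i; move=> h2;
    rewrite -[LHS]opprK -[- (i * _)](_ : - i * Num.conj w + - - i * Num.conj w' = _);
    [rewrite h2; ring|ring].
apply: (mulfI (_ : 2 != 0)); first by rewrite pnatr_eq0.
have -> : 2 * Num.conj w = (Num.conj w + Num.conj w') + (Num.conj w - Num.conj w') by ring.
by rewrite h1 h2; ring.
Qed.

(** Positivity on x - t w y for real t >= 0. The optimal t is 1 / p; if p = 0, a large t forces w =
    0. *)
Lemma pf_cauchy_schwarz x y : S x -> S y ->
  `|f (adj y * x)| ^+ 2 <= f (adj y * y) * f (adj x * x).
Proof.
move=> Sx Sy; set w := f (adj y * x); set p := f (adj y * y); set q := f (adj x * x).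
have p0 : 0 <= p := f_pos Sy; have q0 : 0 <= q := f_pos Sx.
have h (t : R[i]) : 0 <= t -> 0 <= q - 2 * t * `|w| ^+ 2 + t ^+ 2 * `|w| ^+ 2 * p.
  move=> t0; have tc : Num.conj t = t by apply/CrealP/ger0_real.
  have Sa' : S (x - (t * w) *: y).
    rewrite -scaleNr; apply: (lin_closedD S_lin) => //; exact: (lin_closedZ _ S_lin).
  have := f_pos Sa'; rewrite -scaleNr (pf_expand _ Sx Sy) -/w -/p -/q.
  rewrite -[f (adj x * y)]conjCK -pf_conj // -/w !rmorphN !rmorphM /= tc normCK.
  by congr (0 <= _); ring.
have [p00|pn] := eqVneq p 0.
  have [-> |wn] := eqVneq w 0; first by rewrite normr0 expr0n p00 mul0r.
  have w2 : `|w| ^+ 2 != 0 by rewrite expf_neq0 // normr_eq0.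
  (* This t turns the inequality into 0 <= q - (q + 1). *)
  have t0 : 0 <= (q + 1) / (2 * `|w| ^+ 2).
    by rewrite divr_ge0 ?addr_ge0 ?mulr_ge0 ?exprn_ge0.
  have := h _ t0; rewrite p00 mulr0 addr0.
  rewrite (_ : 2 * _ * _ = q + 1); last first.
    by rewrite mulrAC mulrC divfK // mulf_neq0 // pnatr_eq0.
  by rewrite opprD addrA subrr add0r oppr_ge0 => /le_lt_trans/(_ ltr01); rewrite ltxx.
have pp : 0 < p by rewrite lt_def pn.
have := h p^-1; rewrite invr_ge0 => /(_ p0).
have -> : q - 2 * p^-1 * `|w| ^+ 2 + p^-1 ^+ 2 * `|w| ^+ 2 * p = q - `|w| ^+ 2 / p by field.
by rewrite subr_ge0 ler_pdivrMr // mulrC.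
Qed.

Lemma pf_null x y : S x -> S y -> f (adj y * y) = 0 ->
  f (adj y * x) = 0 /\ f (adj x * y) = 0.
Proof.
move=> Sx Sy y0; have := pf_cauchy_schwarz Sx Sy.
rewrite y0 mul0r => h; have w0 : f (adj y * x) = 0.
  apply/eqP; rewrite -normr_eq0 -sqrf_eq0.
  by rewrite eq_le h exprn_ge0.
by split=> //; rewrite pf_conj // w0 rmorph0.
Qed.

(** By Cauchy-Schwarz, |f x|^2 <= f 1 for x in the unit ball, and some such x has |f x| > 1 - e /
    2. *)
Lemma pf_unit : (forall x, S x -> cabs (f x) <= nm x) ->
  (forall e : R, 0 < e -> exists x, [/\ S x, nm x <= 1 & 1 - e < cabs (f x)]) ->
  f 1 = 1.
Proof.
move=> fn f1; have p0 : 0 <= f 1 by have := f_pos S1; rewrite adj1 mulr1.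
rewrite -(ReK p0); congr (_ %:C%C); rewrite [complex.Re _](_ : _ = cabs (f 1)); last first.
  by rewrite /cabs ger0_norm.
apply/eqP; rewrite eq_le; have := fn _ S1; rewrite nm1 => -> /=.
apply/ler_addgt0Pl => e e0; have [x [Sx x1 fx]] := f1 (e / 2) ltac:(lra).
have h2 : cabs (f x) ^+ 2 <= cabs (f 1) * cabs (f (adj x * x)).
  rewrite -lecR rmorphXn rmorphM /= -!cabsE (ger0_norm p0) (ger0_norm (f_pos Sx)).
  by have := pf_cauchy_schwarz Sx S1; rewrite adj1 !mul1r.
have Sxx : S (adj x * x) by apply: SM => //; apply: Sa.
have h1 := fn _ Sxx; rewrite nm_cstar in h1.
have c1 : cabs (f 1) <= 1 by rewrite -(@nm1 _ A) fn.
have c0 := cabs_ge0 (f 1); have d0 := cabs_ge0 (f x); have b0 := nm_ge0 x.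
move: h1 h2 x1 fx c1 c0 d0 b0.
set a := cabs (f (adj x * x)); set b := nm x; set c := cabs (f 1); set d := cabs (f x).
move=> h1 h2 x1 fx c1 c0 d0 b0.
have a1 : a <= 1 by apply: le_trans h1 _; rewrite expr_le1.
have dc : d ^+ 2 <= c by apply: le_trans h2 _; rewrite -[leRHS]mulr1 ler_wpM2l.
have d1 : d <= 1 by rewrite -(@expr_le1 _ 2) // (le_trans dc).
by have := sqr_ge0 (1 - d); move: dc; rewrite !expr2; lra.
Qed.

End PositiveFunctionals.

(** * The diagonal is a C*-diagonal *)

Section Diagonal.
Variables (R : realType) (A : cstarAlgType R) (e : A).
Variables (el : left_id e (@cmul R A)) (er : right_id e (@cmul R A)) (e0 : e != 0).
Local Notation B := (unitalize el er e0).
Variables (r : nat -> bool -> bool -> B) (v : nat -> B) (flip : pred nat).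
Variable tau : B -> R[i].
Hypotheses (hr : matrix_units r) (hv : odometer r v flip) (ht : tracial_state tau).
Hypothesis tau_faithful : forall x : B, tau (adj x * x) = 0 -> x = 0.
Local Notation D := (diagonal r : set A).
Local Notation E := (cexp hr hv : A -> A).

Let nm_le (x y : A) : (`|x| <= `|y|) = (nm (x : B) <= nm (y : B)).
Proof. by rewrite !nrmE lecR. Qed.

Lemma diagonal_masa : masa D.
Proof.
split; first exact: star_closed_sub (diagonal_star_closed hr).
  by move=> x y hx hy; apply: (diagonal_comm hr hv).
move=> V _ aV DV; apply/seteqP; split=> // x Vx t c.
by apply: aV => //; apply: DV => s d; apply: (r_diag_comm hr).
Qed.

Lemma diagonal_regular : smallest (@sub_cstar R A) (normaliser D) = [set: A].
Proof.
case: hv => _ _ _ _; apply.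
  split.
  - split=> [V [[]]//|a x y hx hy V sV]; have [[_ h _ _ _] nV] := sV.
    by apply: h; [apply: hx|apply: hy].
  - move=> V [_ nV]; apply: nV => d hd.
    by rewrite -[star _]/(adj (1 : B)) adj1; split;
      rewrite -[_ ** _ ** _]/((1 : B) * d * 1) mul1r mulr1.
  - move=> x y hx hy V sV; have [[_ _ h _ _] nV] := sV.
    by apply: h; [apply: hx|apply: hy].
  - move=> x hx V sV; have [[_ _ _ h _] nV] := sV.
    by apply: h; apply: hx.
  - move=> x hx V sV; have [[_ _ _ _ h] nV] := sV.
    apply: h; move: hx; rewrite nclosureE => hx U /hx[y [Vy Uy]]; exists y; split=> //.
    exact: Vy.
move=> x hx V [_]; apply=> d hd; case: hx => [[t [a [b ->]]]|[t _ <-]]; last first.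
  exact: (odo_normalises hr hv t).
rewrite -[star _]/(adj (r t a b)); case: (hr) => _ -> _ _.
by split; apply: (unit_normalises hr).
Qed.

Lemma cexp_cond_exp : cond_exp D E.
Proof.
split.
- exact: (cexp_lin hr hv).
- by split=> [x|d]; [apply: cexp_diagonal|apply: cexp_id].
- move=> d x d' hd hd'; exact: (cexp_bimod hr hv).
- move=> n X [Y hX]; have [Z [hZ eZ]] := cexp_gram hr hv ht (Y : 'M[B]_n).
  exists (Z : 'M[A]_n); apply/matrixP => i j.
  by rewrite hX !mxE; apply: eZ.
- by move=> x; rewrite nm_le; apply: (cexp_nm hr hv).
Qed.

(** Any other expectation F onto D satisfies F (p x p) = p F x p for the projections p of D, hence F
    (pave x) = pave (F x) = F x; continuity then gives F x = F (E x) = E x. *)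
Lemma diagonal_cartan : cartan D.
Proof.
split; [exact: diagonal_masa|exact: diagonal_regular|].
exists E; split; first by split;
  [exact: cexp_cond_exp|
   move=> x; exact: (cexp_faithful ht tau_faithful (x := x))].
move=> F [[Flin [FD Fid] Fbi _ Fn] _]; apply/funext => x.
have Dp s : D (proj r s) by apply: proj_diagonal.
have F0 : F 0 = 0 by have := Flin (-1) 0 0; rewrite scaler0 addr0 scaleN1r addNr.
have FD' y z : F (y + z) = F y + F z by rewrite -[y in LHS]scale1r Flin scale1r.
have FB y z : F (y - z) = F y - F z by rewrite addrC -scaleN1r Flin scaleN1r addrC.
have Fpave T : F (pave r T x) = F x.
  have Fsum (q : seq (seq bool)) (G : seq bool -> B) :
      F (\sum_(s <- q) G s) = \sum_(s <- q) F (G s).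
    by elim: q => [|s q ih]; rewrite ?big_nil ?F0 // !big_cons FD' ih.
  rewrite Fsum -[RHS](pave_diagonal hr T) //; apply: eq_bigr => s _.
  exact: (Fbi (proj r s) x (proj r s)).
apply/esym; apply: (@ncvg_unique _ B (fun=> F x)); first exact: ncvg_cst.
move=> eps eps0; have [N hN] := cexp_cvg hr hv x eps0; exists N => n /hN.
apply: le_lt_trans; rewrite -(Fpave n) -{1}[E x](Fid _ (cexp_diagonal hr hv x)) -FB.
by rewrite -nm_le; apply: Fn.
Qed.

Let DM (x y : B) : D x -> D y -> D (x * y).
Proof. by case: (diagonal_star_closed hr) => _ _ h _ _; apply: h. Qed.
Let Da (x : B) : D x -> D (adj x).
Proof. by case: (diagonal_star_closed hr) => _ _ _ h _; apply: h. Qed.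
Let D1 : D (1 : B). Proof. by case: (diagonal_star_closed hr). Qed.
Let DL : @lin_closed R B D. Proof. by case: (diagonal_star_closed hr). Qed.

(* Splitting a pure state f along a projection p of D: unless f p is 0 or 1, f is a
   proper convex combination of the states f (p x) / f p and f ((1 - p) x) / f (1 - p). *)
Lemma state_cut f (p : B) : state_on D f -> D p -> p * p = p -> adj p = p ->
  f p != 0 -> state_on D (fun x : A => f (p * (x : B)) / f p).
Proof.
move=> [flin fpos fn f1] Dp pp ap fp0.
have flin' : forall (a : R[i]) (x y : B), D x -> D y -> f (a *: x + y) = a * f x + f y.
  exact: flin.
have fpos' : forall x : B, D x -> 0 <= f (adj x * x) by exact: fpos.
have fp (x : B) : D x -> 0 <= f (adj x * x) by move=> h; apply: fpos.
have fpp : f p = f (adj p * p) by rewrite ap pp.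
have fpg : 0 <= f p by rewrite fpp; apply: fp.
have pos (x : B) : D x -> 0 <= f (p * (adj x * x)).
  move=> Dx; rewrite -pp -!mulrA -[p * (adj x * x)](_ : adj x * x * p = _); last first.
    by apply: (diagonal_comm hr hv); [apply: DM => //; apply: Da|].
  by rewrite !mulrA -{1}ap -adjM -mulrA; apply: fp; apply: DM.
(* For x a function of T bits with values c_s, f (p x) is the sum of the c_s f (p p_s), with weights
   f (p p_s) >= 0 of total f p. The general case follows by approximation. *)
have bnd (x : B) : D x -> cabs (f (p * x)) <= cabs (f p) * nm x.
  move=> Dx; apply/ler_addgt0Pl => eps eps0.
  have np : nm p <= 1.
    have h : nm p = nm p ^+ 2 by rewrite -nm_cstar ap pp.
    by rewrite leNgt; apply/negP => p1; move: h; rewrite expr2; nra.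
  have bnd' (y : B) : D y -> cabs (f (p * y)) <= nm y.
    move=> Dy; have := fn _ (DM Dp Dy); rewrite nrmE cabsE lecR => h.
    by rewrite (le_trans h) // (le_trans (nmM p y)) // ler_piMl // nm_ge0.
  have [_ [T [c ->]] xy] : exists2 y, diag_span r y & nm (x - y) < eps / 2.
    have := Dx; rewrite -[D x]/(diagonal r x) -(closure_diag_span hr hv).
    by apply; lra.
  set y := diag_sum r T c in xy.
  have Dy : D y by apply: diag_span_diagonal => //; exists T, c.
  have fy : cabs (f (p * y)) <= cabs (f p) * nm y.
    rewrite /y /diag_sum mulr_sumr (pf_sum (diagonal_star_closed hr) flin'); last first.
      by move=> s; apply: DM => //; apply: (lin_closedZ _ DL); apply: proj_diagonal.
    have e1 s : f (p * (c s *: proj r s)) = c s * f (p * proj r s).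
      rewrite -scalerAr (pfZ (diagonal_star_closed hr) flin') //.
      by apply: DM => //; apply: proj_diagonal.
    have e2 s : 0 <= f (p * proj r s).
      rewrite -(proj_idem hr s) -{1}(adj_proj hr s); apply: pos; exact: proj_diagonal.
    have -> : cabs (f p) * nm y = \sum_(s <- bits T) cabs (f (p * proj r s)) * nm y.
      rewrite -mulr_suml; congr (_ * _); apply: complexI.
      rewrite -cabsE ger0_norm // rmorph_sum /= -[p in LHS]mulr1 -(sum_proj hr T) mulr_sumr.
      rewrite (pf_sum (diagonal_star_closed hr) flin'); last first.
        by move=> s; apply: DM => //; apply: proj_diagonal.
      by apply: eq_bigr => s _; rewrite -cabsE ger0_norm.
    apply: le_trans (cabs_sum _ _ _) _; rewrite big_seq [leRHS]big_seq.
    apply: ler_sum => s; rewrite mem_bits => /eqP sT; rewrite e1 cabsM mulrC.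
    rewrite ler_wpM2l ?cabs_ge0 // -(coef_diag_sum hr ht c sT).
    exact: (coef_nm hr ht).
  have fxy : f (p * x) = f (p * (x - y)) + f (p * y).
    rewrite -(pfD flin') -?mulrDr ?subrK //; apply: DM => //.
    by rewrite -scaleN1r addrC; case: DL => _; apply.
  have Dxy : D (x - y) by rewrite -scaleN1r addrC; case: DL => _; apply.
  have h1 := bnd' _ Dxy; have h2 : cabs (f p) <= 1.
    by have := bnd' _ D1; rewrite mulr1 nm1.
  rewrite fxy; apply: le_trans (cabsD _ _) _.
  have := nm_le_dist y x; rewrite nmBC => h3.
  have := cabs_ge0 (f p); have := nm_ge0 x; have := nm_ge0 y; nra.
split.
- by move=> a x y Dx Dy; rewrite mulrDr -scalerAr flin ?mulrDl ?mulrA //; apply: DM.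
- by move=> x Dx; rewrite divr_ge0 //; apply: pos.
- move=> x Dx; rewrite nrmE normrM normfV cabsE [`|f p|]cabsE -fmorphV -rmorphM lecR.
  rewrite ler_pdivrMr; first by rewrite mulrC; apply: bnd.
  by rewrite lt_def cabs_ge0 andbT; apply: contraNneq fp0 => /cabs_eq0 ->.
- move=> eps eps0; exists (1 : B); split=> //.
    by rewrite nrmE -[nrm _]/(nm (1 : B)) nm1.
  by rewrite mulr1 divff // normr1 ltrBlDr ltrDl.
Qed.

Lemma pure_state_proj f (p : B) : pure_state_on D f -> D p -> p * p = p -> adj p = p ->
  f p = 0 \/ f p = 1.
Proof.
move=> [sf pf] Dp pp ap; have [flin fpos fn f1] := sf.
have flin' : forall (a : R[i]) (x y : B), D x -> D y -> f (a *: x + y) = a * f x + f y.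
  exact: flin.
have fpos' : forall x : B, D x -> 0 <= f (adj x * x) by exact: fpos.
have f11 : f (1 : B) = 1.
  apply: (pf_unit (diagonal_star_closed hr) flin' fpos').
    by move=> x Dx; have := fn x Dx; rewrite nrmE cabsE lecR.
  move=> eps eps0; have [|x [Dx x1 fx]] := f1 eps%:C%C; first by rewrite ltcR.
  exists x; split=> //; first by move: x1; rewrite nrmE lecR.
  by move: fx; rewrite cabsE -(rmorph1 (real_complex R)) -rmorphB ltcR.
have Dq : D (1 - p) by rewrite -scaleN1r addrC; case: DL => _; apply.
have qq : (1 - p) * (1 - p) = 1 - p.
  by rewrite mulrBr mulr1 mulrBl mul1r pp subrr subr0.
have aq : adj (1 - p) = 1 - p by rewrite adjB adj1 ap.
have fq : f (1 - p) = 1 - f p by rewrite (pfB flin') // f11.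
have [p0|p0] := eqVneq (f p) 0; [by left|right].
apply/eqP; apply/negPn/negP => p1.
have q0 : f (1 - p) != 0 by rewrite fq subr_eq0 eq_sym.
have := pf _ _ (f p) (state_cut sf Dp pp ap p0) (state_cut sf Dq qq aq q0).
have fp0 : 0 <= f p by rewrite -pp -{1}ap; apply: fpos.
have fq0 : 0 <= f (1 - p) by rewrite -qq -{1}aq; apply: fpos.
have -> : 0 < f p < 1.
  by rewrite lt_def p0 fp0 /= -subr_gt0 -fq lt_def q0 fq0.
move=> /(_ isT) h; have [|h1 _] := h _ p Dp.
  move=> x Dx; rewrite -fq mulrC divfK // [f (1 - p) * _]mulrC divfK //.
  have -> : f x = f ((p + (1 - p)) * (x : B)) by rewrite addrC subrK mul1r.
  by rewrite mulrDl (pfD flin') //; apply: DM.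
by move: h1; rewrite pp divff // => /esym/eqP; rewrite (negbTE p1).
Qed.

(** The extension is f composed with E. For uniqueness, purity makes f equal to 1 on exactly one
    projection p of each length T and 0 on the others. By Cauchy-Schwarz, an extension g kills every
    product with a factor 1 - p or another projection of length T, so g x = g (p x p) = g (pave x),
    which tends to g (E x) = f (E x). *)
Lemma diagonal_unique_extension : unique_extension D.
Proof.
move=> f pf; have [sf _] := pf; have [flin fpos fn f1] := sf.
have flin' : forall (a : R[i]) (x y : B), D x -> D y -> f (a *: x + y) = a * f x + f y.
  exact: flin.
have fpos' : forall x : B, D x -> 0 <= f (adj x * x) by exact: fpos.
exists (fun x => f (E x)); split.
  split; last by move=> d hd; rewrite (cexp_id hr hv).
  split.
  - by move=> a x y _ _; rewrite (cexp_lin hr hv) flin //; apply: cexp_diagonal.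
  - move=> x _; have [Z [hZ eZ]] := cexp_gram hr hv ht (\matrix_(i < 1, j < 1) (x : B)).
    have := eZ ord0 ord0; rewrite !big_ord1 !mxE => h.
    by rewrite -[star x ** x]/(adj (x : B) * x) h; apply: fpos.
  - move=> x _; apply: le_trans (fn _ _) _; first exact: cexp_diagonal.
    by rewrite nm_le; apply: (cexp_nm hr hv).
  - move=> eps /f1[x [Dx x1 fx]]; exists x; split=> //.
    by rewrite (cexp_id hr hv).
move=> g [[glin gpos gn _] gf]; apply/funext => x.
have glin' : forall (a : R[i]) (x y : B), setT x -> setT y ->
  g (a *: x + y) = a * g x + g y by exact: glin.
have sT : @star_closed R B setT by split.
have gpos' : forall x : B, setT x -> 0 <= g (adj x * x) by exact: gpos.
have Dp s : D (proj r s) by apply: proj_diagonal.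
have fps s := pure_state_proj pf (Dp s) (proj_idem hr s) (adj_proj hr s).
have null s : f (proj r s) = 0 -> forall y : B, g (proj r s * y) = 0.
  move=> h y; have := pf_null sT glin' gpos' (x := y) (y := proj r s) I I.
  by rewrite (adj_proj hr) (proj_idem hr) gf // h => /(_ erefl)[].
(* The projection of the empty word is 1; were f 0 there, g and hence f would vanish, against the
   norm 1 of f. *)
have f11 : f (1 : B) = 1.
  by have := fps [::]; rewrite /proj /= => -[h|//]; move: (null [::] h) => h';
    have := f1 1 ltr01 => -[y [Dy _]]; rewrite subrr -(gf y Dy) -[y](mul1r (y : B)) h' normr0 ltxx.
have gpave T : g (pave r T x) = g x.
  have null' s : f (proj r s) = 1 -> forall y : B,
      g ((1 - proj r s) * y) = 0 /\ g (y * (1 - proj r s)) = 0.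
    move=> h y; set q := 1 - proj r s.
    have aq : adj q = q by rewrite /q adjB adj1 (adj_proj hr).
    have qq : q * q = q.
      by rewrite /q mulrBr mulr1 mulrBl mul1r (proj_idem hr) subrr subr0.
    have gq : g (adj q * q) = 0.
      rewrite aq qq gf; first by rewrite (pfB flin') // f11 h subrr.
      by rewrite /q -scaleN1r addrC; case: DL => _; apply.
    have [h1 _] := pf_null sT glin' gpos' (x := y) (y := q) I I gq.
    have [_ h2] := pf_null sT glin' gpos' (x := adj y) (y := q) I I gq.
    by rewrite aq in h1; rewrite adjK in h2.
  have [s0 s0T fs0] : exists2 s0, s0 \in bits T & f (proj r s0) = 1.
    apply: contrapT => hn; have := f11; rewrite -(sum_proj hr T).
    rewrite (pf_sum (diagonal_star_closed hr) flin') // big_seq big1 => [/esym/eqP|s sT'].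
      by rewrite oner_eq0.
    by case: (fps s) => // h; case: hn; exists s.
  rewrite /pave (pf_sum sT glin') // (bigD1_seq s0) ?bits_uniq //= big_seq_cond big1 ?addr0.
    rewrite [in RHS](_ : x = (proj r s0 * x * proj r s0 : B) + (1 - proj r s0) * x
        + (proj r s0 * x) * (1 - proj r s0)); last first.
      by rewrite mulrBr mulr1 mulrBl mul1r -[RHS]addrA [_ - _ + _]addrA subrK addrC subrK.
    rewrite !(pfD glin') //.
    by rewrite (null' _ fs0 x).1 (null' _ fs0 (proj r s0 * x)).2 !addr0.
  move=> s /andP[]; rewrite !mem_bits in s0T * => /eqP sT' ss0.
  rewrite -mulrA; apply: null; case: (fps s) => // h.
  have := (null' _ fs0 (proj r s)).1; rewrite mulrBl mul1r (proj_orth hr) ?subr0.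
  - by rewrite gf // h => /eqP; rewrite oner_eq0.
  - by rewrite sT' (eqP s0T).
  - by rewrite eq_sym.
apply/eqP; rewrite eq_sym -subr_eq0 -normr_le0; apply/ler_addgt0Pl => a /gt0_realC[eps eps0 ->].
rewrite addr0; have [N hN] := cexp_cvg hr hv x eps0.
have -> : f (E x) = g (E x) by rewrite gf //; apply: cexp_diagonal.
rewrite -(gpave N) -(pfB glin') //.
apply: le_trans (gn _ I) _; rewrite nrmE lecR; exact/ltW/hN.
Qed.

Lemma diagonal_cstar_diagonal : cstar_diagonal D.
Proof. by split; [exact: diagonal_cartan|exact: diagonal_unique_extension]. Qed.


End Diagonal.

(** * The spectrum of the diagonal *)

Lemma continuous_to_prod (X : topologicalType) (I : Type) (T : I -> topologicalType)
    (f : X -> prod_topology T) :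
  (forall i, continuous (fun x => f x i)) -> continuous f.
Proof.
move=> cf x; apply/cvg_sup => i; move: x.
apply/(@continuousP _ (initial_topology (@^~ i))) => U [V oV <-].
by have /continuousP := cf i; apply.
Qed.

Lemma cantor_near (w : cantor_space) n :
  nbhs w [set w' : cantor_space | forall i, (i < n)%N -> w i = w' i].
Proof.
elim: n => [|n ih]; first by apply: filterS filterT => w' _ i.
have h : nbhs w [set w' : cantor_space | w n = w' n].
  have := @proj_continuous _ (fun=> bool) n w [set w n] (discrete_set1 _).
  by apply: filterS => w' /= <-.
apply: filterS (filterI ih h) => w' [/= h1 h2] i; rewrite ltnS leq_eqVlt.
by move=> /orP[/eqP ->|/h1].
Qed.

Section Spectrum.
Variables (R : realType) (A : cstarAlgType R) (e : A).
Variables (el : left_id e (@cmul R A)) (er : right_id e (@cmul R A)) (e0 : e != 0).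
Local Notation B := (unitalize el er e0).
Variables (r : nat -> bool -> bool -> B) (v : nat -> B) (flip : pred nat).
Variable tau : B -> R[i].
Hypotheses (hr : matrix_units r) (hv : odometer r v flip) (ht : tracial_state tau).
Local Notation D := (diagonal r : set A).
Local Notation coef := (coef r tau).

Let rM t a b c d : r t a b * r t c d = if b == c then r t a d else 0.
Proof. by case: hr. Qed.
Let sum_r t : r t false false + r t true true = 1.
Proof. by case: hr. Qed.
Let Dr t c : D (r t c c).
Proof. by move=> s d; apply: r_diag_comm. Qed.
Let Dp s : D (proj r s). Proof. by apply: proj_diagonal. Qed.
Let DM (x y : B) : D x -> D y -> D (x * y).
Proof. by case: (diagonal_star_closed hr) => _ _ h _ _; apply: h. Qed.
Let D1 : D (1 : B). Proof. by case: (diagonal_star_closed hr). Qed.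
Let DL : @lin_closed R B D. Proof. by case: (diagonal_star_closed hr). Qed.

Section Character.
Variable chi : A -> R[i].
Hypothesis hchi : character_on D chi.

Let chi_lin (a : R[i]) (x y : B) : D x -> D y -> chi (a *: x + y) = a * chi x + chi y.
Proof. by case: hchi => h _ _; apply: h. Qed.
Let chiM (x y : B) : D x -> D y -> chi (x * y) = chi x * chi y.
Proof. by case: hchi => _ h _; apply: h. Qed.

Lemma char1 : chi (1 : B) = 1.
Proof.
case: hchi => _ _ [x Dx x0]; apply: (mulfI x0).
by rewrite -chiM // !mulr1.
Qed.

Lemma char_proj_idem (p : B) : D p -> p * p = p -> chi p = (chi p == 1)%:R.
Proof.
move=> Hp pp; have := chiM Hp Hp; rewrite pp.
have [->|p0] := eqVneq (chi p) 0; first by rewrite eq_sym oner_eq0.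
by rewrite -{1}[chi p]mulr1 => /(mulfI p0) <-; rewrite eqxx.
Qed.

(* If chi d = 1 with |d| < 1/2 then y = d + d^2 + ... satisfies y = d + d y. *)
Lemma char_nm (d : B) : D d -> cabs (chi d) <= nm d.
Proof.
have weak (x : B) : D x -> cabs (chi x) <= 2 * nm x.
  move=> Dx; rewrite leNgt; apply/negP => hx.
  have x0 : chi x != 0.
    by apply/eqP => h; move: hx; rewrite h cabs0; have := nm_ge0 x; lra.
  pose y : B := (chi x)^-1 *: x.
  have Dy : D y by apply: (lin_closedZ _ DL).
  have y1 : chi y = 1 by rewrite (pfZ (diagonal_star_closed hr) chi_lin) // mulVf.
  have ny : nm y <= 2^-1.
    have -> : nm y = nm x / cabs (chi x).
      by rewrite nmZ mulrC; congr (_ * _); rewrite /cabs normfV -/(cabs _) cabsE -fmorphV.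
    have c0 : 0 < cabs (chi x) by rewrite lt_def cabs_ge0 andbT;
      apply: contraNneq x0 => /cabs_eq0 ->.
    by rewrite ler_pdivrMr //; lra.
  pose s n := \sum_(i < n) y ^+ i.+1.
  have [l hl] : exists l, ncvg s l.
    apply: (@geometric_cvg _ _ s 1) => n; rewrite mul1r /s big_ord_recr addrC addKr.
    apply: le_trans (nmX _ _) _; apply: le_trans (_ : 2^-1 ^+ n.+1 <= _).
      by rewrite lerXn2r ?nnegrE ?nm_ge0 // invr_ge0.
    by rewrite exprS ler_piMl ?exprn_ge0 ?invr_ge0 //; lra.
  have Ds n : D (s n).
    apply: (lin_closed_sum DL) => i _; elim: {i}(i.+1 : nat) => [|k ih].
      by rewrite expr0.
    by rewrite exprS; apply: DM.
  have Dl : D l.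
    case: (diagonal_star_closed hr) => _ _ _ _; apply; apply: ncvg_nclosure hl.
    by exists 0%N => n _; apply: Ds.
  have hls : l = y + y * l.
    have h' : ncvg (fun n => s n.+1) l.
      by move=> eps /hl[N hN]; exists N => n Nn; apply: hN; apply: ltnW; rewrite ltnS.
    apply: ncvg_unique h' _; apply: ncvg_eq (ncvgD (ncvg_cst y) (ncvgMl y hl)).
    exists 0%N => n _; elim: n => [|n ih]; first by rewrite /s big_ord1 big_ord0 mulr0 addr0.
    have hr' k : s k.+1 = s k + y ^+ k.+1 by rewrite /s big_ord_recr.
    by rewrite {1}(hr' n) mulrDr addrA ih -exprS -hr'.
  have := congr1 chi hls; rewrite (pfD chi_lin) ?chiM ?y1 ?mul1r //; last exact: DM.
  by move/eqP; rewrite -subr_eq subrr eq_sym oner_eq0.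
(* Applied to the powers d^(2^k), the weak bound loses its factor 2. *)
move=> Dd; apply: (@pow2_bound _ _ _ 2); [exact: cabs_ge0|exact: nm_ge0|].
move=> k; have DX n : D (d ^+ n).
  by elim: n => [|n ih]; [rewrite expr0|rewrite exprS; apply: DM].
have cX n : cabs (chi (d ^+ n)) = cabs (chi d) ^+ n.
  elim: n => [|n ih]; first by rewrite !expr0 char1 cabs1.
  by rewrite !exprS chiM // cabsM ih.
rewrite -cX (le_trans (weak _ (DX _))) // ler_wpM2l // nmX //.
Qed.

Definition char_bits (t : nat) : bool := chi (r t true true) == 1.

Lemma char_proj T : chi (proj r (mkseq char_bits T)) = 1.
Proof.
rewrite projE; elim: T => [|T ih] /=; first exact: char1.
rewrite chiM ?ih ?mul1r //; last by rewrite -projE.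
have rr c : r T c c * r T c c = r T c c by rewrite rM eqxx.
have := char_proj_idem (Dr T true) (rr true); rewrite -/(char_bits T).
case hb : (char_bits T) => // h.
have := chi_lin 1 (Dr T false) (Dr T true).
by rewrite scale1r sum_r char1 mul1r h addr0.
Qed.

Lemma char_diag_sum T c : chi (diag_sum r T c) = c (mkseq char_bits T).
Proof.
have sz : size (mkseq char_bits T) = T by rewrite size_mkseq.
have := congr1 chi (diag_sum_proj_mul hr c sz).
rewrite chiM ?(pfZ (diagonal_star_closed hr) chi_lin) // ?char_proj ?mulr1 //.
by apply: diag_span_diagonal => //; exists T, c.
Qed.

Lemma char_coef (d : B) : D d -> forall eps : R, 0 < eps -> exists N, forall T,
  (N <= T)%N -> cabs (coef (mkseq char_bits T) d - chi d) < eps.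
Proof.
move=> Dd eps eps0; have [N hN] := diag_sum_coef_cvg hr ht hv Dd eps0.
exists N => T /hN; apply: le_lt_trans.
have DS : D (diag_sum r T (coef^~ d)).
  by apply: diag_span_diagonal => //; exists T, (coef^~ d).
rewrite -(char_diag_sum T (coef^~ d)) -(pfB chi_lin) //; apply: char_nm.
by rewrite -scaleN1r addrC; case: DL => _; apply.
Qed.

End Character.

Section Evaluation.
Variable w : nat -> bool.

Lemma coef_mkseq_near (d : B) T0 T : (T0 <= T)%N ->
  cabs (coef (mkseq w T) d - coef (mkseq w T0) d) <= nm (d - diag_sum r T0 (coef^~ d)).
Proof.
move=> TT; have h : coef (mkseq w T) (diag_sum r T0 (coef^~ d)) = coef (mkseq w T0) d.
  rewrite (diag_sum_take hr _ TT) (coef_diag_sum hr ht) ?size_mkseq //.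
  by rewrite /mkseq -map_take take_iota (minn_idPl TT).
by rewrite -h -(coefB r ht); apply: (coef_nm hr ht).
Qed.

Lemma eval_ex (d : B) : D d -> exists z : R[i], forall T0,
  cabs (z - coef (mkseq w T0) d) <= nm (d - diag_sum r T0 (coef^~ d)).
Proof.
(* Scalars are written as multiples of 1, so that completeness of the algebra yields the limit; the
   trace reads the scalar back. *)
move=> Dd; pose s T : B := coef (mkseq w T) d *: 1.
have ns T T' : nm (s T - s T') = cabs (coef (mkseq w T) d - coef (mkseq w T') d).
  by rewrite /s -scalerBl nmZ nm1 mulr1.
have hcv := diag_sum_coef_cvg hr ht hv Dd.
have [l hl] : exists l, ncvg s l.
  apply: nm_complete => eps eps0; have [N hN] := hcv (eps / 2) ltac:(lra).
  exists N => T T' NT NT'; have := hN N (leqnn _); rewrite nmBC => hNN.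
  apply: le_lt_trans (nm_tri _ (s N) _) _; rewrite (nmBC (s N)) !ns.
  by have := coef_mkseq_near d NT; have := coef_mkseq_near d NT'; lra.
exists (tau l) => T0; apply/ler_addgt0Pl => eps /hl[N hN].
have [_ tau1 _ _ tn] := ht.
have e1 : coef (mkseq w T0) d = tau (s T0) by rewrite (tauZ ht) tau1 mulr1.
have tB x y : tau (x - y) = tau x - tau y.
  by rewrite addrC -scaleN1r; case: ht => -> _ _ _ _; rewrite mulN1r addrC.
rewrite e1 -tB (le_trans (tn _)) //.
have := hN _ (leq_maxl N T0); have := coef_mkseq_near d (leq_maxr N T0).
by rewrite -ns; have := nm_tri l (s (maxn N T0)) (s T0); rewrite (nmBC l (s (maxn _ _))); lra.
Qed.

(** The value of d at the point w, characterised by an explicit rate of convergence that does not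
    depend on w. The default 0 can only occur outside D. *)
Definition eval (d : A) : R[i] := xget 0 [set z : R[i] | forall T0,
  cabs (z - coef (mkseq w T0) (d : B)) <= nm ((d : B) - diag_sum r T0 (coef^~ (d : B)))].

Lemma evalP (d : B) T0 : D d ->
  cabs (eval d - coef (mkseq w T0) d) <= nm (d - diag_sum r T0 (coef^~ d)).
Proof.
by move=> Dd; have [z hz] := eval_ex Dd; rewrite /eval; case: xgetP => [z' -> //|/(_ z)].
Qed.

Lemma evalE (d : B) z : D d -> (forall eps : R, 0 < eps -> exists N, forall T,
  (N <= T)%N -> cabs (coef (mkseq w T) d - z) < eps) -> eval d = z.
Proof.
move=> Dd h; apply/eqP; rewrite -subr_eq0; apply/eqP/cabs_eq0/eqP.
rewrite eq_le cabs_ge0 andbT; apply/ler_addgt0Pl => eps eps0; rewrite addr0.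
have [N hN] := h (eps / 2) ltac:(lra).
have [M hM] := diag_sum_coef_cvg hr ht hv Dd (e := eps / 2) ltac:(lra).
have := hN _ (leq_maxl N M); have := hM _ (leq_maxr N M).
have := evalP (maxn N M) Dd; rewrite nmBC; set c := coef _ d => h1 h2 h3.
by have := cabsD (eval d - c) (c - z); rewrite addrA subrK; lra.
Qed.

Lemma eval_lim (d : B) : D d -> forall eps : R, 0 < eps -> exists N, forall T,
  (N <= T)%N -> cabs (coef (mkseq w T) d - eval d) < eps.
Proof.
move=> Dd eps eps0; have [N hN] := diag_sum_coef_cvg hr ht hv Dd eps0.
exists N => T /hN; apply: le_lt_trans; rewrite -cabsN opprB nmBC.
exact: evalP.
Qed.

Lemma eval_unit t : eval (r t true true) = (w t)%:R.
Proof.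
apply: evalE => // eps eps0; exists t.+1 => T tT.
rewrite /(coef _ _) (proj_mul_diag hr) ?size_mkseq // nth_mkseq //.
case: (w t) => /=; last by rewrite (tau0 ht) mulr0 subrr cabs0.
by rewrite (tau_proj hr ht) size_mkseq exprVn divff ?subrr ?cabs0 // expf_neq0 // pnatr_eq0.
Qed.

Lemma eval_character : character_on D eval.
Proof.
(* Coefficients at words of length T are exactly multiplicative on functions of T bits, so the
   defect is bounded by a distance in norm. *)
have coefM T (x y : B) : D x -> D y -> cabs (coef (mkseq w T) (x * y) -
    coef (mkseq w T) x * coef (mkseq w T) y) <=
    nm (diag_sum r T (coef^~ x) * diag_sum r T (coef^~ y) - x * y).
  move=> Dx Dy; rewrite (diag_sumM hr) nmBC.
  rewrite -[X in cabs (_ - X)](coef_diag_sum hr ht (fun s => coef s x * coef s y)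
    (size_mkseq w T)) -(coefB r ht).
  exact: (coef_nm hr ht).
split.
- move=> a x y Dx Dy; apply: evalE; first by case: DL => _; apply.
  move=> eps eps0; have c0 : 0 < 2 * (cabs a + 1) by have := cabs_ge0 a; lra.
  have [N hN] := eval_lim Dx (divr_gt0 eps0 c0).
  have [M hM] := eval_lim Dy (eps := eps / 2) ltac:(lra).
  exists (maxn N M) => T; rewrite geq_max => /andP[/hN h1 /hM h2].
  rewrite (coef_lin r ht) opprD addrACA -mulrBr.
  apply: le_lt_trans (cabsD _ _) _; rewrite cabsM.
  move: h1; rewrite ltr_pdivlMr // => h1.
  have := cabs_ge0 (coef (mkseq w T) x - eval x); have := cabs_ge0 a; nra.
- move=> x y Dx Dy; apply: evalE; first exact: DM.
  move=> eps eps0.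
  have [N1 h1] := ncvgM (diag_sum_coef_cvg hr ht hv Dx) (diag_sum_coef_cvg hr ht hv Dy)
    (e := eps / 2) ltac:(lra).
  pose a := cabs (eval x); pose b := nm (y : B).
  have c0 : 0 < 4 * (a + b + 1) by have := cabs_ge0 (eval x); have := nm_ge0 (y : B);
    rewrite /a /b; lra.
  have [N2 h2] := eval_lim Dx (divr_gt0 eps0 c0).
  have [N3 h3] := eval_lim Dy (divr_gt0 eps0 c0).
  exists (maxn N1 (maxn N2 N3)) => T; rewrite !geq_max => /and3P[/h1 k1 /h2 k2 /h3 k3].
  have k0 := coefM T x y Dx Dy; set p := coef _ x in k0 k2; set q := coef _ y in k0 k3.
  have -> : coef (mkseq w T) ((x : B) * y) - eval x * eval y =
     (coef (mkseq w T) ((x : B) * y) - p * q) + ((p - eval x) * q + eval x * (q - eval y)).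
    by ring.
  have qb : cabs q <= b by apply: (coef_nm hr ht).
  move: k2 k3; rewrite !ltr_pdivlMr // => k2 k3.
  apply: le_lt_trans (cabsD _ _) _; have := cabsD ((p - eval x) * q) (eval x * (q - eval y)).
  rewrite (cabsM (p - _) q) (cabsM (eval x)) -/a => k4.
  have a0 : 0 <= a := cabs_ge0 _; have b0 : 0 <= b := nm_ge0 _.
  have := cabs_ge0 (p - eval x); have := cabs_ge0 (q - eval y); have := cabs_ge0 q.
  move: k0 k1 k2 k3 k4 qb; set X := cabs (p - _); set Y := cabs (q - _); set Z := cabs q.
  move=> k0 k1 k2 k3 k4 qb Z0 Y0 X0.
  have hXZ : X * Z <= X * b by rewrite ler_wpM2l.
  have := mulr_ge0 X0 a0; have := mulr_ge0 X0 b0; have := mulr_ge0 Y0 a0.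
  have := mulr_ge0 Y0 b0; nra.
- exists (1 : B); first exact: D1.
  rewrite (@evalE 1 1) ?oner_neq0 // => eps eps0; exists 0%N => T _.
  rewrite /(coef _ _) mulr1 (tau_proj hr ht) size_mkseq exprVn divff ?subrr ?cabs0 //.
Qed.

End Evaluation.

Lemma eval_near (w w' : nat -> bool) (d : B) T0 : D d ->
  (forall i, (i < T0)%N -> w i = w' i) ->
  cabs (eval w d - eval w' d) <= 2 * nm (d - diag_sum r T0 (coef^~ d)).
Proof.
move=> Dd h; have := evalP w T0 Dd; have := evalP w' T0 Dd.
have -> : mkseq w T0 = mkseq w' T0.
  by apply/eq_in_map => i; rewrite mem_iota => /andP[_]; apply: h.
set c := coef _ d => h1 h2; have := cabsD (eval w d - c) (c - eval w' d).
rewrite addrA subrK -(cabsN (c - _)) opprB => h3; apply: le_trans h3 _.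
rewrite mulr_natl mulr2n; exact: lerD h2 h1.
Qed.

Let rD t : D := exist _ (r t true true) (mem_set (Dr t true)).

Lemma diagonal_cantor : cantor_spectrum D.
Proof.
pose f (x : gelfand_spectrum D) : cantor_space := fun t => val x (rD t) == 1.
have gP (w : cantor_space) : (fun d : D => eval w (val d)) \in @spectrum R A D.
  by apply/mem_set; exists (eval w) => //; apply: eval_character.
pose g (w : cantor_space) : gelfand_spectrum D := (SigSub (gP w) : @spectrum R A D).
exists f, g; split.
- move=> x; apply: val_inj => /=; case: (set_mem (valP x)) => chi hchi hx.
  apply/funext => d; have Dd : D (val d) by apply: set_mem (valP d).
  have fx : f x = char_bits chi by apply/funext => t; rewrite /f -hx.
  by rewrite -hx fx; apply: evalE => //; apply: char_coef.
- move=> w; apply/funext => t; rewrite /f /= eval_unit.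
  by case: (w t); rewrite ?eqxx // eq_sym oner_eq0.
- apply: continuous_to_prod => t x U nU.
  have hc : {for x, continuous (fun y : gelfand_spectrum D => val y (rD t) : R[i]^o)}.
    apply: (@continuous_comp _ _ _ (val : gelfand_spectrum D -> {ptws D -> R[i]^o})
      (fun h => h (rD t))); first exact: initial_continuous.
    exact: (@proj_continuous _ (fun=> R[i]^o) (rD t)).
  have val01 (y : gelfand_spectrum D) : val y (rD t) = (f y t)%:R.
    case: (set_mem (valP y)) => chi hchi hy; rewrite /f -hy /=.
    by apply: (char_proj_idem hchi (Dr t true)); rewrite rM eqxx.
  (* Characters are 0 or 1 on projections, so values less than 1/2 apart give the same bit. *)
  have /cvgrPdist_lt/(_ (2^-1)%:C%C) := hc; rewrite ltcR invr_gt0 ltr0n => /(_ isT).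
  apply: filterS => y; rewrite /= !val01 => hy.
  suff -> : f y t = f x t by exact: nbhs_singleton nU.
  move: hy; case: (f y t); case: (f x t) => //; rewrite ?subr0 ?sub0r ?normrN normr1.
    by rewrite -(rmorph1 (real_complex R)) ltcR; lra.
  by rewrite -(rmorph1 (real_complex R)) ltcR; lra.
- apply: continuous_comp_initial; apply: continuous_to_prod => d w.
  have Dd : D (val d) by apply: set_mem (valP d).
  apply/cvgrPdist_lt => a /gt0_realC[eps eps0 ->].
  have [N hN] := diag_sum_coef_cvg hr ht hv Dd (e := eps / 2) ltac:(lra).
  have := hN N (leqnn _); rewrite nmBC => h.
  apply: filterS (cantor_near w N) => w' /= /(eval_near Dd) h'.
  by rewrite cabsE ltcR; lra.
Qed.

End Spectrum.

(** * Masas of finite dimensional C*-algebras *)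

Section CStarBasics.
Variables (R : realType) (F : cstarAlgType R).
Implicit Types (x y z : F) (S : set F).

Lemma cmul0x x : 0 ** x = 0.
Proof. by have := cmulZl 0 0 x; rewrite !scale0r. Qed.

Lemma cmulx0 x : x ** 0 = 0.
Proof. by have := cmulZr 0 x 0; rewrite !scale0r. Qed.

Lemma cmulNx x y : (- x) ** y = - (x ** y).
Proof. by rewrite -scaleN1r cmulZl scaleN1r. Qed.

Lemma cmulxN x y : x ** (- y) = - (x ** y).
Proof. by rewrite -scaleN1r cmulZr scaleN1r. Qed.

Lemma cmulBx x y z : (x - y) ** z = x ** z - y ** z.
Proof. by rewrite cmulDl cmulNx. Qed.

Lemma cmulxB x y z : z ** (x - y) = z ** x - z ** y.
Proof. by rewrite cmulDr cmulxN. Qed.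

Lemma cmul_suml (I : Type) (q : seq I) (P : pred I) (f : I -> F) x :
  (\sum_(i <- q | P i) f i) ** x = \sum_(i <- q | P i) f i ** x.
Proof. by elim/big_rec2: _ => [|i y z _ <-]; rewrite ?cmul0x ?cmulDl. Qed.

Lemma cmul_sumr (I : Type) (q : seq I) (P : pred I) (f : I -> F) x :
  x ** (\sum_(i <- q | P i) f i) = \sum_(i <- q | P i) x ** f i.
Proof. by elim/big_rec2: _ => [|i y z _ <-]; rewrite ?cmulx0 ?cmulDr. Qed.

Lemma star0 : star 0 = 0 :> F.
Proof. by have := starZ 0 (0 : F); rewrite rmorph0 !scale0r. Qed.

Lemma starN x : star (- x) = - star x.
Proof. by rewrite -scaleN1r starZ rmorphN rmorph1 scaleN1r. Qed.

Lemma starB x y : star (x - y) = star x - star y.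
Proof. by rewrite starD starN. Qed.

Lemma starxx_eq0 x : star x ** x = 0 -> x = 0.
Proof.
move=> h; have := cstar_identity x; rewrite h normr0 => /esym/eqP.
by rewrite sqrf_eq0 normr_eq0 => /eqP.
Qed.

(* z and D generate an abelian algebra, contained in its bicommutant. *)
Lemma masa_commutant D z : masa D -> (forall d, D d -> z ** d = d ** z) -> D z.
Proof.
move=> [[D0 Dl DM Ds Dc] Dab Dmax].
(* Self-adjoint elements come first: for a general z nothing says yet that z and its adjoint
   commute. The two self-adjoint parts of z are treated separately at the end. *)
have sa y : star y = y -> (forall d, D d -> y ** d = d ** y) -> D y.
  move=> ys yD; pose S := [set y] `|` D.
  pose C := [set c : F | forall s, S s -> c ** s = s ** c].
  pose V := [set b : F | forall c, C c -> b ** c = c ** b].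
  have SS s t : S s -> S t -> s ** t = t ** s.
    by move=> [->|Ss] [->|St] //; [apply: yD|rewrite yD|apply: Dab].
  have Sst s : S s -> S (star s) by move=> [->|Ss]; [left|right; apply: Ds].
  have Cst c : C c -> C (star c).
    by move=> Cc s /Sst /Cc /(congr1 star); rewrite !starM starK.
  have SV s : S s -> V s by move=> Ss c /(_ _ Ss).
  have SC s : S s -> C s by move=> Ss t St; apply: SS.
  have VE : V = D.
    apply: Dmax; last by move=> d Dd; apply: SV; right.
    - split.
      + by move=> c _; rewrite cmul0x cmulx0.
      + by move=> a b b' Vb Vb' c Cc; rewrite cmulDl cmulDr cmulZl cmulZr Vb // Vb'.
      + by move=> b b' Vb Vb' c Cc; rewrite -cmulA Vb' // cmulA Vb // cmulA.
      + by move=> b Vb c /Cst /Vb /(congr1 star); rewrite !starM starK.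
      + move=> b /closureP cb c Cc; apply/eqP; rewrite -subr_eq0; apply/eqP.
        apply: nrm_eq0; apply/eqP; rewrite eq_le nrm_ge0 andbT.
        apply/ler_addgt0Pl => eps eps0; rewrite addr0.
        have c1 : 0 < 2 * (nrm c + 1) by have := nrm_ge0 c; lra.
        have [b' Vb' bb'] := cb _ (divr_gt0 eps0 c1).
        have -> : b ** c - c ** b = (b - b') ** c - c ** (b - b').
          by rewrite cmulBx cmulxB (Vb' _ Cc) opprB addrA subrK.
        apply: le_trans (nrmD _ _) _; rewrite nrmN.
        have := nrm_cmul (b - b') c; have := nrm_cmul c (b - b').
        move: bb'; rewrite ltr_pdivlMr //; have := nrm_ge0 c; have := nrm_ge0 (b - b').
        by nra.
    - move=> b b' Vb Vb'; apply: Vb => s Ss; apply: Vb'; exact: SC.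
  by rewrite -VE; apply: SV; left.
move=> zD; have zsD d : D d -> star z ** d = d ** star z.
  by move=> /Ds /zD /(congr1 star); rewrite !starM starK.
have h1 : D (z + star z).
  apply: sa => [|d Dd]; first by rewrite starD starK addrC.
  by rewrite cmulDl cmulDr zD // zsD.
have h2 : D ('i *: (z - star z)).
  apply: sa => [|d Dd]; first by rewrite starZ starB starK conjCi scaleNr -scalerN opprB.
  by rewrite cmulZl cmulZr cmulBx cmulxB zD // zsD.
have -> : z = 2^-1 *: (z + star z) + ((- 'i / 2) *: ('i *: (z - star z)) + 0).
  rewrite addr0 scalerA mulrAC mulNr -expr2 sqrCi opprK mul1r -scalerDr addrACA subrr addr0.
  by rewrite scalerDr -scalerDl -[2^-1]mul1r -splitr scale1r.
by apply: (Dl _ _ _ h1); apply: (Dl _ _ _ h2).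
Qed.

End CStarBasics.

Section FiniteDimensional.
Variables (R : realType) (F : cstarAlgType R) (D : set F).
Hypotheses (hF : finite_dimensional F) (hD : masa D).
Implicit Types (x y z : F).

Let Dab x y : D x -> D y -> x ** y = y ** x. Proof. by case: hD => _ h _; apply: h. Qed.
Let DM x y : D x -> D y -> D (x ** y).
Proof. by case: hD => -[_ _ h _ _] _ _; apply: h. Qed.
Let Ds x : D x -> D (star x).
Proof. by case: hD => -[_ _ _ h _] _ _; apply: h. Qed.
Let D0 : D 0. Proof. by case: hD => -[]. Qed.
Let Dl (a : R[i]) x y : D x -> D y -> D (a *: x + y).
Proof. by case: hD => -[_ h _ _ _] _ _; apply: h. Qed.
Let DZ (a : R[i]) x : D x -> D (a *: x).
Proof. by move=> Dx; rewrite -[_ *: _]addr0; apply: Dl. Qed.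
Let DB x y : D x -> D y -> D (x - y).
Proof. by move=> Dx Dy; rewrite addrC -scaleN1r; apply: Dl. Qed.

Lemma fd_dependent : exists n, forall f : nat -> F,
  exists2 u : 'rV[R[i]]_n.+1, u != 0 & \sum_(k < n.+1) u 0 k *: f k = 0.
Proof.
have [n [e he]] := hF; exists n => f.
have /choice[c hc] : forall k : 'I_n.+1, exists c : 'I_n -> R[i], f k = \sum_i c i *: e i.
  by move=> k; apply: he.
pose M := \matrix_(k < n.+1, i < n) c k i.
have : kermx M != 0 by rewrite -mxrank_eq0 -lt0n mxrank_ker subn_gt0 ltnS rank_leq_col.
move=> /rowV0Pn[u /sub_kermxP uM u0]; exists u => //.
under eq_bigr => j _ do rewrite hc scaler_sumr.
rewrite exchange_big big1 // => i _ /=.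
under eq_bigr do rewrite scalerA; rewrite -scaler_suml.
have /matrixP/(_ 0 i) := uM; rewrite !mxE => h.
rewrite (_ : \sum_i0 _ = 0) ?scale0r // -[RHS]h; apply: eq_bigr => j _.
by rewrite !mxE.
Qed.

(** When the factors b - l are applied to y one after the other, the last nonzero vector is an
    eigenvector. V keeps track of the subspace it lies in. *)
Lemma eigen_factor (b y : F) (s : seq R[i]) (g : R[i] -> F -> F) (V : set F) :
  g = (fun l x => b ** x - l *: x) -> (forall l x, V x -> V (g l x)) ->
  V y -> y != 0 -> foldr g y s = 0 ->
  exists l x, [/\ V x, x != 0 & b ** x = l *: x].
Proof.
move=> gE Vg; elim/last_ind: s y => [|s l ih] y Vy y0; first by move=> /eqP; rewrite (negbTE y0).
rewrite foldr_rcons => h; have [/eqP g0|g0] := boolP (g l y == 0).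
  exists l, y; split=> //; apply/eqP; rewrite -subr_eq0; move: g0; rewrite gE => ->.
  by [].
by apply: (ih _ _ g0 h); apply: Vg.
Qed.

(* The powers of b are dependent, and the polynomial relation splits into factors. *)
Lemma eigen_exists (b y : F) (V : set F) : V y -> y != 0 ->
  (forall (a : R[i]) x z, V x -> V z -> V (a *: x + z)) -> (forall x, V x -> V (b ** x)) ->
  exists l x, [/\ V x, x != 0 & b ** x = l *: x].
Proof.
move=> Vy y0 Vl Vb; have [n hn] := fd_dependent.
pose g (l : R[i]) (x : F) := b ** x - l *: x.
pose pw k := iter k (cmul b) y.
have [u u0 hu] := hn pw.
pose p := \poly_(k < n.+1) u 0 (inord k).
have p0 : p != 0.
  apply: contraNneq u0 => p0; apply/eqP/rowP => k; rewrite mxE.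
  have := congr1 (fun q : {poly _} => q`_k) p0.
  by rewrite coef_poly ltn_ord coef0 inord_val.
have [s hs] := closed_field_poly_normal p.
pose ev (q : {poly R[i]}) x := \sum_(k < size q) q`_k *: iter k (cmul b) x.
have evw (q : {poly R[i]}) x m : (size q <= m)%N ->
    ev q x = \sum_(k < m) q`_k *: iter k (cmul b) x.
  move=> qm; rewrite /ev (big_ord_widen m (fun k => q`_k *: iter k (cmul b) x) qm).
  rewrite big_mkcond; apply: eq_bigr => k _; case: ltnP => // h.
  by rewrite nth_default ?scale0r.
have ev_p : ev p y = 0.
  rewrite (evw _ _ n.+1) ?size_poly // -[RHS]hu; apply: eq_bigr => k _.
  by rewrite coef_poly ltn_ord inord_val.
have evX (q : {poly R[i]}) l x : ev (q * ('X - l%:P)) x = ev q (g l x).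
  have sq : (size (q * ('X - l%:P))%R <= (size q).+1)%N.
    by rewrite (leq_trans (size_polyMleq _ _)) // size_XsubC addn2.
  rewrite (evw _ _ _ sq) (evw _ _ (size q).+1) //.
  have gi k : iter k (cmul b) (g l x) = iter k.+1 (cmul b) x - l *: iter k (cmul b) x.
    elim: k => // k ih; rewrite iterS ih cmulxB cmulZr; congr (_ - _).
  under [RHS]eq_bigr do rewrite gi scalerBr scalerA.
  under [LHS]eq_bigr do rewrite mulrBr poly.coefB coefMC coefMX scalerBl.
  rewrite !sumrB big_ord_recl /= scale0r add0r; congr (_ - _).
  by rewrite [RHS]big_ord_recr /= [q`_(size q)]nth_default // scale0r addr0.
have fold0 : foldr g y s = 0.
  have lc : lead_coef p != 0 by rewrite lead_coef_eq0.
  have evZ c (q : {poly R[i]}) x : c != 0 -> ev (c *: q) x = c *: ev q x.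
    move=> c0; rewrite /ev size_scale // scaler_sumr; apply: eq_bigr => k _.
    by rewrite poly.coefZ scalerA.
  have ev_prod (t : seq R[i]) x : ev (\prod_(z <- t) ('X - z%:P)) x = foldr g x t.
    elim/last_ind: t x => [|t l ih] x.
      by rewrite big_nil /ev size_poly1 big_ord1 coef1 scale1r.
    by rewrite -cats1 big_cat big_seq1 /= evX ih foldr_cat.
  move: ev_p; rewrite hs evZ // ev_prod => /eqP.
  by rewrite scaler_eq0 (negbTE lc) => /eqP.
apply: (@eigen_factor b y s g V) => // l x Vx.
by rewrite /g addrC -scaleNr; apply: Vl => //; apply: Vb.
Qed.

(** V is the algebra of polynomials in b without constant term. An eigenvector c of b in V is an
    eigenvector of every element of V, c included, so c c = m c. As c is normal, c c is not 0, so m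
    is not 0 and c / m is a normal idempotent, hence self-adjoint. *)
Lemma spectral_projection (b : F) : D b -> b != 0 -> exists l (p : F),
  [/\ D p, p != 0, p ** p = p, star p = p & b ** p = l *: p /\ l != 0].
Proof.
move=> Db b0.
pose stable (W : set F) := [/\ W b, forall (a : R[i]) x z, W x -> W z -> W (a *: x + z) &
  forall x, W x -> W (b ** x)].
pose V := [set x | forall W, stable W -> W x].
have [||a x z Vx Vz W sW|x Vx W sW|l [c [Vc c0 bc]]] := @eigen_exists b b V.
- by move=> W [].
- by [].
- by have [_ h _] := sW; apply: h; [apply: Vx|apply: Vz].
- by have [_ _ h] := sW; apply: h; apply: Vx.
have [Dc [m cm]] : D c /\ exists m, c ** c = m *: c.
  apply: (Vc [set a | D a /\ exists m, a ** c = m *: c]); split.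
  - by split=> //; exists l.
  - move=> a x z [Dx [m xm]] [Dz [n zn]]; split; first exact: Dl.
    by exists (a * m + n); rewrite cmulDl cmulZl xm zn scalerDl scalerA.
  - move=> x [Dx [m xm]]; split; first exact: DM.
    by exists (m * l); rewrite -cmulA xm cmulZr bc scalerA.
have cc0 : c ** c != 0.
  apply: contra_neq c0 => cc; apply: starxx_eq0; apply: starxx_eq0.
  by rewrite starM starK -!cmulA (cmulA c) (Dab Dc (Ds Dc)) -!cmulA cc !cmulx0.
have m0 : m != 0 by apply: contraNneq cc0 => m0; rewrite cm m0 scale0r.
(* For l = 0 the whole of V, and so c itself, would annihilate c. *)
have l0 : l != 0.
  apply: contraNneq cc0 => l0; apply/eqP.
  apply: (Vc [set a | a ** c = 0]); split=> [|a x z|x] /=.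
  - by rewrite bc l0 scale0r.
  - by rewrite cmulDl cmulZl => -> ->; rewrite scaler0 addr0.
  - by rewrite -cmulA => ->; rewrite cmulx0.
pose p := m^-1 *: c; have Dp : D p by apply: DZ.
have pp : p ** p = p by rewrite /p cmulZl cmulZr cm [m^-1 *: (m *: c)]scalerA mulVf // scale1r.
have sp : p = star p ** p.
  apply/eqP; rewrite -subr_eq0; apply/eqP; apply: starxx_eq0.
  rewrite starB starM starK cmulBx !cmulxB -!cmulA !(cmulA p) (Dab Dp (Ds Dp)).
  have ss : star p ** star p = star p by rewrite -starM pp.
  by rewrite !cmulA ss !subrr.
exists l, p; split=> //.
- by rewrite scaler_eq0 invr_eq0 (negbTE m0).
- by rewrite [in LHS]sp starM starK -sp.
- by split=> //; rewrite /p cmulZr bc !scalerA mulrC.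
Qed.

Definition orth_projections (s : seq F) :=
  [/\ uniq s, forall p, p \in s -> [/\ D p, p != 0, p ** p = p & star p = p] &
      forall p q, p \in s -> q \in s -> p != q -> p ** q = 0].

(** Nonzero orthogonal projections are linearly independent. *)
Lemma projections_bounded : exists n, forall s, orth_projections s -> (size s <= n)%N.
Proof.
have [n hn] := fd_dependent; exists n => s [us hs os]; rewrite leqNgt; apply/negP => ns.
have [u /eqP u0] := hn (nth 0 s); apply: contra_not u0 => h; apply/rowP => k.
have ks (j : 'I_n.+1) : (j < size s)%N by apply: leq_trans ns.
have [_ pk pp _] := hs _ (mem_nth 0 (ks k)).
move: (congr1 (fun x => x ** s`_k) h); rewrite cmul0x cmul_suml (bigD1 k) //= big1.
  by rewrite addr0 cmulZl pp mxE => /eqP; rewrite scaler_eq0 (negbTE pk) orbF => /eqP.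
move=> j jk; rewrite cmulZl os ?scaler0 ?mem_nth //.
by rewrite nth_uniq.
Qed.

(** A family of maximal size will do: a nonzero remainder of a would supply a further projection,
    and a product a p that is not scalar would split p. *)
Lemma spectral_resolution : exists2 s, orth_projections s &
  forall a, D a -> a = \sum_(p <- s) a ** p /\ forall p, p \in s -> exists m, a ** p = m *: p.
Proof.
have [n hn] := projections_bounded.
pose P m := `[< exists2 s, orth_projections s & size s = m >].
have P0 : exists m, P m by exists 0%N; apply/asboolP; exists [::].
have Pn m : P m -> (m <= n)%N by move=> /asboolP[s /hn sn <-].
case: (ex_maxnP P0 Pn) => m /asboolP[s hs sm] mmax.
have smax t : orth_projections t -> (size t <= size s)%N.
  by move=> ht; rewrite sm; apply: mmax; apply/asboolP; exists t.
exists s => // a Da; have [us ps os] := hs; split.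
  apply/eqP; rewrite -subr_eq0; set d := a - _.
  have Dd : D d.
    apply: DB => //; rewrite big_seq; apply: (big_ind D) => // [x y Dx Dy|q sq].
      by rewrite -[x]scale1r; apply: Dl.
    by apply: DM => //; have [] := ps _ sq.
  apply/negPn/negP => d0; have [l [e [De e0 ee se [de l0]]]] := spectral_projection Dd d0.
  have dp p : p \in s -> d ** p = 0.
    move=> sp; rewrite cmulBx cmul_suml (bigD1_seq p) //= big1_seq ?addr0.
      by rewrite -cmulA; have [_ _ -> _] := ps _ sp; rewrite subrr.
    by move=> q /andP[qp sq]; rewrite -cmulA (os q p) // cmulx0.
  have ep p : p \in s -> e ** p = 0.
    move=> sp; have [Dp _ _ _] := ps _ sp; apply/eqP.
    have : l *: (e ** p) == 0.
      by rewrite -cmulZl -de -cmulA (Dab De Dp) cmulA dp // cmul0x.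
    by rewrite scaler_eq0 (negbTE l0).
  have es : e \notin s.
    by apply: contraNN e0 => es; rewrite -ee ep.
  have /smax : orth_projections (e :: s); last by rewrite /= ltnn.
  split=> /=; first by rewrite es.
    by move=> p; rewrite inE => /predU1P[->|/ps].
  move=> p q; rewrite !inE => /predU1P[->|sp] /predU1P[->|sq]; first by rewrite eqxx.
  - by move=> _; apply: ep.
  - by have [Dp _ _ _] := ps _ sp; move=> _; rewrite (Dab Dp De) ep.
  - exact: os.
move=> p sp; have [Dp p0 pp stp] := ps _ sp.
have [ap0|ap0] := eqVneq (a ** p) 0; first by exists 0; rewrite ap0 scale0r.
have [l [e [De e0 ee se [ae l0]]]] := spectral_projection (DM Da Dp) ap0.
exists l; have ep : e ** p = e.
  have : l *: (e ** p - e) == 0.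
    by rewrite scalerBr -cmulZl -ae -!cmulA (Dab De Dp) (cmulA p p e) pp subrr.
  by rewrite scaler_eq0 (negbTE l0) subr_eq0 => /eqP.
have [<-|ne] := eqVneq e p; first by rewrite -[in RHS]ae -cmulA (Dab Dp De) ep.
have pe : p ** e = e by rewrite (Dab Dp De).
have oth q : q \in s -> q != p -> e ** q = 0.
  by move=> sq qp; rewrite -ep -cmulA (os p q) ?cmulx0 // eq_sym.
have De' : D (p - e) by apply: DB.
have oth' q : q \in s -> q != p -> (p - e) ** q = 0.
  by move=> sq qp; rewrite cmulBx oth // (os p q) ?subrr // eq_sym.
have ee' : e ** (p - e) = 0 by rewrite cmulxB ep ee subrr.
(* If e differs from p, the pieces e and p - e in place of p make the family longer. *)
have prj : orth_projections [:: e, p - e & rem p s].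
  split=> /=.
  - rewrite rem_uniq // inE !mem_rem_uniq // !inE !andbT negb_or.
    apply/andP; split; last first.
      apply/negP => /andP[qp sq]; have := oth' _ sq qp.
      rewrite cmulxB !cmulBx pp pe ep ee subrr subr0 => /eqP.
      by rewrite subr_eq0 eq_sym (negbTE ne).
    apply/andP; split; last first.
      by apply/negP => /andP[qp sq]; have /eqP := oth _ sq qp; rewrite ee (negbTE e0).
    by apply: contra_neq e0 => ee1; rewrite -ee [X in _ ** X]ee1 ee'.
  - move=> q; rewrite !inE mem_rem_uniq // inE => /or3P[/eqP->|/eqP->|/andP[_ /ps]//].
      by split.
    split=> //; first by rewrite subr_eq0 eq_sym.
      by rewrite cmulxB !cmulBx pp pe ep ee subrr subr0.
    by rewrite starB se stp.
  - move=> q q'; rewrite !inE !mem_rem_uniq // !inE.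
    move=> /or3P[/eqP->|/eqP->|/andP[qp sq]] /or3P[/eqP->|/eqP->|/andP[qp' sq']] //;
      rewrite ?eqxx // => qq'.
    + exact: oth.
    + by rewrite (Dab De').
    + exact: oth'.
    + by have [Dq _ _ _] := ps _ sq; rewrite (Dab Dq) // oth.
    + by have [Dq _ _ _] := ps _ sq; rewrite (Dab Dq) // oth'.
    + exact: os.
by have /smax := prj; rewrite /= size_rem // prednK ?ltnn // -has_predT; apply/hasP; exists p.
Qed.

End FiniteDimensional.

(** * The diagonal is not AF *)

Section NearPermutation.
Variables (R : realType) (A : ucstarAlgType R) (X : cstarAlgType R).
Variables (D : set A) (DX : set X) (s : seq X) (m : X -> A) (u : A) (x0 : X).
Hypotheses (D1 : D 1) (Dab : forall a b, D a -> D b -> GRing.comm a b).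
Hypotheses (Dl : lin_closed D) (DM : forall a b, D a -> D b -> D (a * b)).
Hypothesis Dmax : forall a,
  (forall p, D p -> p * p = p -> adj p = p -> GRing.comm a p) -> D a.
Hypotheses (uu : adj u * u = 1) (uu' : u * adj u = 1).
Hypothesis unorm : forall d, D d -> D (u * d * adj u) /\ D (adj u * d * u).
Hypotheses (hDX : masa DX) (hs : orth_projections DX s).
Hypothesis res : forall a, DX a -> a = \sum_(p <- s) a ** p /\
  forall p, p \in s -> exists c, a ** p = c *: p.
Hypotheses (mlin : linear m) (mM : forall x y, m (x ** y) = m x * m y).
Hypotheses (mS : forall x, m (star x) = adj (m x)) (mD : forall x, DX x -> D (m x)).
Hypothesis mnorm : forall w, normaliser DX w -> forall d, D d -> D (m w * d * adj (m w)).
Hypothesis near : nm (u - m x0) < 8^-1.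
Implicit Types (p q w x y : X) (b e : A).

Let sD p : p \in s -> DX p. Proof. by case: hs => _ h _ /h[]. Qed.
Let sp p : p \in s -> p ** p = p. Proof. by case: hs => _ h _ /h[]. Qed.
Let ss p : p \in s -> star p = p. Proof. by case: hs => _ h _ /h[]. Qed.
Let resl (a : X) p : DX a -> p \in s -> exists2 c, a ** p = c *: p & p ** a = c *: p.
Proof.
move=> Da pS; have [_ /(_ _ pS)[c h]] := res Da; exists c => //.
by have [_ ab _] := hDX; rewrite (ab _ _ (sD pS) Da).
Qed.
Let m0 : m 0 = 0. Proof. by have := mlin (-1) 0 0; rewrite scaler0 addr0 scaleN1r addNr. Qed.
Let mZ (c : R[i]) x : m (c *: x) = c *: m x.
Proof. by have := mlin c x 0; rewrite m0 !addr0. Qed.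
Let m_sum (F : X -> X) : m (\sum_(p <- s) F p) = \sum_(p <- s) m (F p).
Proof.
by elim: (s) => [|p t ih]; rewrite ?big_nil ?m0 // !big_cons -[F p]scale1r mlin !scale1r ih.
Qed.
Let Ds x : DX x -> DX (star x).
Proof. by case: hDX => -[_ _ _ h _] _ _; apply: h. Qed.
(** The defect g annihilates D on the right, so g^* g commutes with D and lies in the masa, where
    g^* g is the sum of the g^* g p = 0. *)
Lemma res_unit x : x ** (\sum_(p <- s) p) = x.
Proof.
pose g := x - x ** \sum_(p <- s) p.
have gp p : p \in s -> g ** p = 0.
  move=> pS; rewrite cmulBx -cmulA cmul_suml (bigD1_seq p) //=; last by case: hs.
  rewrite sp // big1_seq ?addr0 ?subrr // => q /andP[qp qS].
  by case: hs => _ _; apply.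
have gd d : DX d -> g ** d = 0.
  move=> Dd; have [-> _] := res Dd; rewrite cmul_sumr big1_seq // => p /andP[_ pS].
  by have [c h1 _] := resl Dd pS; rewrite h1 cmulZr gp // scaler0.
have Dg : DX (star g ** g).
  apply: (masa_commutant hDX) => d Dd; rewrite -cmulA gd // cmulx0 cmulA.
  by have := gd _ (Ds Dd) => /(congr1 star); rewrite starM starK star0 => ->; rewrite cmul0x.
suff : g = 0 by move/eqP; rewrite subr_eq0 => /eqP <-.
apply: starxx_eq0; have [-> _] := res Dg; apply: big1_seq => p /andP[_ pS].
by rewrite -cmulA gp // cmulx0.
Qed.

Lemma idem_nm_small e : adj e * e = e -> nm e < 1 -> e = 0.
Proof.
move=> ee e1; have := nm_cstar e; rewrite ee => h; apply: nm_eq0; apply/eqP.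
have := nm_ge0 e; nra.
Qed.

(** Let g be the complement of the image of the unit. It is killed by m x0, so nm g = nm (u g) = nm
    ((u - m x0) g) <= nm g / 8. *)
Lemma res_sum1 : \sum_(p <- s) m p = 1.
Proof.
rewrite -m_sum; set f := \sum_(p <- s) p; pose g := 1 - m f.
have sf : star f = f.
  rewrite /f; elim: (s) (ss) => [|p t ih] h; rewrite ?big_nil ?star0 // !big_cons starD.
  by rewrite h ?mem_head // ih // => q qt; apply: h; rewrite inE qt orbT.
have ff : m f * m f = m f by rewrite -mM res_unit.
have xf : m x0 * g = 0 by rewrite mulrBr mulr1 -mM res_unit subrr.
have gg : adj g * g = g.
  by rewrite adjB adj1 -mS sf mulrBr mulr1 mulrBl mul1r ff subrr subr0.
suff : g = 0 by move/eqP; rewrite subr_eq0 => /eqP <-.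
have h : nm g <= 8^-1 * nm g.
  have e1 : nm g = nm (u * g).
    apply/eqP; rewrite -(@eqrXn2 _ 2) ?nm_ge0 //.
    by rewrite -!nm_cstar adjM -mulrA (mulrA _ u) uu mul1r.
  rewrite {1}e1; have -> : u * g = (u - m x0) * g by rewrite mulrBl xf subr0.
  by apply: le_trans (nmM _ _) _; rewrite ler_wpM2r ?nm_ge0 // ltW.
by apply: nm_eq0; apply/eqP; have := nm_ge0 g; lra.
Qed.

(** Multiplying by b gives |c - 1| < 1/2 unless b = 0, and multiplying by e - b gives |c| < 1/2
    unless b = e. *)
Lemma near_scaled_idem (c : R[i]) e b : b * b = b -> e * b = b -> b * e = b -> e * e = e ->
  nm (c *: e - b) < 2^-1 -> b = 0 \/ b = e.
Proof.
move=> bb eb be ee h; have [->|b0] := eqVneq b 0; [by left|right].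
apply/eqP; rewrite -subr_eq0 -oppr_eq0 opprB; apply/negPn/negP => eb0.
have pos (y : A) : y != 0 -> 0 < nm y.
  by move=> y0; rewrite lt_neqAle nm_ge0 andbT eq_sym; apply: contra_neq y0 => /nm_eq0.
have h1 : cabs (c - 1) * nm b < 2^-1 * nm b.
  have -> : cabs (c - 1) * nm b = nm ((c *: e - b) * b).
    by rewrite mulrBl -scalerAl eb bb -nmZ scalerBl scale1r.
  by apply: le_lt_trans (nmM _ _) _; rewrite ltr_pM2r ?pos.
have h2 : cabs c * nm (e - b) < 2^-1 * nm (e - b).
  have -> : cabs c * nm (e - b) = nm ((c *: e - b) * (e - b)).
    by rewrite mulrBl -scalerAl !mulrBr ee eb be bb subrr subr0 nmZ.
  by apply: le_lt_trans (nmM _ _) _; rewrite ltr_pM2r ?pos.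
move: h1 h2; rewrite !ltr_pM2r ?pos // => h1 h2.
by have := cabsD c (1 - c); rewrite addrC subrK cabs1 -(cabsN (1 - c)) opprB; lra.
Qed.

(** The constant of the hypothesis [near] is fixed here: nm z <= 9/8, and (9/8 + 1) / 8 < 1/2. *)
Lemma near_gram (z y : A) : nm (y - z) < 8^-1 -> nm y <= 1 -> nm (adj z * z - adj y * y) < 2^-1.
Proof.
move=> yz y1; have -> : adj z * z - adj y * y = adj z * (z - y) + (adj z - adj y) * y.
  by rewrite mulrBr mulrBl addrA subrK.
apply: le_lt_trans (nmD _ _) _; have := nmM (adj z) (z - y); have := nmM (adj z - adj y) y.
rewrite -adjB !nm_adj (nmBC z); have := nm_le_dist z y; rewrite nmBC.
by have := nm_ge0 z; have := nm_ge0 (y - z); have := nm_ge0 y; nra.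
Qed.

(** On each side of w^* w, an element of D acts as the scalar it has at p; so w^* w commutes with D
    and lies in the masa, under p. *)
Lemma compress_scalar p w : p \in s -> w ** p = w ->
  exists c, star w ** w = c *: p.
Proof.
move=> pS wp; have pw : p ** star w = star w by rewrite -{1}(ss pS) -starM wp.
have Dw : DX (star w ** w).
  apply: (masa_commutant hDX) => d Dd; have [c h1 h2] := resl Dd pS.
  have wd : w ** d = c *: w by rewrite -{1}wp -cmulA h2 cmulZr wp.
  have dw : d ** star w = c *: star w by rewrite -{1}pw cmulA h1 cmulZl pw.
  by rewrite -cmulA wd cmulZr cmulA dw cmulZl.
have [c h _] := resl Dw pS; exists c.
by rewrite -h -cmulA wp.
Qed.


Let mw_near p q : p \in s -> q \in s ->
  nm (m q * u * m p - m (q ** x0 ** p)) < 8^-1.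
Proof.
have n1 x : x \in s -> nm (m x) <= 1.
  move=> xS; have := nm_cstar (m x); rewrite -mS ss // -mM sp // => h.
  by have := nm_ge0 (m x); nra.
move=> pS qS; rewrite !mM -mulrBl -mulrBr.
apply: le_lt_trans near; apply: le_trans (nmM _ _) _.
have := nmM (m q) (u - m x0); have := n1 _ pS; have := n1 _ qS.
have := nm_ge0 (m q); have := nm_ge0 (m p); have := nm_ge0 (u - m x0).
have := nm_ge0 (m q * (u - m x0)); nra.
Qed.

(** The Gram elements of w = q x0 p are multiples of p and q, and they lie close to the projections
    obtained from q u p. A projection below m p that is this close to a multiple of m p is 0 or m p,
    so u m p u^* lies under m q; the same argument on the other side gives equality. *)
Lemma permuted p : p \in s -> m p != 0 -> exists q, [/\ q \in s, u * m p * adj u = m q &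
  exists c, let w := q ** x0 ** p in
    [/\ c != 0, star w ** w = c *: p, w ** star w = c *: q & nm (c *: m p - m p) < 2^-1]].
Proof.
move=> pS p0; have mI x : x \in s -> m x * m x = m x by move=> xS; rewrite -mM sp.
have mA x : x \in s -> adj (m x) = m x by move=> xS; rewrite -mS ss.
have nu : nm u = 1 by apply: nm_unitary.
have n1 x : x \in s -> nm (m x) <= 1.
  move=> xS; have := nm_cstar (m x); rewrite mA // mI // => h.
  by have := nm_ge0 (m x); nra.
pose g q := adj u * m q * u.
have Dg q : q \in s -> D (g q) by move=> qS; have [] := unorm (mD (sD qS)).
have gI q : q \in s -> g q * g q = g q.
  by move=> qS; rewrite /g !mulrA -(mulrA _ u) uu' mulr1 -(mulrA _ (m q) (m q)) mI.
have gc q : q \in s -> g q * m p = m p * g q by move=> qS; apply: Dab; [apply: Dg|apply/mD/sD].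
(* The g q sum to 1, so one of them meets m p. *)
have [q qS gp0] : exists2 q, q \in s & g q * m p != 0.
  apply/not_exists2P => h; case/eqP: p0.
  have : \sum_(q <- s) g q * m p = 0.
    by apply: big1_seq => q /andP[_ qS]; case: (h q) => // /negP; rewrite negbK => /eqP.
  by rewrite -mulr_suml -mulr_suml -mulr_sumr res_sum1 mulr1 uu mul1r.
pose w := q ** x0 ** p; pose y := m q * u * m p.
have y1 : nm y <= 1.
  apply: le_trans (nmM _ _) _; have := nmM (m q) u; rewrite nu.
  have := n1 _ pS; have := n1 _ qS; have := nm_ge0 (m p); have := nm_ge0 (m q * u); nra.
have wp : w ** p = w by rewrite -cmulA sp.
have wq : star w ** q = star w by rewrite /w !starM (ss pS) (ss qS) -!cmulA sp.
have [c hc] := compress_scalar pS wp.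
have [c' hc'] := compress_scalar qS wq; rewrite starK in hc'.
have yy : adj y * y = g q * m p.
  rewrite !adjM !mA // /y !mulrA -(mulrA _ (m q) (m q)) mI //.
  by rewrite -(mulrA (m p)) -(mulrA (m p)) -/(g q) -gc // -mulrA mI.
have h1 : nm (c *: m p - g q * m p) < 2^-1.
  have := near_gram (mw_near pS qS) y1.
  by rewrite -[adj (m _)]mS -mM -/w hc mZ -/y yy.
have gpE : g q * m p = m p.
  case: (near_scaled_idem _ _ _ (mI _ pS) h1) => // [|||h]; last by rewrite h eqxx in gp0.
  - by rewrite -mulrA [m p * (g q * m p)]mulrA -gc // -mulrA mI // mulrA gI.
  - by rewrite gc // mulrA mI.
  - by rewrite -mulrA mI.
rewrite gpE in h1.
have yE : y = u * m p.
  by rewrite -[in RHS]gpE /g !mulrA uu' mul1r.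
have c0 : c != 0.
  apply: contraNneq p0 => c0; move: h1; rewrite c0 scale0r sub0r nmN => h1.
  apply/eqP/idem_nm_small; first by rewrite mA ?mI.
  by apply: lt_trans h1 _; lra.
(* Both scalars describe w w^* w. *)
have cc' : c' = c.
  have : c' *: w = c *: w.
    have <- : q ** w = w by rewrite /w !cmulA sp.
    by rewrite -cmulZl -hc' -cmulA hc cmulZr wp /w !cmulA sp.
  move/eqP; rewrite -subr_eq0 -scalerBl scaler_eq0 subr_eq0 => /orP[/eqP//|/eqP w0].
  move: hc; rewrite w0 cmulx0 => /esym/eqP; rewrite scaler_eq0 (negbTE c0) /= => /eqP pz.
  by rewrite pz m0 eqxx in p0.
have h2 : nm (c *: m q - u * m p * adj u) < 2^-1.
  have ye : nm (adj y) <= 1 by rewrite nm_adj.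
  have hn : nm (adj y - adj (m w)) < 8^-1 by rewrite -adjB nm_adj; apply: mw_near.
  have := near_gram hn ye; rewrite !adjK -mS -mM hc' mZ cc' yE adjM mA //.
  by rewrite -mulrA (mulrA (m p)) mI // mulrA.
have up : u * m p * adj u * (u * m p * adj u) = u * m p * adj u.
  by rewrite !mulrA -(mulrA _ (adj u)) uu mulr1 -(mulrA u (m p)) mI.
have qu : m q * u * m p = u * m p by [].
exists q; split=> //; last by exists c; split=> //; rewrite -cc'.
case: (near_scaled_idem up _ _ (mI _ qS) h2) => // [||h].
- by rewrite !mulrA qu.
- rewrite -[RHS]adjK -[LHS]adjK; congr adj.
  by rewrite !adjM adjK (mA q) // (mA p) // !mulrA qu.
- case/eqP: p0; have : adj u * (u * m p * adj u) * u = 0 by rewrite h mulr0 mul0r.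
  by rewrite !mulrA uu mul1r -mulrA uu mulr1.
Qed.

(** The elements e (1 - b) and b (1 - e / c) are eigenvectors of multiplication by e - b, for c and
    -1; both eigenvalues exceed nm (e - b) in modulus, so both vectors vanish. *)
Lemma proportional_idem (c : R[i]) e b : GRing.comm e b -> e * e = c *: e -> b * b = b ->
  cabs (c - 1) < 2^-1 -> nm (e - b) < 2^-1 -> e = c *: b.
Proof.
move=> eb ee bb c1 h.
have c2 : 2^-1 < cabs c.
  by have := cabsD c (1 - c); rewrite addrC subrK cabs1 -(cabsN (1 - c)) opprB; lra.
have c0 : c != 0 by apply: contraTneq c2 => ->; rewrite cabs0 -leNgt invr_ge0.
have small (t : A) (k : R[i]) : 2^-1 < cabs k -> (e - b) * t = k *: t -> t = 0.
  move=> k2 et; apply: nm_eq0; apply/eqP; rewrite eq_le nm_ge0 andbT.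
  have := nmM (e - b) t; rewrite et nmZ; have := nm_ge0 t; nra.
have eX : e * (1 - b) = 0.
  apply: (small _ c) => //; rewrite mulrA mulrBl ee -eb mulrBl -scalerAl.
  by rewrite -(mulrA e b) (mulrBr b) mulr1 bb subrr mulr0 subr0.
have eeb : e * b = e by move/eqP: eX; rewrite mulrBr mulr1 subr_eq0 => /eqP.
have bY : b * (1 - c^-1 *: e) = 0.
  apply: (small _ (-1)); first by rewrite cabsN cabs1; lra.
  rewrite mulrA mulrBl eeb bb scaleN1r -mulrN opprB mulrBr mulr1 mulrBl -!scalerAr ee.
  by rewrite scalerA mulVf // scale1r opprB [LHS]addrC addrA subrK mulrBr mulr1 -scalerAr.
move/eqP: bY; rewrite mulrBr mulr1 subr_eq0 -scalerAr -eb eeb => /eqP ->.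
by rewrite scalerA divff ?scale1r.
Qed.

(** With z = m w and a = z^* u / c, z a = z z^* u / c = m q u = u m p. What is left is a in D, for
    which [Dmax] asks commutation with the projections f of D only: there z f z^* is c times an
    idempotent, close to the conjugate of f p by u, and must be c times it. *)
Lemma permuted_factor p : p \in s -> m p != 0 -> exists q w (a : A),
  [/\ q \in s, u * m p * adj u = m q, q ** w = w, D a & u * m p = m w * a].
Proof.
move=> pS p0; have [q [qS pq [c [c0 ww ww' cp]]]] := permuted pS p0.
set w := q ** x0 ** p in ww ww'; pose z := m w; pose a := adj z * u.
have mI x : x \in s -> m x * m x = m x by move=> xS; rewrite -mM sp.
have mA x : x \in s -> adj (m x) = m x by move=> xS; rewrite -mS ss.
have qw : q ** w = w by rewrite /w !cmulA sp.
have wp : w ** p = w by rewrite /w -!cmulA sp.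
have up : u * m p = m q * u by rewrite -pq -mulrA uu mulr1.
have zz : adj z * z = c *: m p by rewrite -mS -mM ww mZ.
have zz' : z * adj z = c *: m q by rewrite -mS -mM ww' mZ.
have zp : z * m p = z by rewrite -mM wp.
have qz : m q * z = z by rewrite -mM qw.
have pz : m p * adj z = adj z by rewrite -[in RHS]zp adjM mA.
have zq : adj z * m q = adj z by rewrite -[in RHS]qz adjM mA.
have DZ (k : R[i]) x : DX x -> DX (k *: x).
  by case: hDX => -[h0 h _ _ _] _ _ Dx; rewrite -[_ *: _]addr0; apply: h.
(* D acts by scalars on both sides of w, and the Gram elements of w are multiples of p and q. *)
have nw : normaliser DX w.
  move=> d Dd; have [k _ h] := resl Dd pS; have [k' _ h'] := resl Dd qS.
  rewrite -{1}wp -(cmulA w) h cmulZr cmulZl wp ww' -cmulA; split; first exact/DZ/DZ/sD.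
  have dq : d ** w = k' *: w.
    by rewrite -{1}qw cmulA; have [_ ab _] := hDX; rewrite (ab _ _ Dd (sD qS)) h' cmulZl qw.
  by rewrite dq cmulZr ww; apply/DZ/DZ/sD.
have np : nm (m p) = 1.
  have := nm_cstar (m p); rewrite mA // mI // => h.
  have : nm (m p) != 0 by apply: contra_neq p0 => /nm_eq0.
  by have := nm_ge0 (m p); move=> h1 h2; apply/eqP;
    rewrite -subr_eq0 -(mulrI_eq0 _ (mulfI h2)) mulrBr mulr1 -expr2 -h subrr.
have c1 : cabs (c - 1) < 2^-1.
  by move: cp; rewrite -{2}[m p]scale1r -scalerBl nmZ np mulr1.
exists q, w, (c^-1 *: a); split=> //; last first.
  by rewrite -scalerAr mulrA zz' -scalerAl scalerA mulVf // scale1r.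
apply: lin_closedZ Dl _; apply: Dmax => f Df ff sf.
have nf : nm f <= 1.
  have := nm_cstar f; rewrite sf ff => h; have := nm_ge0 f; nra.
pose b := m q * (u * f * adj u).
have Db : D b by apply: DM; [apply/mD/sD|have [] := unorm Df].
have De : D (z * f * adj z) by apply: mnorm.
have yE : b = u * m p * f * adj (u * m p).
  rewrite adjM mA // !mulrA -(mulrA _ f) (Dab Df (mD (sD pS))) mulrA -(mulrA u) mI //.
  by rewrite up /b !mulrA.
have bb : b * b = b.
  have h : (u * f * adj u) * (u * f * adj u) = u * f * adj u.
    by rewrite !mulrA -(mulrA _ (adj u)) uu mulr1 -(mulrA u f) ff.
  have [Du _] := unorm Df; rewrite {2}/b mulrA -(mulrA (m q)) (Dab Du (mD (sD qS))).
  by rewrite (mulrA (m q)) mI // -mulrA h.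
have zy : nm (z - u * m p) < 8^-1.
  by rewrite nmBC; have := mw_near pS qS; rewrite -mulrA up mulrA mI // -up.
have ny : nm (u * m p) <= 1 by rewrite (le_trans (nmM _ _)) // (nm_unitary uu) np mulr1.
have eE : z * f * adj z = c *: b.
  apply: proportional_idem => //; first exact: Dab.
    rewrite !mulrA -(mulrA _ (adj z) z) zz -!scalerAr -!scalerAl.
    by rewrite -(mulrA _ (m p)) (Dab (mD (sD pS)) Df) !mulrA -(mulrA z f f) ff -(mulrA (z * f)) pz.
  rewrite yE; set y := u * m p.
  have -> : z * f * adj z - y * f * adj y = (z - y) * (f * adj z) + (y * f) * adj (z - y).
    by rewrite mulrBl adjB mulrBr !mulrA addrA subrK.
  apply: le_lt_trans (nmD _ _) _.
  have := nmM (z - y) (f * adj z); have := nmM f (adj z); have := nmM (y * f) (adj (z - y)).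
  have := nmM y f; rewrite !nm_adj; have := nm_le_dist z y.
  have := nm_ge0 (f * adj z); have := nm_ge0 (y * f); have := nm_ge0 (z - y).
  have := nm_ge0 z; have := nm_ge0 y; have := nm_ge0 f.
  rewrite -/y in zy ny; move: zy ny nf.
  set Z := nm z; set Y := nm y; set N := nm (z - y); set P := nm f.
  set Q := nm (f * _); set S := nm (y * f).
  move=> zy ny nf P0 Y0 Z0 N0 S0 Q0 h1 h2 h3 h4 h5.
  have S1 : S <= 1 by nra.
  have Q1 : Q <= 9 / 8 by nra.
  nra.
have fa : c *: (f * a) = c *: (a * f).
  have h1 : adj z * (z * f * adj z) * u = c *: (f * a).
    rewrite !mulrA zz -!scalerAl (Dab (mD (sD pS)) Df) /a; congr (_ *: _).
    by rewrite -(mulrA f (m p)) pz.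
  rewrite -h1 eE -scalerAr -scalerAl /b /a; congr (_ *: _).
  by rewrite !mulrA zq -!mulrA uu mulr1.
by apply: (scalerI c0); apply: esym.
Qed.

(** The projections with nonzero image are finitely many and u permutes their images, so some orbit
    closes up. The factorisations of the successive steps multiply, because conjugation by u
    preserves D. *)
Lemma permuted_pow : exists e N, [/\ D e, e != 0, (0 < N)%N & D (u ^+ N * e)].
Proof.
have [p pS p0] : exists2 p, p \in s & m p != 0.
  apply/not_exists2P => h; have := res_sum1; rewrite big1_seq => [|q /andP[_ qS]].
    by move/eqP; rewrite eq_sym oner_eq0.
  by case: (h q) => // /negP; rewrite negbK => /eqP.
have /choice[nx hnx] : forall p, exists q, p \in s -> m p != 0 ->
    exists w (a : A), [/\ q \in s, u * m p * adj u = m q, q ** w = w, D a & u * m p = m w * a].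
  move=> x; have [xS|xS] := boolP (x \in s); last by exists x.
  have [x00|x00] := eqVneq (m x) 0; first by exists x; rewrite x00.
  by have [q [w [a h]]] := permuted_factor xS x00; exists q => _ _; exists w, a.
have mI x : x \in s -> m x * m x = m x by move=> xS; rewrite -mM sp.
have nzx x : x \in s -> m x != 0 -> nx x \in s /\ m (nx x) != 0.
  move=> xS x00; have [w [a [qS uq _ _ _]]] := hnx _ xS x00; split=> //.
  apply: contra_neq x00 => q0; have : adj u * (u * m x * adj u) * u = 0.
    by rewrite uq q0 mulr0 mul0r.
  by rewrite !mulrA uu mul1r -mulrA uu mulr1.
have it n : iter n nx p \in s /\ m (iter n nx p) != 0.
  by elim: n => // n [h1 h2]; rewrite iterS; apply: nzx.
(* Pigeonhole: the orbit of p has size s + 1 terms in s. *)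
have [i [j [ij eij]]] : exists i j, (i < j)%N /\ iter i nx p = iter j nx p.
  pose l := mkseq (fun n => iter n nx p) (size s).+1.
  have : ~~ uniq l.
    apply/negP => /uniq_leq_size -/(_ s); rewrite size_mkseq ltnn => h.
    suff: false by []; apply: h => x /mapP[n _ ->]; by case: (it n).
  move=> /(uniqPn p)[i [j [ij]]]; rewrite size_mkseq => js.
  by rewrite !nth_mkseq ?(ltn_trans ij) // => e; exists i, j.
pose q := iter i nx p; have [qS q0] := it i; rewrite -/q in qS q0.
have pow n : exists w (a : A), [/\ iter n nx q ** w = w, D a, u ^+ n * m q = m w * a,
    w ** q = w & u ^+ n * m q = m (iter n nx q) * u ^+ n].
  elim: n => [|n [w [a [h1 Da h2 wq h3]]]].
    by exists q, 1; rewrite /= !expr0 sp // mul1r !mulr1.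
  have [nS n0] : iter n nx q \in s /\ m (iter n nx q) != 0.
    by rewrite /q -iterD; apply: it.
  have [w' [a' [_ uq w1 Da' w2]]] := hnx _ nS n0.
  have up : u * m (iter n nx q) = m (nx (iter n nx q)) * u.
    by rewrite -uq -mulrA uu mulr1.
  have un k d : D d -> exists2 d', D d' & d * u ^+ k = u ^+ k * d'.
    move=> Dd; elim: k => [|k [d' Dd' e]]; first by exists d; rewrite // !expr0 mulr1 mul1r.
    exists (adj u * d' * u); first by have [] := unorm Dd'.
    by rewrite exprSr mulrA e !mulrA -(mulrA _ u) uu' mulr1.
  have [a'' Da'' e] := un n _ Da'.
  exists (w' ** w), (a * a''); split.
  - by rewrite cmulA w1.
  - exact: DM.
  - rewrite exprS -mulrA h3 -{1}(mI _ nS) -mulrA -h3 mulrA w2 -mulrA (mulrA a') e.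
    by rewrite -(mulrA (u ^+ n)) (Dab Da'' (mD (sD qS))) (mulrA (u ^+ n)) h2 mM !mulrA.
  - by rewrite -cmulA wq.
  - by rewrite exprS -mulrA h3 mulrA up -mulrA.
exists (m q), (j - i)%N; split=> //; [exact/mD/sD|by rewrite subn_gt0|].
have [w [a [h1 Da h2 wq _]]] := pow (j - i)%N.
(* After a full cycle w = q w q; since d q is a scalar multiple of q, w commutes with every d of the
   masa. *)
rewrite h2; apply: DM => //; apply: mD; apply: (masa_commutant hDX) => d Dd.
have eq : iter (j - i) nx q = q by rewrite /q -iterD subnK 1?ltnW // -eij.
rewrite eq in h1; have [k h3 h4] := resl Dd qS.
by rewrite -{1}wq -cmulA h4 -{2}h1 cmulA h3 cmulZr cmulZl wq h1.
Qed.

End NearPermutation.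

Section NotAF.
Variables (R : realType) (A : cstarAlgType R) (e : A).
Variables (el : left_id e (@cmul R A)) (er : right_id e (@cmul R A)) (e0 : e != 0).
Local Notation B := (unitalize el er e0).
Variables (r : nat -> bool -> bool -> B) (v : nat -> B) (flip : pred nat).
Hypotheses (hr : matrix_units r) (hv : odometer r v flip).
Local Notation D := (diagonal r : set A).

(** [push] carries elements to a later stage without changing their image in the limit, so that
    finitely many of them can be compared in one stage. *)
Lemma diagonal_not_AF : ~ AF_diagonal D.
Proof.
move=> [F [DF [phi [mu [fd hphi hD hN [hmu mphi _ dens DE]]]]]].
have push (P : forall k, set (F k)) : (forall k, phi k @` P k `<=` P k.+1) ->
    forall k j, (k <= j)%N -> forall x, P k x -> exists2 y, P j y & mu j y = mu k x.
  move=> hP k; elim=> [|j ih]; rewrite leq_eqVlt => /predU1P[<-|]; try by move=> x Px; exists x.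
    by rewrite ltn0.
  rewrite ltnS => /ih h x /h[y Py <-]; exists (phi j y) => //.
  by apply: hP; exists y.
have muD k x : DF k x -> D (mu k x).
  by move=> Dx; rewrite DE; apply: subset_closure; exists k => //; exists x.
have [_ [k _ [x0 _ <-]] near] := (denseP _).1 dens (v 0 : A) 8^-1 ltac:(lra).
have [s hs res] := spectral_resolution (fd k).1 (fd k).2.
have [ml mM mS] := hmu k; have [vu vc vs _ _] := hv.
have [D0 D1 DM _ Dc] := diagonal_star_closed hr.
(* An approximant of d may live beyond stage k. Since connecting maps preserve normalisers, w can be
   moved to a common stage. *)
have mnorm w : normaliser (DF k) w -> forall d : B, diagonal r d ->
    diagonal r (((mu k w : B) * d * adj (mu k w : B)) : B).
  move=> nw d Dd; apply: Dc => eps eps0.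
  set z : B := mu k w; have z0 := nm_ge0 z.
  have m0 : 0 < nm z ^+ 2 + 1 by rewrite ltr_wpDl ?sqr_ge0.
  move: Dd; rewrite {1}DE => /closureP/(_ _ (divr_gt0 eps0 m0)).
  case=> _ [j _ [a Da <-]] h.
  have [w' nw' ew] := push _ hN _ _ (leq_maxr j k) _ nw.
  have [a' Da' ea] := push _ hD _ _ (leq_maxl j k) _ Da.
  exists (z * (mu j a : B) * adj z).
    have [_ M S] := hmu (maxn j k).
    rewrite -ea /z -ew -[adj _]/(star _) -S.
    rewrite -[_ * _ * _]/(mu _ w' ** mu _ a' ** mu _ (star w')) -!M.
    by apply: muD; have [] := nw' _ Da'.
  rewrite -mulrBl -mulrBr; have h1 := nmM (z * (d - (mu j a : B))) (adj z).
  have h2 := nmM z (d - (mu j a : B)); rewrite nm_adj in h1.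
  have {}h : nm (d - (mu j a : B)) < eps / (nm z ^+ 2 + 1) by [].
  rewrite ltr_pdivlMr // in h; have := nm_ge0 (d - (mu j a : B)).
  by move: h h1 h2; rewrite expr2; nra.
have [|f [N [Df f0 N0 /(cexp_id hr hv)]]] :=
  @permuted_pow R B (F k) (diagonal r) (DF k) s (mu k) (v 0%N) x0 D1 (diagonal_comm hr hv) D0 DM
  _ (vu 0%N).1 (vu 0%N).2 (odo_normalises hr hv 0%N) (fd k).2 hs res ml mM mS (@muD k) mnorm near.
  move=> a ha t c; have [rM adj_r _ _] := hr; apply: ha; last exact: adj_r.
    by move=> i d; apply: (r_diag_comm hr).
  by rewrite rM eqxx.
(* An element u^N f of D equals E (u^N f) = E (u^N) f = 0, and cancelling the unitary leaves f =
   0. *)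
rewrite -[v 0%N ^+ N]mul1r (cexp_bimod hr hv) // (cexp_vpow hr hv) // mulr0 mul0r mul1r.
move=> /(congr1 ( *%R (adj (v 0%N ^+ N)))) /esym/eqP; rewrite mulr0 mulrA adjX.
suff -> : adj (v 0%N) ^+ N * v 0%N ^+ N = 1 by rewrite mul1r (negbTE f0).
elim: N {N0} => [|N ih]; first by rewrite !expr0 mul1r.
by rewrite exprSr exprS mulrA -(mulrA (_ ^+ N)) (vu 0%N).1 mulr1.
Qed.

End NotAF.

(** * Construction of the system of units and unitaries *)

Section Blocks.
Variables (R : realType) (A : ucstarAlgType R).
Variable r : nat -> bool -> bool -> A.
Hypothesis hr : matrix_units r.
Implicit Types (x y w : A) (h : nat -> A).

Let rM t a b c d : r t a b * r t c d = if b == c then r t a d else 0.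
Proof. by case: hr. Qed.
Let adj_r t a b : adj (r t a b) = r t b a.
Proof. by case: hr. Qed.
Let sum_r t : r t false false + r t true true = 1.
Proof. by case: hr. Qed.

Definition local n : set A := [set x | forall i a b, (i < n)%N -> GRing.comm x (r i a b)].

Lemma local_star_closed n : star_closed (local n).
Proof.
split.
- split=> [i a b _|k x y hx hy i a b ib]; first exact/commr_sym/commr0.
  by rewrite /GRing.comm mulrDl mulrDr -scalerAl -scalerAr hx // hy.
- by move=> i a b _; apply/commr_sym/commr1.
- by move=> x y hx hy i a b ib; apply/commr_sym/commrM/commr_sym/hy => //; apply/commr_sym/hx.
- move=> x hx i a b ib; have /(congr1 adj) := hx i b a ib.
  by rewrite !adjM adj_r.
- move=> x /nclosure_seq[s hs sx] i a b ib.
  apply: (ncvg_unique (ncvgMr (r i a b) sx)).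
  by apply: ncvg_eq (ncvgMl (r i a b) sx); exists 0%N => m _; rewrite (hs m i a b ib).
Qed.

Lemma local_r n t a b : (n <= t)%N -> local n (r t a b).
Proof. by case: hr => _ _ _ h nt i c d ni; apply: h; rewrite neq_ltn (leq_trans ni nt) orbT. Qed.

Lemma local_le n n' x : (n <= n')%N -> local n' x -> local n x.
Proof. by move=> nn h i a b ni; apply: h; apply: leq_trans nn. Qed.

Let locD n x y : local n x -> local n y -> local n (x + y).
Proof. by apply: lin_closedD; have [] := local_star_closed n. Qed.
Let locM n x y : local n x -> local n y -> local n (x * y).
Proof. by have [_ _ h _ _] := local_star_closed n; apply: h. Qed.
Let locA n x : local n x -> local n (adj x).
Proof. by have [_ _ _ h _] := local_star_closed n; apply: h. Qed.
Let loc1 n : local n 1.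
Proof. by have [] := local_star_closed n. Qed.

Lemma unit_mul t a b c d x y : local t.+1 x ->
  (r t a b * x) * (r t c d * y) = if b == c then r t a d * (x * y) else 0.
Proof.
move=> hx; rewrite -mulrA (mulrA x) hx // -mulrA mulrA rM.
by case: eqP; rewrite ?mul0r.
Qed.

Lemma nm_unit_le t a b : nm (r t a b) <= 1.
Proof.
have := nm_cstar (r t a b); rewrite adj_r rM eqxx => h.
have := nm_cstar (r t b b); rewrite adj_r rM eqxx => h'.
have h1 : nm (r t b b) <= 1 by have := nm_ge0 (r t b b); nra.
by have := nm_ge0 (r t a b); nra.
Qed.

(** The blocks are diagonal for [s = false] and antidiagonal for [s = true]; both are orthogonal as
    [nm_orth_sum] requires. *)
Lemma nm_block2 t (s : bool) x y C : 0 <= C -> local t.+1 x -> local t.+1 y ->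
  nm x <= C -> nm y <= C ->
  nm (r t s false * x + r t (~~ s) true * y) <= C.
Proof.
move=> C0 hx hy xC yC.
have -> : r t s false * x + r t (~~ s) true * y =
    \sum_(b <- [:: false; true]) r t (s (+) b) b * (if b then y else x).
  by rewrite big_cons big_seq1 addbF addbT.
have hz (b : bool) : local t.+1 (if b then y else x) by case: b.
apply: nm_orth_sum => // [i j _ _ ij|i _]; last first.
  have := nmM (r t (s (+) i) i) (if i then y else x); have := nm_unit_le t (s (+) i) i.
  have : nm (if i then y else x) <= C by case: (i).
  have := nm_ge0 (if i then y else x); have := nm_ge0 (r t (s (+) i) i); nra.
rewrite !adjM !adj_r; split.
  rewrite -mulrA (mulrA (r _ _ _)) rM eq_sym (can_eq (addKb s)) eq_sym (negbTE ij).
  by rewrite mul0r mulr0.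
rewrite (locA (hz j)) // unit_mul // (negbTE ij).
by [].
Qed.

(** s doublings from level b on, ending in y: adding 1 with carry to an s-bit number, least
    significant bit at level b, with y inserted when the number wraps around. *)
Fixpoint od b s y : A :=
  if s is s'.+1 then r b true false + r b false true * od b.+1 s' y else y.

(** h j stands in the block whose number j has its least significant bit at level b, so that [od]
    moves block j to block j + 1. *)
Fixpoint block_diag b s h : A :=
  if s is s'.+1 then r b false false * block_diag b.+1 s' (fun j => h j.*2)
    + r b true true * block_diag b.+1 s' (fun j => h j.*2.+1)
  else h 0%N.

Lemma od_local b s y : local (b + s) y -> local b (od b s y).
Proof.
elim: s b => [|s ih] b; first by rewrite addn0.
rewrite addnS -addSn => /ih h; apply: locD; first exact: local_r.
by apply: locM; [apply: local_r|apply: local_le h].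
Qed.

Lemma block_diag_local b s h : (forall j, local (b + s) (h j)) -> local b (block_diag b s h).
Proof.
elim: s b h => [|s ih] b h; first by rewrite addn0; apply.
rewrite addnS -addSn => hh.
by apply: locD; apply: locM; do ?[exact: local_r]; apply: local_le (ih _ _ _) => // j; apply: hh.
Qed.

Lemma od_unitary b s y : local (b + s) y -> adj y * y = 1 -> y * adj y = 1 ->
  adj (od b s y) * od b s y = 1 /\ od b s y * adj (od b s y) = 1.
Proof.
elim: s b => [|s ih] b //; rewrite addnS -addSn => hy yy yy' /=.
have [h1 h2] := ih _ hy yy yy'; have ho := od_local hy; set o := od _ _ _ in h1 h2 ho *.
rewrite adjD adjM !adj_r (locA ho) // -[r b true false]mulr1 -[r b false true]mulr1.
rewrite -(mulrA (r b false true)) mul1r -(mulrA (r b true false)) mul1r.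
rewrite !mulrDl !mulrDr !unit_mul //=; try exact: locA.
by rewrite !mulr1 h1 h2 !addr0 !add0r !mulr1 [r b true true + _]addrC sum_r.
Qed.

Lemma od_nmB b s x y : nm (od b s x - od b s y) <= nm (x - y).
Proof.
elim: s b => [|s ih] b //=; rewrite opprD addrACA subrr add0r -mulrBr.
apply: le_trans (ih b.+1); apply: le_trans (nmM _ _) _.
by rewrite ler_piMl ?nm_ge0 ?nm_unit_le.
Qed.

Lemma eq_block_diag b s h h' : (forall j, h j = h' j) -> block_diag b s h = block_diag b s h'.
Proof. by move=> e; congr block_diag; apply/funext. Qed.

Lemma block_diagM b s h h' : (forall j, local (b + s) (h j)) ->
  block_diag b s h * block_diag b s h' = block_diag b s (fun j => h j * h' j).
Proof.
elim: s b h h' => [|s ih] b h h' //; rewrite addnS -addSn => hh /=.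
have hl (k : nat -> nat) : local b.+1 (block_diag b.+1 s (fun j => h (k j))).
  by apply: block_diag_local => j; apply: hh.
rewrite !mulrDl !mulrDr !unit_mul //=; try exact: hl.
by rewrite addr0 add0r !ih //; try by move=> j; apply: hh.
Qed.

Lemma block_diag_adj b s h : (forall j, local (b + s) (h j)) ->
  adj (block_diag b s h) = block_diag b s (fun j => adj (h j)).
Proof.
elim: s b h => [|s ih] b h //; rewrite addnS -addSn => hh /=.
have hl (k : nat -> nat) : local b.+1 (block_diag b.+1 s (fun j => h (k j))).
  by apply: block_diag_local => j; apply: hh.
rewrite adjD !adjM !adj_r !(locA (hl _)) // !ih //; try by move=> j; apply: hh.
Qed.

Lemma block_diag1 b s : block_diag b s (fun=> 1) = 1.
Proof. by elim: s b => [|s ih] b //=; rewrite ih !mulr1 sum_r. Qed.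

Lemma block_diagB b s h h' :
  block_diag b s h - block_diag b s h' = block_diag b s (fun j => h j - h' j).
Proof.
elim: s b h h' => [|s ih] b h h' //=.
by rewrite opprD addrACA -!mulrBr !ih.
Qed.

Lemma nm_block_diag b s h C : 0 <= C -> (forall j, local (b + s) (h j)) ->
  (forall j, (j < 2 ^ s)%N -> nm (h j) <= C) -> nm (block_diag b s h) <= C.
Proof.
move=> C0; elim: s b h => [|s ih] b h; first by move=> _ /(_ 0%N); apply.
rewrite addnS -addSn => hh hC /=.
apply: (@nm_block2 _ false) => //; try by apply: block_diag_local => j; apply: hh.
  by apply: ih => [j|j js]; [apply: hh|apply: hC; rewrite expnS mul2n ltn_double].
apply: ih => [j|j js]; [exact: hh|apply: hC].
by rewrite expnS mul2n -doubleS leq_double.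
Qed.

(* Diagonal weights slide through the odometer, whose wrap-around weight is y. *)
Lemma block_diag_od b s h y : (forall j, local (b + s) (h j)) -> h (2 ^ s)%N = h 0%N * y ->
  block_diag b s h * od b s y = od b s 1 * block_diag b s (fun j => h j.+1).
Proof.
elim: s b h => [|s ih] b h; first by rewrite /= mul1r => _ ->.
rewrite addnS -addSn => hh hy /=.
have hl (k : nat -> nat) : local b.+1 (block_diag b.+1 s (fun j => h (k j))).
  by apply: block_diag_local => j; apply: hh.
have ho : local b.+1 (od b.+1 s 1) by apply: od_local; apply: loc1.
rewrite -[r b true false]mulr1 !mulrDl !mulrDr !unit_mul //=; try exact: hl; try exact: loc1.
rewrite !mulr1 mul1r addr0 !add0r [LHS]addrC; congr (_ + _ * _).
by apply: ih => [j|]; [apply: hh|rewrite -mul2n -expnS].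
Qed.

End Blocks.

(** * A path of unitaries from 1 to a flip *)

Section Rotation.
Variables (R : realType) (A : ucstarAlgType R).
Variable r : nat -> bool -> bool -> A.
Hypothesis hr : matrix_units r.
Implicit Types (v w q : A) (x y : R).

Let rM t a b c d : r t a b * r t c d = if b == c then r t a d else 0.
Proof. by case: hr. Qed.
Let adj_r t a b : adj (r t a b) = r t b a.
Proof. by case: hr. Qed.
Let sum_r t : r t false false + r t true true = 1.
Proof. by case: hr. Qed.

Definition local_unitary n : set A :=
  [set v | [/\ local r n v, adj v * v = 1 & v * adj v = 1]].

Lemma local_unitary1 n : local_unitary n 1.
Proof. by split; rewrite ?adj1 ?mulr1 //; have [] := local_star_closed hr n. Qed.

Lemma local_unitaryM n v w : local_unitary n v -> local_unitary n w -> local_unitary n (v * w).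
Proof.
move=> [lv v1 v2] [lw w1 w2]; have [_ _ h _ _] := local_star_closed hr n.
by split; rewrite ?adjM; [apply: h|rewrite mulrA -(mulrA (adj w)) v1 mulr1|
  rewrite mulrA -(mulrA v) w2 mulr1].
Qed.

Lemma local_unitary_adj n v : local_unitary n v -> local_unitary n (adj v).
Proof.
move=> [lv v1 v2]; have [_ _ _ h _] := local_star_closed hr n.
by split; rewrite ?adjK //; apply: h.
Qed.

Lemma local_unitary_le n n' v : (n <= n')%N -> local_unitary n' v -> local_unitary n v.
Proof. by move=> nn [/(local_le nn)]. Qed.

(* A rational parametrisation of the quarter circle. *)
Let cos_ x : R := (1 - x ^+ 2) / (1 + x ^+ 2).
Let sin_ x : R := 2 * x / (1 + x ^+ 2).

Let den_gt0 x : 0 < 1 + x ^+ 2. Proof. by rewrite ltr_pwDl ?sqr_ge0. Qed.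

Lemma quarter_circle x : cos_ x ^+ 2 + sin_ x ^+ 2 = 1.
Proof.
have := den_gt0 x => /lt0r_neq0 h; rewrite /cos_ /sin_ !expr_div_n -mulrDl.
by apply: (canLR (mulfK _)); [rewrite expf_neq0|ring].
Qed.

Lemma cos_lip x y : 0 <= x <= 1 -> 0 <= y <= 1 -> `|cos_ x - cos_ y| <= 4 * `|x - y|.
Proof.
move=> /andP[x0 x1] /andP[y0 y1]; have hx := den_gt0 x; have hy := den_gt0 y.
have -> : cos_ x - cos_ y = (2 * (x + y) / ((1 + x ^+ 2) * (1 + y ^+ 2))) * (y - x).
  by rewrite /cos_; field; rewrite !lt0r_neq0.
rewrite normrM distrC ler_wpM2r // ger0_norm; last first.
  by rewrite divr_ge0 ?mulr_ge0 ?addr_ge0 ?sqr_ge0.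
rewrite ler_pdivrMr ?mulr_gt0 //.
have : 1 <= (1 + x ^+ 2) * (1 + y ^+ 2) by have := sqr_ge0 x; have := sqr_ge0 y; nra.
by nra.
Qed.

Lemma sin_lip x y : 0 <= x <= 1 -> 0 <= y <= 1 -> `|sin_ x - sin_ y| <= 2 * `|x - y|.
Proof.
move=> /andP[x0 x1] /andP[y0 y1]; have hx := den_gt0 x; have hy := den_gt0 y.
have -> : sin_ x - sin_ y = (2 * (1 - x * y) / ((1 + x ^+ 2) * (1 + y ^+ 2))) * (x - y).
  by rewrite /sin_; field; rewrite !lt0r_neq0.
have xy0 : 0 <= x * y by apply: mulr_ge0.
have xy1 : x * y <= 1 by nra.
rewrite normrM ler_wpM2r // ger0_norm; last first.
  by rewrite divr_ge0 ?mulr_ge0 ?subr_ge0 ?addr_ge0 ?sqr_ge0.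
rewrite ler_pdivrMr ?mulr_gt0 //.
have : 1 <= (1 + x ^+ 2) * (1 + y ^+ 2) by have := sqr_ge0 x; have := sqr_ge0 y; nra.
by nra.
Qed.

Variable n : nat.
Local Notation p00 := (r n false false).
Local Notation p01 := (r n false true).
Local Notation p10 := (r n true false).
Local Notation p11 := (r n true true).

(** A partial isometry with initial projection p00, onto the line spanned by (cos, sin). *)
Let rot x : A := (cos_ x)%:C%C *: p00 + (sin_ x)%:C%C *: p10.

Definition rot_proj x : A := rot x * adj (rot x).

Let adj_rot x : adj (rot x) = (cos_ x)%:C%C *: p00 + (sin_ x)%:C%C *: p01.
Proof.
by rewrite /rot adjD !adjZ !adj_r !conj_realC.
Qed.

Let rot_iso x : adj (rot x) * rot x = p00.
Proof.
rewrite adj_rot /rot mulrDl !mulrDr -!scalerAl -!scalerAr !rM /= !scaler0 addr0 add0r.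
by rewrite !scalerA -scalerDl -!expr2 -!rmorphXn -rmorphD /= quarter_circle scale1r.
Qed.

Lemma adj_rot_proj x : adj (rot_proj x) = rot_proj x.
Proof. by rewrite adjM adjK. Qed.

Lemma rot_proj_idem x : rot_proj x * rot_proj x = rot_proj x.
Proof.
rewrite /rot_proj mulrA -(mulrA (rot x)) rot_iso; congr (_ * _).
by rewrite /rot mulrDl -!scalerAl !rM.
Qed.

Lemma rot_proj0 : rot_proj 0 = p00.
Proof.
rewrite /rot_proj adj_rot /rot /cos_ /sin_ expr0n /= subr0 addr0 mulr0 mul0r divr1.
by rewrite !scale1r !scale0r !addr0 rM.
Qed.

Lemma rot_proj1 : rot_proj 1 = p11.
Proof.
rewrite /rot_proj adj_rot /rot /cos_ /sin_ expr1n /= subrr mul0r mulr1 divff ?lt0r_neq0 //.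
by rewrite !scale1r !scale0r !add0r rM.
Qed.

Lemma rot_proj_local x : local r n (rot_proj x).
Proof.
have [[_ hl] _ hM hA _] := local_star_closed hr n.
have h : local r n (rot x).
  by apply: (hl) (local_r hr _ _ (leqnn n)) _; apply: (lin_closedZ _ (conj _ hl));
    [have [[]] := local_star_closed hr n|apply: local_r].
by apply: hM => //; apply: hA.
Qed.

Lemma comm_rot_proj v x : local r n.+1 v -> GRing.comm v (rot_proj x).
Proof.
move=> hv; rewrite /rot_proj adj_rot /rot.
have h (a b : bool) (k : R[i]) : GRing.comm v (k *: r n a b).
  by rewrite /GRing.comm -scalerAl -scalerAr hv.
by apply: commrM; apply: commrD.
Qed.

(** The constants 4 and 2 of cosine and sine add up to 6, which doubles because [rot] occurs twice
    in the projection. *)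
Lemma rot_proj_lip x y : 0 <= x <= 1 -> 0 <= y <= 1 ->
  nm (rot_proj x - rot_proj y) <= 12 * `|x - y|.
Proof.
move=> hx hy; have n1 z : nm (rot z) <= 1.
  have := nm_cstar (rot z); rewrite rot_iso; have := nm_unit_le hr n false false.
  by have := nm_ge0 (rot z); nra.
have dn : nm (rot x - rot y) <= 6 * `|x - y|.
  have -> : rot x - rot y = (cos_ x - cos_ y)%:C%C *: p00 + (sin_ x - sin_ y)%:C%C *: p10.
    by rewrite /rot opprD addrACA -!scalerBl !rmorphB.
  apply: le_trans (nmD _ _) _; rewrite !nmZ !cabsR.
  have := cos_lip hx hy; have := sin_lip hx hy.
  have := nm_unit_le hr n false false; have := nm_unit_le hr n true false.
  have := nm_ge0 p00; have := nm_ge0 p10.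
  have := normr_ge0 (cos_ x - cos_ y); have := normr_ge0 (sin_ x - sin_ y); nra.
have -> : rot_proj x - rot_proj y =
    (rot x - rot y) * adj (rot x) + rot y * adj (rot x - rot y).
  by rewrite /rot_proj adjB mulrBl mulrBr addrA subrK.
apply: le_trans (nmD _ _) _.
have := nmM (rot x - rot y) (adj (rot x)); have := nmM (rot y) (adj (rot x - rot y)).
rewrite !nm_adj; have := n1 x; have := n1 y; have := nm_ge0 (rot x); have := nm_ge0 (rot y).
have := nm_ge0 (rot x - rot y); nra.
Qed.

(** For a projection q commuting with the unitary v: the unitary that is v under q and 1 under 1 -
    q. *)
Definition cut v q : A := 1 - q + v * q.

Lemma cutM v w q : q * q = q -> GRing.comm w q -> cut v q * cut w q = cut (v * w) q.
Proof.
move=> qq wq; have q1 : q * (1 - q) = 0 by rewrite mulrBr mulr1 qq subrr.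
have q2 : (1 - q) * q = 0 by rewrite mulrBl mul1r qq subrr.
have q3 : (1 - q) * (1 - q) = 1 - q by rewrite mulrBl mul1r q1 subr0.
rewrite /cut mulrDl (mulrDr (1 - q)) (mulrDr (v * q)) q3 -(mulrA v q (1 - q)) q1 mulr0 add0r wq
  (mulrA (1 - q)) q2.
by rewrite mul0r addr0 (mulrA (v * q)) -(mulrA v q q) qq -(mulrA v q w) -wq mulrA.
Qed.

Lemma adj_cut v q : adj q = q -> GRing.comm v q -> adj (cut v q) = cut (adj v) q.
Proof.
move=> sq vq; rewrite /cut adjD adjB adj1 adjM sq; congr (_ + _).
by have := congr1 adj vq; rewrite !adjM sq.
Qed.

Lemma cut_unitary k v x : (k <= n)%N -> local_unitary n.+1 v ->
  local_unitary k (cut v (rot_proj x)).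
Proof.
move=> kn [lv v1 v2]; have [hl h1 hM hA _] := local_star_closed hr k.
have lq : local r k (rot_proj x) by apply: local_le (rot_proj_local x).
have lv' : local r n.+1 (adj v) by have [_ _ _ h _] := local_star_closed hr n.+1; apply: h.
split.
- apply: (lin_closedD hl); last by apply: hM => //; apply: local_le lv; apply: leqW.
  by rewrite -scaleN1r addrC; case: hl => _; apply.
- rewrite adj_cut ?adj_rot_proj //; last exact: comm_rot_proj.
  rewrite cutM ?rot_proj_idem ?v1 /cut ?mul1r ?subrK //; exact: comm_rot_proj.
- rewrite adj_cut ?adj_rot_proj //; last exact: comm_rot_proj.
  rewrite cutM ?rot_proj_idem ?v2 /cut ?mul1r ?subrK //; exact: comm_rot_proj.
Qed.

Definition flip_block v : A := p00 * v + p11 * adj v.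

(** v stays on p00 while the projection carrying v^* turns from p00, where the two cancel, to p11,
    where they form the flip. Only the projection depends on x, so the speed of the path is bounded
    uniformly in v. *)
Definition flip_path v x : A := cut v (rot_proj 0) * cut (adj v) (rot_proj x).

Lemma flip_path_unitary v x : local_unitary n.+1 v -> local_unitary n (flip_path v x).
Proof.
by move=> hv; apply: local_unitaryM; apply: cut_unitary => //; apply: local_unitary_adj.
Qed.

Lemma flip_path0 v : local_unitary n.+1 v -> flip_path v 0 = 1.
Proof.
move=> hv; have [lv _ v2] := hv; have [lv' _ _] := local_unitary_adj hv.
by rewrite /flip_path cutM ?rot_proj_idem ?v2 /cut ?mul1r ?subrK //; apply: comm_rot_proj.
Qed.

Lemma flip_path1 v : local_unitary n.+1 v -> flip_path v 1 = flip_block v.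
Proof.
move=> hv; have [lv _ v2] := hv; have [lv' _ _] := local_unitary_adj hv.
rewrite /flip_path rot_proj0 rot_proj1 /cut /flip_block.
have -> : 1 - p00 = p11 by rewrite -(sum_r n) addrC addKr.
have -> : 1 - p11 = p00 by rewrite -(sum_r n) addrK.
rewrite mulrDl !mulrDr rM /= add0r !lv // !lv' // mulrA rM eqxx addrC; congr (_ + _).
rewrite -!mulrA lv // (mulrA p00 p00) rM eqxx (mulrA v) lv // !mulrA rM /= !mul0r.
by rewrite addr0.
Qed.

End Rotation.

(** * One block conjugated to nearly plain doublings *)

Section Theta.
Variables (R : realType) (A : ucstarAlgType R).
Variable r : nat -> bool -> bool -> A.
Hypothesis hr : matrix_units r.
Variables (b s : nat).
Implicit Types (v w : A).
Local Notation n := (b + s)%N.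
Local Notation U := (local_unitary r n.+1).

(** The path is run through once during the 2^s steps of the odometer. *)
Definition weight v (j : nat) : A := flip_path r n v (j%:R / 2 ^+ s).

(* The unitary W such that W^* theta(v) W runs through s doublings and one flip. *)
Definition intertwiner v : A := block_diag r b s (weight v).

Definition theta v : A := intertwiner v * od r b s (flip_block r n v) * adj (intertwiner v).

Lemma weight_unitary v j : U v -> local_unitary r n (weight v j).
Proof. exact: flip_path_unitary. Qed.

Lemma weight_local v j : U v -> local r n (weight v j).
Proof. by move=> /(weight_unitary j)[]. Qed.

Lemma intertwiner_unitary v : U v -> local_unitary r b (intertwiner v).
Proof.
move=> Uv; have hl j := weight_local j Uv.
have hl' j : local r n (adj (weight v j)) by have [_ _ _ h _] := local_star_closed hr n; apply: h.
split; first exact: block_diag_local.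
  rewrite block_diag_adj // block_diagM // -[RHS](block_diag1 hr b s).
  by apply: eq_block_diag => j; have [] := weight_unitary j Uv.
rewrite block_diag_adj // block_diagM // -[RHS](block_diag1 hr b s).
by apply: eq_block_diag => j; have [] := weight_unitary j Uv.
Qed.

Lemma flip_block_unitary v : U v -> local_unitary r n (flip_block r n v).
Proof. by move=> Uv; rewrite -(flip_path1 hr Uv); apply: flip_path_unitary. Qed.

Lemma od_local_unitary y : local_unitary r n y -> local_unitary r b (od r b s y).
Proof.
move=> [ly y1 y2]; have [h1 h2] := od_unitary hr ly y1 y2.
by split=> //; apply: od_local.
Qed.

Lemma theta_unitary v : U v -> local_unitary r b (theta v).
Proof.
move=> Uv; have hW := intertwiner_unitary Uv.
do 2?[apply: local_unitaryM => //]; last exact: local_unitary_adj.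
exact/od_local_unitary/flip_block_unitary.
Qed.

Lemma nm_unitaryM v w : adj v * v = 1 -> nm (v * w) = nm w.
Proof.
move=> v1; apply/eqP; rewrite -(@eqrXn2 _ 2) ?nm_ge0 //.
by rewrite -!nm_cstar adjM -mulrA (mulrA _ v) v1 mul1r.
Qed.

Lemma nm_Munitary v w : v * adj v = 1 -> nm (w * v) = nm w.
Proof. by move=> v1; rewrite -nm_adj adjM nm_unitaryM ?nm_adj // adjK. Qed.

(** 24 = 2 * 12: nm (v^* - 1) <= 2, times the Lipschitz constant of the projections. *)
Lemma weight_step v j : U v -> (j < 2 ^ s)%N -> nm (weight v j.+1 - weight v j) <= 24 / 2 ^+ s.
Proof.
move=> Uv js; have s0 : 0 < (2 : R) ^+ s by rewrite exprn_gt0.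
have hx (i : nat) : (i <= 2 ^ s)%N -> 0 <= (i%:R / 2 ^+ s : R) <= 1.
  move=> is_; rewrite divr_ge0 ?(ltW s0) //= ler_pdivrMr // mul1r -natrX ler_nat //.
rewrite /weight /flip_path -mulrBr.
have [_ c1 _] := cut_unitary hr 0 (leqnn n) Uv; rewrite nm_unitaryM //.
set x := _ / _; set y := j%:R / _.
have -> : cut (adj v) (rot_proj r n x) - cut (adj v) (rot_proj r n y) =
    (adj v - 1) * (rot_proj r n x - rot_proj r n y).
  rewrite /cut mulrBl mul1r mulrBr !opprB !opprD !opprK.
  by rewrite addrACA (addrACA 1) subrr add0r [LHS]addrC; congr (_ + _); rewrite addrC.
apply: le_trans (nmM _ _) _.
have v2 : nm (adj v - 1) <= 2.
  apply: le_trans (nmB _ _) _; rewrite nm_adj nm1.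
  by have [_ v1 _] := Uv; rewrite (nm_unitary v1).
have := rot_proj_lip hr n (hx _ js) (hx _ (ltnW js)).
have -> : `|x - y| = (2 ^+ s)^-1.
  rewrite /x /y -mulrBl -natrB // subSnn mul1r ger0_norm // invr_ge0 ltW //.
have := nm_ge0 (adj v - 1); have := nm_ge0 (rot_proj r n x - rot_proj r n y).
have : 0 < (2 ^+ s : R)^-1 by rewrite invr_gt0.
rewrite -/x -/y; set q := nm (rot_proj _ _ _ - _); set t := _^-1; nra.
Qed.

(** The weights slide through the odometer: the flip at the wrap-around is absorbed as the end point
    of the path, and what is left is [od] with end 1 times the block diagonal of the quotients of
    consecutive weights. *)
Lemma theta_near v : U v -> nm (theta v - od r b s 1) <= 24 / 2 ^+ s.
Proof.
move=> Uv; have hl j := weight_local j Uv.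
have hA x : local r n x -> local r n (adj x) by have [_ _ _ h _] := local_star_closed hr n;
  apply: h.
have [lo o1 o2] : local_unitary r b (od r b s 1) by apply/od_local_unitary/local_unitary1.
have -> : theta v = od r b s 1 * block_diag r b s (fun j => weight v j.+1 * adj (weight v j)).
  rewrite /theta /intertwiner block_diag_od //; last first.
    rewrite /weight mul0r flip_path0 // mul1r natrX divff ?expf_neq0 ?pnatr_eq0 //.
    by rewrite flip_path1.
  by rewrite -mulrA block_diag_adj // block_diagM // => j; apply: hA.
rewrite -[X in _ - X]mulr1 -mulrBr nm_unitaryM // -(block_diag1 hr b s) block_diagB.
apply: nm_block_diag => //.
- move=> j; have [hlin h1 hM _ _] := local_star_closed hr n.
  have : local r n (weight v j.+1 * adj (weight v j)) by apply: hM => //; apply: hA.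
  by move=> h; rewrite -scaleN1r addrC; case: hlin => _; apply.
move=> j js; apply: le_trans (weight_step Uv js).
have [_ u1 u2] := weight_unitary j Uv.
by rewrite -u2 -mulrBl nm_Munitary ?nm_adj // adjK.
Qed.

Lemma weight_lip v w j : U v -> U w -> nm (weight v j - weight w j) <= 2 * nm (v - w).
Proof.
move=> Uv Uw; rewrite /weight /flip_path; set x := _ / _.
have nq y : nm (rot_proj r n y) <= 1.
  have := nm_cstar (rot_proj r n y); rewrite adj_rot_proj // rot_proj_idem //.
  by have := nm_ge0 (rot_proj r n y); nra.
have cl (u u' : A) y : nm (cut u (rot_proj r n y) - cut u' (rot_proj r n y)) <= nm (u - u').
  rewrite /cut opprD addrACA subrr add0r -mulrBl; apply: le_trans (nmM _ _) _.
  by rewrite ler_piMr ?nm_ge0.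
set a := cut v _; set a' := cut w _; set c := cut (adj v) _; set c' := cut (adj w) _.
have -> : a * c - a' * c' = (a - a') * c + a' * (c - c').
  by rewrite mulrBl mulrBr addrA subrK.
have [_ _ cu] := cut_unitary hr x (leqnn n) (local_unitary_adj hr Uv).
have [_ au _] := cut_unitary hr 0 (leqnn n) Uw.
apply: le_trans (nmD _ _) _; rewrite nm_Munitary // nm_unitaryM //.
have := cl (adj v) (adj w) x; rewrite -adjB nm_adj.
by have := cl v w 0; rewrite -/a -/a' -/c -/c'; lra.
Qed.

(** 5 = 2 + 1 + 2: [intertwiner] is 2-Lipschitz and occurs twice, and the middle factor is
    1-Lipschitz. *)
Lemma theta_lip v w : U v -> U w -> nm (theta v - theta w) <= 5 * nm (v - w).
Proof.
move=> Uv Uw; have [_ v1 v2] := intertwiner_unitary Uv.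
have [_ w1 w2] := intertwiner_unitary Uw.
have [_ ov1 ov2] := od_local_unitary (flip_block_unitary Uv).
have [_ ow1 ow2] := od_local_unitary (flip_block_unitary Uw).
have Wl : nm (intertwiner v - intertwiner w) <= 2 * nm (v - w).
  rewrite block_diagB; apply: nm_block_diag => //.
  - by rewrite mulr_ge0 ?nm_ge0.
  - move=> j; have [[_ h] _ _ _ _] := local_star_closed hr n.
    by rewrite -scaleN1r addrC; apply: h; apply: weight_local.
  - by move=> j _; apply: weight_lip.
have fl : nm (flip_block r n v - flip_block r n w) <= nm (v - w).
  rewrite /flip_block opprD addrACA -!mulrBr -adjB.
  have [lv _ _] := Uv; have [lw _ _] := Uw.
  have lvw : local r n.+1 (v - w).
    have [[_ h] _ _ _ _] := local_star_closed hr n.+1.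
    by rewrite -scaleN1r addrC; apply: h.
  apply: (@nm_block2 _ _ _ hr n false) => //; rewrite ?nm_ge0 ?nm_adj //.
  by have [_ _ _ h _] := local_star_closed hr n.+1; apply: h.
rewrite /theta; set a := intertwiner v in v1 v2 Wl *; set a' := intertwiner w in w1 w2 Wl *.
set o := od _ _ _ (flip_block _ _ v) in ov1 ov2 *.
set o' := od _ _ _ (flip_block _ _ w) in ow1 ow2 *.
have oo : nm (o - o') <= nm (v - w) by apply: le_trans (od_nmB hr _ _ _ _) fl.
have -> : a * o * adj a - a' * o' * adj a' =
    (a - a') * o * adj a + (a' * (o - o') * adj a + a' * o' * adj (a - a')).
  by rewrite adjB !mulrBl !mulrBr !mulrBl !addrA !subrK.
rewrite (le_trans (nmD _ _)) //.
have := nmD (a' * (o - o') * adj a) (a' * o' * adj (a - a')).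
have n1 : nm ((a - a') * o * adj a) = nm (a - a') by rewrite nm_Munitary ?adjK // nm_Munitary.
have n2 : nm (a' * (o - o') * adj a) = nm (o - o') by rewrite nm_Munitary ?adjK // nm_unitaryM.
have n3 : nm (a' * o' * adj (a - a')) = nm (a - a') by rewrite -mulrA !nm_unitaryM // nm_adj.
by rewrite n1 n2 n3; lra.
Qed.

End Theta.

(** * Solving the equations along the blocks *)

Section Construction.
Variables (R : realType) (A : ucstarAlgType R).
Variable r : nat -> bool -> bool -> A.
Hypotheses (hr : matrix_units r) (hgen : generating [set x | exists t a b, x = r t a b]).
Implicit Types (x y w : A).

(** Block k consists of [len k] doublings and one flip, from level [off k] on. The rate 4 is for
    convergence: n applications of theta cost a factor 5^n, while block k + n contributes 24 / 2^(4
    (k + n) + 1), and 5/16 < 1/2. *)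
Let len k := (4 * k).+1.
Let off := fix off k := if k is k'.+1 then (off k' + len k').+1 else 0%N.
Local Notation U k := (local_unitary r (off k)).
Local Notation th k := (theta r (off k) (len k)).

Lemma local_unitary_ncvg n (f : nat -> A) l :
  (forall m, local_unitary r n (f m)) -> ncvg f l -> local_unitary r n l.
Proof.
move=> hf fl; have fa := ncvg_adj fl; split.
- have [_ _ _ _] := local_star_closed hr n; apply.
  by apply: ncvg_nclosure fl; exists 0%N => m _; have [] := hf m.
- apply: (ncvg_unique (ncvgM fa fl)); apply: ncvg_eq (ncvg_cst 1).
  by exists 0%N => m _; have [_ -> _] := hf m.
- apply: (ncvg_unique (ncvgM fl fa)); apply: ncvg_eq (ncvg_cst 1).
  by exists 0%N => m _; have [_ _ ->] := hf m.
Qed.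

(** An approximation of u_k that takes n blocks into account and replaces block k + n by doublings
    ending in 1. *)
Let approx := fix approx n k : A :=
  if n is n'.+1 then th k (approx n' k.+1) else od r (off k) (len k) 1.

Let approx_unitary n k : U k (approx n k).
Proof.
elim: n k => [|n ih] k; last by apply: (theta_unitary hr); exact: (ih k.+1).
exact: (od_local_unitary hr (local_unitary1 hr _)).
Qed.

Let approx_step n k : nm (approx n.+1 k - approx n k) <= 24 * 2^-1 ^+ n.
Proof.
(* [theta_near] bounds the change in block k + n, and each of the n blocks before it multiplies the
   change by at most 5. *)
suff h : nm (approx n.+1 k - approx n k) <= 5 ^+ n * (24 / 2 ^+ len (k + n)).
  apply: le_trans h _; rewrite mulrCA ler_pM2l //.
  have -> : (2 : R) ^+ len (k + n) = 2 * 16 ^+ k * 16 ^+ n.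
    by rewrite /len exprS exprM -mulrA -exprD -natrX.
  have k1 : 1 <= (16 : R) ^+ k by apply: exprn_ege1; rewrite ler1n.
  have h0 : (2 : R)^-1 ^+ n * 16 ^+ n = 8 ^+ n.
    by rewrite -exprMn; congr (_ ^+ n); lra.
  have n0 : 0 < (16 : R) ^+ n by apply: exprn_gt0.
  rewrite ler_pdivrMr; last by rewrite !mulr_gt0 ?exprn_gt0.
  rewrite mulrCA h0.
  have : (5 : R) ^+ n <= 8 ^+ n by rewrite lerXn2r ?nnegrE // ler_nat.
  have : 0 <= (5 : R) ^+ n by apply: exprn_ge0.
  nra.
elim: n k => [|n ih] k.
  rewrite expr0 mul1r addn0; apply: (theta_near hr); exact: (approx_unitary 0 k.+1).
apply: le_trans (@theta_lip _ _ _ hr (off k) (len k) _ _ (approx_unitary n.+1 k.+1)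
  (approx_unitary n k.+1)) _.
rewrite exprS -mulrA ler_pM2l // addnS -addSn; exact: ih.
Qed.

Lemma odometer_fixpoint : exists u : nat -> A,
  forall k, U k (u k) /\ u k = th k (u k.+1).
Proof.
have /choice[u hu] : forall k, exists l, ncvg (approx^~ k) l.
  by move=> k; apply: (geometric_cvg (C := 24)) => n; apply: approx_step.
have Uu k : U k (u k) by apply: local_unitary_ncvg (hu k) => n; apply: approx_unitary.
exists u => k; split=> //.
have h1 : ncvg (fun n => approx n.+1 k) (u k).
  by move=> e /(hu k)[N hN]; exists N => n Nn; apply: hN; apply: leqW.
apply: ncvg_unique h1 _ => e e0.
have [N hN] := hu k.+1 (e / 6) ltac:(lra); exists N => n /hN h.
apply: le_lt_trans (@theta_lip _ _ _ hr (off k) (len k) _ _ (approx_unitary n k.+1)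
  (Uu k.+1)) _.
by lra.
Qed.

Let offS k : off k.+1 = (off k + len k).+1. Proof. by []. Qed.

Let off_le k l : (k <= l)%N -> (off k <= off l)%N.
Proof.
by move=> /subnK <-; elim: (l - k)%N => // m; rewrite addSn offS => h; lia.
Qed.

(* Position t lies in block k at depth j when state t = (k, j). *)
Let next (p : nat * nat) := if p.2 == len p.1 then (p.1.+1, 0%N) else (p.1, p.2.+1).
Let state t := iter t next (0%N, 0%N).

Let stateP t : t = (off (state t).1 + (state t).2)%N /\ ((state t).2 <= len (state t).1)%N.
Proof.
elim: t => // t [e h]; rewrite /state iterS -/(state t) /next.
case: eqP => [ej|nj].
  by split=> //; rewrite -[RHS]/(off (state t).1.+1 + 0)%N addn0 offS -ej -e.
by rewrite /= addnS -e; split=> //; rewrite ltn_neqAle h andbT; apply/eqP.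
Qed.

Let block_lt t : (t < off (state t).1.+1)%N.
Proof. by have [e h] := stateP t; rewrite offS; lia. Qed.

Let state_uniq k j : (j <= len k)%N -> state (off k + j) = (k, j).
Proof.
move=> jk; have [e h] := stateP (off k + j).
have [kl|kl|kl] := ltngtP k (state (off k + j)).1.
- by have := off_le kl; rewrite offS; lia.
- by have := off_le kl; rewrite offS; lia.
- by move: e; rewrite -kl => /addnI e; rewrite [LHS]surjective_pairing -kl -e.
Qed.

Let state_next t : state t.+1 = next (state t). Proof. by []. Qed.

(** Serves to recover the conjugating unitaries from the system, and so to show that the system
    generates. *)
Lemma intertwiner_in (S : set A) b s v : star_closed S ->
  (forall i c d, (i <= b + s)%N -> S (r i c d)) -> S v -> S (intertwiner r b s v).
Proof.
move=> [hl S1 SM SA _] Sr Sv; have [_ lin] := hl.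
have SB x y : S x -> S y -> S (x - y) by rewrite -scaleN1r addrC => hx hy; apply: lin.
have SD x y : S x -> S y -> S (x + y) by apply: lin_closedD.
have SZ (k : R[i]) x : S x -> S (k *: x) by apply: lin_closedZ.
have Sq (x : R) : S (rot_proj r (b + s) x).
  by apply: SM; [|apply: SA]; apply: SD; apply: SZ; apply: Sr.
have Sc x (y : R) : S x -> S (cut x (rot_proj r (b + s) y)).
  by move=> Sx; apply: SD; [apply: SB|apply: SM].
have : forall j, S (weight r b s v j) by move=> j; apply: SM; apply: Sc => //; apply: SA.
rewrite /intertwiner; move: (weight r b s v) => h {Sq Sc}.
elim: s b h Sr => [|s ih] b h Sr Sh /=; first exact: Sh.
by apply: SD; (apply: SM; first by apply: Sr; rewrite leq_addr);
  apply: ih => // i c d; rewrite addSn -addnS; apply: Sr.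
Qed.

(** V_k is the product W_0 ... W_(k-1) of the intertwiners. In block k the given units and the
    partial odometers are conjugated by V_(k+1); as u_k is W_k (doublings, then a flip) W_k^*, the
    blocks fit together where they meet. *)
Lemma odometer_exists : exists (r' : nat -> bool -> bool -> A) (v : nat -> A) flip,
  matrix_units r' /\ odometer r' v flip.
Proof.
have [u hu] := odometer_fixpoint.
have Uu k : U k (u k) by have [] := hu k.
pose W k := intertwiner r (off k) (len k) (u k.+1).
have UW k : U k (W k) by apply: intertwiner_unitary => //; exact: (Uu k.+1).
have [V [V0 VS]] : exists V : nat -> A, V 0%N = 1 /\ forall k, V k.+1 = V k * W k.
  by exists (fix V k := if k is k'.+1 then V k' * W k' else 1).
have Vtail k l : (k <= l)%N -> exists2 y, U k y & V l = V k * y.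
  move=> /subnK <-; elim: (l - k)%N => [|m [y Uy e]].
    by exists 1; rewrite ?mulr1 //; apply: local_unitary1.
  exists (y * W (m + k)%N); last by rewrite addSn VS e mulrA.
  by apply: local_unitaryM => //; apply: local_unitary_le (UW _); apply/off_le/leq_addl.
have [V1 V2] : (forall l, adj (V l) * V l = 1) /\ (forall l, V l * adj (V l) = 1).
  by split=> l; have [y [_ y1 y2] ->] := Vtail 0%N l isT; rewrite V0 mul1r.
pose Ad l x := V l * x * adj (V l).
have AdM l x y : Ad l x * Ad l y = Ad l (x * y).
  by rewrite /Ad !mulrA -(mulrA _ (adj (V l)) (V l)) V1 mulr1 -(mulrA (V l)).
have AdD l x y : Ad l x + Ad l y = Ad l (x + y) by rewrite /Ad mulrDr mulrDl.
have AdA l x : adj (Ad l x) = Ad l (adj x) by rewrite /Ad !adjM adjK mulrA.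
have Ad1 l : Ad l 1 = 1 by rewrite /Ad mulr1 V2.
have Ad0 l : Ad l 0 = 0 by rewrite /Ad mulr0 mul0r.
pose r' t a b := Ad (state t).1.+1 (r t a b).
(* The intertwiners after the block of t commute with r t, so conjugation by any later V gives the
   same unit. Relations between units of different blocks can thus be checked under one V. *)
have r'E l t a b : (t < off l)%N -> r' t a b = Ad l (r t a b).
  move=> tl; have kl : ((state t).1 < l)%N.
    rewrite ltnNge; apply/negP => /off_le h; have [e _] := stateP t.
    by move: tl; rewrite e; lia.
  have [y [ly _ y2] e] := Vtail _ _ kl.
  rewrite /r' /Ad e adjM -!mulrA (mulrA y) ly; last exact: block_lt.
  by rewrite -(mulrA (r t a b)) (mulrA y (adj y)) y2 mul1r.
(* What remains of the block from level t on: the doublings still to come, then the flip. *)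
pose body t := od r t (len (state t).1 - (state t).2)
  (flip_block r (off (state t).1 + len (state t).1) (u (state t).1.+1)).
have Ub t : local_unitary r t (body t).
  have [e h] := stateP t; apply: (od_local_unitary hr).
  have -> : (t + (len (state t).1 - (state t).2) = off (state t).1 + len (state t).1)%N.
    by rewrite {1}e -addnA subnKC.
  exact: (@flip_block_unitary _ _ _ hr (off (state t).1) (len (state t).1) _ (Uu (state t).1.+1)).
pose v t := Ad (state t).1.+1 (body t).
have v_off k : v (off k) = Ad k (u k).
  have := state_uniq (leq0n (len k)); rewrite addn0 => e.
  have -> : v (off k) = Ad k.+1 (od r (off k) (len k) (flip_block r (off k + len k) (u k.+1))).
    by rewrite /v /body e.
  rewrite [u k](hu k).2 /theta -/(W k) /Ad VS adjM.
  by rewrite !mulrA.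
exists r', v, (fun t => (state t).2 == len (state t).1).
have [rM adj_r sum_r rC] := hr.
split.
  split=> [t a b c d|t a b|t|s t a b c d st].
  - by rewrite /r' AdM rM; case: ifP.
  - by rewrite /r' AdA adj_r.
  - by rewrite /r' AdD sum_r Ad1.
  - pose l := maxn (state s).1.+1 (state t).1.+1.
    have sl : (s < off l)%N by apply: leq_trans (block_lt s) (off_le (leq_maxl _ _)).
    have tl : (t < off l)%N by apply: leq_trans (block_lt t) (off_le (leq_maxr _ _)).
    by rewrite /GRing.comm !(r'E l) // !AdM rC.
split.
- by move=> t; have [_ b1 b2] := Ub t; rewrite /v !AdA !AdM b1 b2 Ad1.
- move=> i t a b it; have [lb _ _] := Ub t.
  rewrite /GRing.comm (r'E (state t).1.+1) ?(ltn_trans it) // /v !AdM lb //.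
- move=> t; have [e h] := stateP t; case: eqP => [ej|nj].
    have st : state t.+1 = ((state t).1.+1, 0%N) by rewrite state_next /next ej eqxx.
    have et : t.+1 = off (state t).1.+1 by rewrite offS -ej -e.
    rewrite et v_off /r' !AdA !AdM AdD /v; congr (Ad _ _).
    by rewrite /body ej subnn /= -ej -e.
  have st : state t.+1 = ((state t).1, (state t).2.+1).
    by rewrite state_next /next; case: eqP nj.
  rewrite /v st /r' AdM AdD /=; congr (Ad _ _); rewrite /body st /=.
  by have -> : (len (state t).1 - (state t).2 = (len (state t).1 - (state t).2.+1).+1)%N by lia.
- move=> t; have [ej|nj] := eqVneq (state t).2 (len (state t).1); last by exists t.
  by exists t.+1; rewrite // state_next /next ej eqxx.
- move=> S hS sS; have [hl S1 SM SA Sc] := hS.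
  have Sr' t a b : S (r' t a b) by apply: sS; left; exists t, a, b.
  have Sv t : S (v t) by apply: sS; right; exists t.
  have SAd k : star_closed [set x | S (Ad k x)].
    split=> /=; rewrite ?Ad1 //.
    - split=> [|c x y Sx Sy]; first by rewrite /= Ad0; case: hl.
      rewrite -[_ (c *: x + y)]/(S (Ad k (c *: x + y))).
      suff -> : Ad k (c *: x + y) = c *: Ad k x + Ad k y by case: hl => _; apply.
      by rewrite -AdD /Ad -scalerAr -scalerAl.
    - by move=> x y Sx Sy; rewrite /= -AdM; apply: SM.
    - by move=> x Sx; rewrite /= -AdA; apply: SA.
    - move=> x /nclosure_seq[f Sf fx]; apply: Sc.
      apply: (ncvg_nclosure (s := fun n => Ad k (f n))); first by exists 0%N => n _; apply: Sf.
      exact/ncvgMr/ncvgMl.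
  (* V_(k+1) is the conjugate of W_k by V_(k+1), times V_k; that conjugate is built from the new
     units and the new unitary at level off (k + 1). *)
  have SV k : S (V k).
    elim: k => [|k ih]; first by rewrite V0.
    have -> : V k.+1 = Ad k.+1 (W k) * V k.
      rewrite /Ad !VS adjM; have [_ _ w2] := UW k.
      by rewrite !mulrA -(mulrA _ (W k) (adj _)) w2 mulr1 -(mulrA _ (adj _) (V k)) V1 mulr1.
    apply: SM => //; apply: (intertwiner_in (SAd k.+1)) => [i c d ic|] /=.
      by rewrite -r'E // offS ltnS.
    by rewrite -v_off.
  apply: hgen => // _ [t [a [b ->]]].
  have -> : r t a b = adj (V (state t).1.+1) * r' t a b * V (state t).1.+1.
    by rewrite /r' /Ad !mulrA V1 mul1r -mulrA V1 mulr1.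
  by apply: (SM) => //; apply: (SM) => //; apply: SA.
Qed.

End Construction.

(** * The CAR algebra: matrix units and trace *)

Section TensorTwo.
Variable R : realType.
Local Notation C := R[i].

Definition ord2 (b : bool) : 'I_2 := if b then ord_max else ord0.
Definition unit2 (a b : bool) : 'M[C]_2 := delta_mx (ord2 a) (ord2 b).

Lemma ord2_eq a b : (ord2 a == ord2 b) = (a == b).
Proof. by case: a b => -[]. Qed.

Lemma unit2_mul a b c d : unit2 a b *m unit2 c d = if b == c then unit2 a d else 0.
Proof.
by rewrite /unit2; have [->|bc] := eqVneq b c; rewrite ?mul_delta_mx // mul_delta_mx_0 // ord2_eq.
Qed.

Lemma unit2_sum : unit2 false false + unit2 true true = 1%:M.
Proof.
apply/matrixP => i j; rewrite !mxE -!val_eqE /=.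
by case: i j => [[|[|i]] ?] [[|[|j]] ?] //=; rewrite ?addr0 ?add0r.
Qed.

(** The size equation is a parameter with a variable right-hand side, so that case analysis on it
    removes the cast. *)
Definition tens2 m n (e : (m * 2)%N = n) (x : 'M[C]_m) (y : 'M[C]_2) : 'M[C]_n :=
  castmx (e, e) (tensmx x y).

Variables (m n : nat) (e : (m * 2)%N = n).
Implicit Types (x : 'M[C]_m) (y : 'M[C]_2).

Lemma tens2M x y x' y' : tens2 e x y *m tens2 e x' y' = tens2 e (x *m x') (y *m y').
Proof. by case: n / e; rewrite /tens2 !castmx_id tensmx_mul. Qed.

Lemma tens2_1 : tens2 e 1%:M 1%:M = 1%:M.
Proof.
case: n / e; rewrite /tens2 castmx_id; apply/matrixP => i j.
case: (mxtens_indexP i) => i0 i1; case: (mxtens_indexP j) => j0 j1.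
rewrite tensmxE !mxE -natrM mulnb; congr (nat_of_bool _)%:R.
by rewrite (can_eq (@mxtens_indexK _ _)).
Qed.

Lemma tens2_linl (a : C) x x' y : tens2 e (a *: x + x') y = a *: tens2 e x y + tens2 e x' y.
Proof.
case: n / e; rewrite /tens2 !castmx_id; apply/matrixP => i j.
by rewrite !mxE mulrDl mulrA.
Qed.

Lemma tens2_linr (a : C) x y y' : tens2 e x (a *: y + y') = a *: tens2 e x y + tens2 e x y'.
Proof.
case: n / e; rewrite /tens2 !castmx_id; apply/matrixP => i j.
by rewrite !mxE mulrDr mulrCA.
Qed.

Lemma tens2_0r x : tens2 e x 0 = 0.
Proof. by case: n / e; rewrite /tens2 castmx_id tensmx0. Qed.

Lemma tens2_ct x y : (map_mx Num.conj (tens2 e x y))^T =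
  tens2 e (map_mx Num.conj x)^T (map_mx Num.conj y)^T.
Proof. by case: n / e; rewrite /tens2 !castmx_id map_mxT trmx_tens. Qed.

Lemma tens2_tr x y : \tr (tens2 e x y) = \tr x * \tr y.
Proof.
case: n / e; rewrite /tens2 castmx_id /mxtrace mulr_sum; apply: eq_bigr => i _.
by rewrite !mxE.
Qed.

Lemma tens2_decompose (z : 'M[C]_n) : exists x : bool -> bool -> 'M[C]_m,
  z = \sum_(ab : bool * bool) tens2 e (x ab.1 ab.2) (unit2 ab.1 ab.2).
Proof.
case: n / e z => z.
exists (fun a b => \matrix_(i, j) z (mxtens_index (i, ord2 a)) (mxtens_index (j, ord2 b))).
apply/matrixP => i j.
case: (mxtens_indexP i) => i0 i1; case: (mxtens_indexP j) => j0 j1.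
rewrite summxE.
have o2 (k : 'I_2) : exists a, k = ord2 a.
  by case: k => -[|[|k]] // ?; [exists false|exists true]; apply: val_inj.
have [a ->] := o2 i1; have [b ->] := o2 j1.
rewrite (bigD1 (a, b)) //= big1 ?addr0 => [|[c d] /= cd].
  by rewrite /tens2 castmx_id tensmxE !mxE !eqxx mulr1.
rewrite /tens2 castmx_id tensmxE !mxE !ord2_eq.
by move: cd; rewrite xpair_eqE (eq_sym c) (eq_sym d) => /negbTE ->; rewrite mulr0.
Qed.

End TensorTwo.

Section TraceExtension.
Variables (R : realType) (A : ucstarAlgType R) (P : set A) (t : A -> R[i]).
Hypotheses (P_dense : forall x, nclosure P x) (P1 : P 1)
  (P_lin : forall (a : R[i]) x y, P x -> P y -> P (a *: x + y))
  (PM : forall x y, P x -> P y -> P (x * y)) (Pa : forall x, P x -> P (adj x)).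
Hypotheses (t_lin : forall (a : R[i]) x y, P x -> P y -> t (a *: x + y) = a * t x + t y)
  (t1 : t 1 = 1) (tC : forall x y, P x -> P y -> t (x * y) = t (y * x))
  (t_pos : forall x, P x -> 0 <= t (adj x * x))
  (t_adj : forall x, P x -> t (adj x) = Num.conj (t x))
  (t_nm : forall x, P x -> cabs (t x) <= nm x).

(* The largest 1-Lipschitz extension of g \o t. *)
Let ext (g : R[i] -> R) (x : A) : R :=
  sup [set r | exists2 y, P y & r = g (t y) - nm (x - y)].

Let lip (g : R[i] -> R) := forall a b, g a - g b <= cabs (a - b).

Let PB x y : P x -> P y -> P (x - y).
Proof. by move=> Px Py; rewrite addrC -scaleN1r; apply: P_lin. Qed.

Let tB x y : P x -> P y -> t (x - y) = t x - t y.
Proof. by move=> Px Py; rewrite addrC -scaleN1r t_lin // mulN1r addrC. Qed.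

Let ext_lip_P g y z : lip g -> P y -> P z -> g (t z) - g (t y) <= nm (z - y).
Proof. by move=> hg Py Pz; rewrite (le_trans (hg _ _)) // -tB // t_nm //; apply: PB. Qed.

Let ext_bound g x y : lip g -> P y -> ubound
  [set r | exists2 z, P z & r = g (t z) - nm (x - z)] (g (t y) + nm (x - y)).
Proof.
move=> hg Py _ [z Pz ->]; have := ext_lip_P hg Py Pz.
by have := nm_tri z x y; rewrite (nmBC z x); lra.
Qed.

Let ext_has_sup g x : lip g -> has_sup [set r | exists2 y, P y & r = g (t y) - nm (x - y)].
Proof.
move=> hg; split; first by exists (g (t 1) - nm (x - 1)); exists 1.
by exists (g (t 1) + nm (x - 1)); apply: ext_bound.
Qed.

Let ext_le g x x' : lip g -> ext g x - ext g x' <= nm (x - x').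
Proof.
move=> hg; rewrite lerBlDr; apply: ge_sup; first by have [] := ext_has_sup x hg.
move=> _ [y Py ->]; have : g (t y) - nm (x' - y) <= ext g x'.
  by apply: (ub_le_sup (ext_has_sup x' hg).2); exists y.
by have := nm_tri x' x y; rewrite (nmBC x' x); lra.
Qed.

Let ext_P g x : lip g -> P x -> ext g x = g (t x).
Proof.
move=> hg Px; apply/eqP; rewrite eq_le; apply/andP; split.
  apply: ge_sup; first by have [] := ext_has_sup x hg.
  by have := @ext_bound g x x hg Px; rewrite subrr nm0 addr0.
by apply: (ub_le_sup (ext_has_sup x hg).2); exists x => //; rewrite subrr nm0 subr0.
Qed.

Let reL : lip (@complex.Re R).
Proof. by move=> a b; have := cabs_ler_Re (a - b); case: a b => [? ?] [? ?]. Qed.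

Let imL : lip (@complex.Im R).
Proof.
move=> a b; have := cabs_ler_Re (- 'i * (a - b)).
rewrite cabsM cabsN (_ : cabs 'i = 1) ?mul1r; last by rewrite /cabs normCi.
by case: a b => [a a'] [b b'] /=; lra.
Qed.

(** Real and imaginary part are extended separately, and the result is 2-Lipschitz. All algebraic
    laws then pass from P to its closure by sequences. *)
Lemma trace_extension : exists2 tau, tracial_state tau & forall x, P x -> tau x = t x.
Proof.
pose tau x : R[i] := Complex (ext (@complex.Re R) x) (ext (@complex.Im R) x).
have tauP x : P x -> tau x = t x.
  by move=> Px; rewrite /tau !ext_P //; case: (t x).
(* Scalars as multiples of 1, so that limits of traces are limits in A. *)
pose T (x : A) : A := tau x *: 1.
have TB (a b : R[i]) : nm (a *: (1 : A) - b *: 1) = cabs (a - b).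
  by rewrite -scalerBl nmZ nm1 mulr1.
have TI (a b : R[i]) : a *: (1 : A) = b *: 1 -> a = b.
  move=> ab; apply/eqP; rewrite -subr_eq0; apply/eqP; apply: cabs_eq0.
  by rewrite -TB ab subrr nm0.
have tau_lip x y : cabs (tau x - tau y) <= 2 * nm (x - y).
  have -> : tau x - tau y = (ext (@complex.Re R) x - ext (@complex.Re R) y)%:C%C
      + 'i * (ext (@complex.Im R) x - ext (@complex.Im R) y)%:C%C.
    by apply/eqP; rewrite eq_complex /=; apply/andP; split; apply/eqP; lra.
  apply: le_trans (cabsD _ _) _; rewrite cabsM !cabsR (_ : cabs 'i = 1) ?mul1r; last first.
    by rewrite /cabs normCi.
  have bd g : lip g -> `|ext g x - ext g y| <= nm (x - y).
    move=> hg; rewrite ler_norml ext_le // andbT lerNl opprB nmBC.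
    exact: ext_le.
  by have := bd _ reL; have := bd _ imL; lra.
have Tc s x : ncvg s x -> ncvg (T \o s) (T x).
  by apply: (@ncvg_lip _ _ s x T 2) => n; rewrite TB.
have sq x : exists2 s : nat -> A, (forall n, P (s n)) & ncvg s x by apply: nclosure_seq.
exists tau => //; split.
- move=> a x y; apply: TI; have [s Ps sx] := sq x; have [s' Ps' sy] := sq y.
  rewrite -[LHS]/(T (a *: x + y)) scalerDl -scalerA -/(T x) -/(T y).
  apply: (ncvg_unique (Tc _ _ (ncvgD (ncvgZ a sx) sy))).
  apply: ncvg_eq (ncvgD (ncvgZ a (Tc _ _ sx)) (Tc _ _ sy)); exists 0%N => n _ /=.
  by rewrite /T !tauP //; [rewrite t_lin // scalerDl scalerA|apply: P_lin].
- by rewrite tauP.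
- move=> x y; apply: TI; have [s Ps sx] := sq x; have [s' Ps' sy] := sq y.
  apply: (ncvg_unique (Tc _ _ (ncvgM sx sy))).
  apply: ncvg_eq (Tc _ _ (ncvgM sy sx)); exists 0%N => n _ /=.
  by rewrite /T !tauP; [rewrite tC|apply: PM|apply: PM].
- move=> x; have [s Ps sx] := sq x.
  have adjT y : tau (adj y) = Num.conj (tau y).
    apply: TI; have [q Pq qy] := sq y.
    have -> : Num.conj (tau y) *: (1 : A) = adj (T y) by rewrite adjZ adj1.
    apply: (ncvg_unique (Tc _ _ (ncvg_adj qy))).
    apply: ncvg_eq (ncvg_adj (Tc _ _ qy)); exists 0%N => n _ /=.
    by rewrite /T !tauP ?t_adj ?adjZ ?adj1 //; apply: Pa.
  split=> //; have : tau (adj x * x) \is Num.real.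
    by apply/CrealP; rewrite -adjT adjM adjK.
  move=> hr; rewrite lecE /=; apply/andP; split.
    by move/CrealP: hr => /(congr1 (@complex.Im R)) /= h; apply/eqP; lra.
  rewrite leNgt; apply/negP => neg.
  have [|N /(_ _ (leqnn N)) hN] := ncvgM (ncvg_adj sx) sx (e := - ext (@complex.Re R) (adj x * x)).
    by rewrite oppr_gt0.
  have := ext_le (adj (s N) * s N) (adj x * x) reL; rewrite ext_P //; last by apply: PM => //;
    apply: Pa.
  have := t_pos (Ps N); rewrite lecE => /andP[_ /=] h1 h2.
  by move: (le_lt_trans h2 hN); rewrite ltrBlDr addNr ltNge h1.
- move=> x; have [s Ps sx] := sq x; rewrite -[leLHS]mulr1 -(nm1 A) -nmZ.
  apply/ler_addgt0Pl => eps eps0; apply: (ncvg_nm_le _ (Tc _ _ sx)).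
  have [N hN] := sx _ eps0; exists N => n /hN h /=.
  rewrite /T tauP // nmZ nm1 mulr1; have := t_nm (Ps n).
  by have := nm_le_dist (s n) x; lra.
Qed.

End TraceExtension.

Section CARUnits.
Variables (R : realType) (A : cstarAlgType R) (mu : forall k, 'M[R[i]]_(2 ^ k) -> A).
Arguments mu : clear implicits.
Hypotheses (mu_lin : forall k, linear (mu k))
  (muM : forall k, {morph (mu k) : x y / x *m y >-> x ** y})
  (muS : forall k x, mu k (map_mx Num.conj x)^T = star (mu k x))
  (mu_inj : forall k, injective (mu k))
  (mu_raise : forall k x, mu k.+1 (castmx (esym (expnSr 2 k), esym (expnSr 2 k))
                (tensmx x (1%:M : 'M[R[i]]_2))) = mu k x)
  (mu_dense : dense (\bigcup_k range (mu k))).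

Local Notation e := (mu 0%N 1%:M).
Local Notation tns k := (tens2 (esym (expnSr 2 k))).

Let mu0 k : mu k 0 = 0.
Proof. by have := @mu_lin k (-1) 0 0; rewrite scaler0 addr0 scaleN1r addNr. Qed.

Let muD k x y : mu k (x + y) = mu k x + mu k y.
Proof. by have := @mu_lin k 1 x y; rewrite !scale1r. Qed.

Let muZ k (c : R[i]) x : mu k (c *: x) = c *: mu k x.
Proof. by have := @mu_lin k c x 0; rewrite mu0 !addr0. Qed.

Let mu_sum k (I : Type) (q : seq I) (P : pred I) (F : I -> 'M[R[i]]_(2 ^ k)) :
  mu k (\sum_(i <- q | P i) F i) = \sum_(i <- q | P i) mu k (F i).
Proof. by elim/big_rec2: _ => [|i y z _ <-]; rewrite ?mu0 ?muD. Qed.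

Lemma car_one k : mu k 1%:M = e.
Proof.
elim: k => // k <-; rewrite -[RHS]mu_raise; congr (mu _ _).
by rewrite -[LHS](tens2_1 R (esym (expnSr 2 k))).
Qed.

Let dns (x : A) (eps : R) : 0 < eps -> exists k y, nrm (x - mu k y) < eps.
Proof. by move=> /((denseP _).1 mu_dense x)[_ [k _ [y _ <-]] h]; exists k, y. Qed.

Lemma car_unit_l : left_id e cmul.
Proof.
move=> x; apply/eqP; rewrite -subr_eq0; apply/eqP; apply: nrm_eq0.
apply/eqP; rewrite eq_le nrm_ge0 andbT; apply/ler_addgt0Pl => eps eps0; rewrite addr0.
have n0 := nrm_ge0 e; have [k [y h]] := dns x (divr_gt0 eps0 (ltr_wpDl n0 ltr01)).
have -> : e ** x - x = e ** (x - mu k y) - (x - mu k y).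
  by rewrite cmulxB -(car_one k) -muM mul1mx opprB addrA subrK.
apply: le_trans (nrmD _ _) _; rewrite nrmN.
have := nrm_cmul e (x - mu k y); rewrite ltr_pdivlMr ?ltr_wpDl // in h.
by have := nrm_ge0 (x - mu k y); nra.
Qed.

Lemma car_unit_r : right_id e cmul.
Proof.
have se : star e = e by rewrite -muS; congr (mu _ _); apply/matrixP => i j;
  rewrite !mxE rmorph_nat eq_sym.
by move=> x; rewrite -[LHS]starK starM se car_unit_l starK.
Qed.

Lemma car_unit_neq0 : e != 0.
Proof.
rewrite -(mu0 0); apply/eqP => /(@mu_inj 0%N)/matrixP/(_ 0 0).
by rewrite !mxE /= => /eqP; rewrite oner_eq0.
Qed.

Local Notation B := (unitalize car_unit_l car_unit_r car_unit_neq0).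

Definition car_units (t : nat) (a b : bool) : B := mu t.+1 (tns t 1%:M (unit2 R a b)).

Lemma car_raise k l x : (k <= l)%N -> exists y, mu l y = mu k x.
Proof.
move=> /subnK <-; elim: (l - k)%N => [|m [y <-]]; first by exists x.
by exists (tns (m + k)%N y 1%:M); apply: (mu_raise y).
Qed.

Lemma car_units_local k (x : 'M[R[i]]_(2 ^ k)) a b : ((mu k x : B) * car_units k a b : B) =
  car_units k a b * (mu k x : B).
Proof.
rewrite -[mu k x]mu_raise -/(tns k x 1%:M).
rewrite -[_ * _ in LHS]/(mu k.+1 _ ** mu k.+1 _) -[_ * _ in RHS]/(mu k.+1 _ ** mu k.+1 _).
by rewrite -!muM !tens2M !mul1mx !mulmx1.
Qed.

Lemma car_matrix_units : matrix_units car_units.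
Proof.
have rC s t a b c d : (s < t)%N -> GRing.comm (car_units s a b) (car_units t c d).
  by move=> /car_raise-/(_ (tns s 1%:M (unit2 R a b)))[y hy]; rewrite {1}/car_units -hy;
    apply: car_units_local.
split=> [t a b c d|t a b|t|s t a b c d].
- rewrite /car_units -[_ * _]/(mu t.+1 _ ** mu t.+1 _) -muM tens2M mul1mx unit2_mul.
  case: eqP => // _; rewrite -[RHS](mu0 t.+1); congr (mu _ _).
  exact: tens2_0r.
- rewrite /car_units -[adj _]/(star _) -muS tens2_ct; congr (mu _ (tens2 _ _ _)).
    by apply/matrixP => i j; rewrite !mxE rmorph_nat eq_sym.
  by apply/matrixP => i j; rewrite !mxE rmorph_nat andbC.
- rewrite /car_units -[_ + _]/((mu t.+1 _ : A) + (mu t.+1 _ : A)) -muD.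
  transitivity (mu t.+1 1%:M); last exact: car_one.
  congr (mu _ _); have := tens2_linr (esym (expnSr 2 t)) 1 1%:M (unit2 R false false) (unit2 R
    true true).
  by rewrite !scale1r unit2_sum tens2_1.
- by rewrite neq_ltn => /orP[/rC//|/rC]; rewrite /GRing.comm => ->.
Qed.

Lemma car_units_generating : generating [set x : B | exists t a b, x = car_units t a b].
Proof.
move=> V [[V0 Vl] V1 VM VA Vc] sV; have Vk k x : V (mu k x).
  elim: k x => [|k ih] x.
    have -> : x = x 0 0 *: 1%:M.
      by apply/matrixP => i j; rewrite !mxE !ord1 mulr1.
    rewrite muZ -[_ *: _]addr0; apply: Vl => //; exact: V1.
  have [y ->] := tens2_decompose (esym (expnSr 2 k)) x.
  rewrite mu_sum; apply: (big_ind (fun z => V z)) => // [u w Vu Vw|[a b] _ /=].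
    by rewrite -[u]scale1r; apply: Vl.
  have -> : mu k.+1 (tns k (y a b) (unit2 R a b)) =
      mu k (y a b) ** mu k.+1 (tns k 1%:M (unit2 R a b)).
    by rewrite -[mu k (y a b)]mu_raise -muM -/(tns k _ _) tens2M mulmx1 mul1mx.
  by apply: VM => //; apply: sV; exists k, a, b.
apply/seteqP; split=> // x _; apply: Vc => eps eps0.
by have [k [y h]] := dns x eps0; exists (mu k y).
Qed.


Let ntr k (x : 'M[R[i]]_(2 ^ k)) : R[i] := \tr x / (2 ^ k)%:R.

Let raise_tr k l x : (k <= l)%N -> exists2 y, mu l y = mu k x & ntr y = ntr x.
Proof.
move=> /subnK <-; elim: (l - k)%N => [|m [y <- <-]]; first by exists x.
exists (tns (m + k)%N y 1%:M); first exact: (mu_raise y).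
rewrite /ntr tens2_tr mxtrace1 addSn expnSr natrM.
by rewrite invfM mulrA mulrAC -[\tr y * _ * _]mulrA mulfV ?mulr1 // pnatr_eq0.
Qed.

Let tr_unique k l x y : mu k x = mu l y -> ntr x = ntr y.
Proof.
move=> xy; have [x' hx <-] := raise_tr x (leq_maxl k l).
have [y' hy <-] := raise_tr y (leq_maxr k l).
by congr (ntr _); apply: (@mu_inj (maxn k l)); rewrite hx hy.
Qed.

Let F k i j : B := mu k (delta_mx i j).
Arguments F : clear implicits.

Let FM k i j i' j' : F k i j * F k i' j' = if j == i' then F k i j' else 0.
Proof.
rewrite -[_ * _]/(mu k _ ** mu k _) -muM; have [->|ji] := eqVneq j i'.
  by rewrite mul_delta_mx.
by rewrite mul_delta_mx_0 // mu0.
Qed.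

Let Fa k i j : adj (F k i j) = F k j i.
Proof.
rewrite -[adj _]/(star _) -muS; congr (mu _ _).
by apply/matrixP => a b; rewrite !mxE rmorph_nat andbC.
Qed.

Let nm_F_le k i j : nm (F k i j) <= 1.
Proof.
have h a : nm (F k a a) <= 1.
  by have := nm_cstar (F k a a); rewrite Fa FM eqxx; have := nm_ge0 (F k a a); nra.
have := nm_cstar (F k i j); rewrite Fa FM eqxx; have := h j.
by have := nm_ge0 (F k i j); nra.
Qed.

Let nm_F_diag k i : nm (F k i i) = 1.
Proof.
have h : nm (F k i i) = nm (F k i i) ^+ 2 by rewrite -nm_cstar Fa FM eqxx.
have : nm (F k i i) != 0.
  apply/eqP => /nm_eq0; rewrite -[0]/(0 : A) -(mu0 k) => /(@mu_inj k)/matrixP/(_ i i).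
  by rewrite !mxE !eqxx /= => /eqP; rewrite oner_eq0.
by move=> n0; apply: (mulfI n0); rewrite mulr1 -expr2.
Qed.

Let F_compress k i j (x : 'M[R[i]]_(2 ^ k)) : F k i i * (mu k x : B) * F k j j = x i j *: F k i j.
Proof.
rewrite -[_ * _ * _]/(mu k _ ** mu k _ ** mu k _) -!muM -[_ *: _]/(_ *: mu k _) -muZ.
congr (mu _ _); apply/matrixP => a b; rewrite !mxE (bigD1 j) //= big1 => [|c cj].
  rewrite addr0 !mxE (bigD1 i) //= big1 => [|c ci]; last first.
    by rewrite !mxE (negbTE ci) andbF mul0r.
  by rewrite addr0 !mxE !eqxx /= andbT; case: (a == i); case: (b == j);
    rewrite ?mulr1 ?mul1r ?mulr0 ?mul0r.
by rewrite !mxE (negbTE cj) mulr0.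
Qed.

Let entry_le k (x : 'M[R[i]]_(2 ^ k)) i : cabs (x i i) <= nm (mu k x : B).
Proof.
have := nmZ (x i i) (F k i i); rewrite nm_F_diag mulr1 -F_compress => <-.
have := nmM (F k i i * (mu k x : B)) (F k i i); have := nmM (F k i i) (mu k x : B).
by rewrite nm_F_diag; lra.
Qed.

Let ntr_le k (x : 'M[R[i]]_(2 ^ k)) : cabs (ntr x) <= nm (mu k x : B).
Proof.
have n0 : 0 < (2 ^ k)%:R :> R by rewrite ltr0n expn_gt0.
have -> : cabs (ntr x) = cabs (\tr x) / (2 ^ k)%:R.
  rewrite /ntr cabsM; congr (_ * _).
  have -> : ((2 ^ k)%:R : R[i])^-1 = ((2 ^ k)%:R^-1 : R)%:C%C by rewrite fmorphV rmorph_nat.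
  by rewrite cabsR ger0_norm // invr_ge0 ltW.
rewrite ler_pdivrMr // (le_trans (cabs_sum _ _ _)) //.
apply: (le_trans (ler_sum _ (fun i _ => entry_le x i))).
by rewrite sumr_const card_ord mulr_natr.
Qed.

Let P : set B := \bigcup_k range (mu k).

Let P2 x y : P x -> P y -> exists k a b, x = mu k a /\ y = mu k b.
Proof.
move=> [k _ [a _ <-]] [l _ [b _ <-]]; exists (maxn k l).
have [a' ha _] := raise_tr a (leq_maxl k l).
by have [b' hb _] := raise_tr b (leq_maxr k l); exists a', b'.
Qed.

Let Pdense x : nclosure P x.
Proof. by move=> eps /(dns x)[k [y h]]; exists (mu k y) => //; exists k. Qed.

Lemma car_trace : exists tau : B -> R[i],
  tracial_state tau /\ forall k x, tau (mu k x) = \tr x / (2 ^ k)%:R.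
Proof.
(* The normalised trace does not depend on the matrix that represents x; off the union of the matrix
   algebras t is 0. *)
have /choice[t ht] : forall x : B, exists c, forall k y, mu k y = x -> c = ntr y.
  move=> x; have [[k _ [y _ <-]]|nP] := pselect (P x).
    by exists (ntr y) => l z /esym; apply: tr_unique.
  by exists 0 => k y xy; case: nP; exists k => //; exists y.
have tE k x : t (mu k x) = ntr x by apply: ht.
have mE k (x y : 'M[R[i]]_(2 ^ k)) : (mu k x : B) * (mu k y : B) = mu k (x *m y) by rewrite muM.
have [||||||||||tau tt tauP] := @trace_extension R B P t Pdense.
- by exists 0%N => //; exists 1%:M.
- move=> a x y Px Py; have [k [b [c [-> ->]]]] := P2 Px Py.
  by exists k => //; exists (a *: b + c); rewrite // mu_lin.
- move=> x y Px Py; have [k [b [c [-> ->]]]] := P2 Px Py.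
  by exists k => //; exists (b *m c); rewrite // muM.
- move=> _ [k _ [b _ <-]]; exists k => //.
  by exists (map_mx Num.conj b)^T; rewrite // muS.
- move=> a x y Px Py; have [k [b [c [-> ->]]]] := P2 Px Py.
  rewrite -[_ + _]/(a *: mu k b + mu k c) -mu_lin !tE /ntr.
  by rewrite linearP /= mulrDl mulrA.
- by rewrite -[1]/(mu 0%N 1%:M : B) tE /ntr mxtrace1 divff.
- move=> x y Px Py; have [k [b [c [-> ->]]]] := P2 Px Py.
  by rewrite !mE !tE /ntr mxtrace_mulC.
- move=> _ [k _ [b _ <-]]; rewrite -[adj _]/(star (mu k b)) -muS mE tE.
  rewrite divr_ge0 ?ler0n //; apply: sumr_ge0 => i _; rewrite mxE.
  by apply: sumr_ge0 => j _; rewrite !mxE mulrC mul_conjC_ge0.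
- move=> _ [k _ [b _ <-]]; rewrite -[adj _]/(star (mu k b)) -muS !tE /ntr.
  rewrite rmorphM fmorphV rmorph_nat mxtrace_tr /mxtrace rmorph_sum.
  by congr (_ * _); apply: eq_bigr => i _; rewrite mxE.
- by move=> _ [k _ [b _ <-]]; rewrite tE; apply: ntr_le.
by exists tau; split=> // k x; rewrite tauP ?tE //; exists k => //; exists x.
Qed.

(** The sum over j of F_ji x F_ij has orthogonal terms, hence norm at most nm x, and its trace is
    2^k tau (F_ii x). *)
Lemma car_trace_entry_le (tau : B -> R[i]) k i (x : B) : tracial_state tau ->
  (2 ^ k)%:R * cabs (tau (F k i i * x)) <= nm x.
Proof.
move=> ht; have [tau_lin _ tauC _ tau_nm] := ht.
pose y j := F k j i * x * F k i j.
have ny : nm (\sum_(j <- enum 'I_(2 ^ k)) y j) <= nm x.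
  apply: nm_orth_sum; rewrite ?enum_uniq ?nm_ge0 //.
    move=> a b _ _ ab; rewrite /y !adjM !Fa; split.
      by rewrite -!mulrA (mulrA (F k _ _) (F k _ _)) FM (negbTE ab) !(mulr0, mul0r).
    by rewrite -!mulrA (mulrA (F k i a)) FM (negbTE ab) !(mulr0, mul0r).
  move=> j _; have := nmM (F k j i * x) (F k i j); have := nmM (F k j i) x.
  have := nm_F_le j i; have := nm_F_le i j; have := nm_ge0 (F k j i * x).
  by have := nm_ge0 (F k i j); have := nm_ge0 (F k j i); have := nm_ge0 x; rewrite /y; nra.
apply: le_trans ny; have := tau_nm (\sum_(j <- enum 'I_(2 ^ k)) y j).
have -> : tau (\sum_(j <- enum 'I_(2 ^ k)) y j) = (2 ^ k)%:R%:C%C * tau (F k i i * x).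
  rewrite (tau_sum ht) (eq_bigr (fun=> tau (F k i i * x))).
    rewrite big_enum /= sumr_const card_ord -[LHS]mulr_natl; congr (_ * _).
    by rewrite rmorph_nat.
  by move=> j _; rewrite /y tauC mulrA FM eqxx.
by rewrite cabsM cabsR normr_nat.
Qed.

Lemma car_trace_faithful (tau : B -> R[i]) : tracial_state tau ->
  (forall k x, tau (mu k x) = \tr x / (2 ^ k)%:R) ->
  forall x : B, tau (adj x * x) = 0 -> x = 0.
Proof.
move=> ht tauE x x0; have [tau_lin _ tauC tau_pos _] := ht.
have hT : star_closed [set: B] by [].
set a := adj x * x; have sa : adj a = a by rewrite /a adjM adjK.
have az z : tau (z * a) = 0.
  rewrite tauC /a -mulrA.
  have [||//] := @pf_null R B setT tau hT _ _ (x * z) x I I x0.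
    by move=> c y y' _ _; apply: tau_lin.
  by move=> y _; have [] := tau_pos y.
apply: adjxx_eq0; apply: nm_small => eps eps0.
have [k [y near]] := dns (a : A) (ltac:(lra) : 0 < eps / 2).
have {}near : nm (a - (mu k y : B)) < eps / 2 by [].
(* The Hermitian part of y is no further from a, which is self-adjoint. *)
pose h := 2^-1 *: (y + (map_mx Num.conj y)^T).
have hh : map_mx Num.conj h^T = h.
  apply/matrixP => i j; rewrite !mxE rmorphM rmorphD /= conjCK fmorphV rmorph_nat.
  by rewrite [X in _ * X]addrC.
have nh : nm (a - (mu k h : B)) <= eps / 2.
  have -> : a - (mu k h : B) = 2^-1 *: ((a - (mu k y : B)) + adj (a - (mu k y : B))).
    rewrite adjB sa -[adj (mu k y : B)]/(star (mu k y)) -muS addrACA -opprD scalerBr.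
    congr (_ - _); first by rewrite scalerDr -scalerDl -[2^-1]mul1r -splitr scale1r.
    by rewrite /h muZ muD.
  have c2 : cabs (2^-1 : R[i]) = 2^-1.
    have -> : (2^-1 : R[i]) = (2^-1 : R)%:C%C by rewrite fmorphV rmorph_nat.
    by rewrite cabsR ger0_norm // invr_ge0.
  rewrite nmZ c2; have := nmD (a - (mu k y : B)) (adj (a - (mu k y : B))).
  by rewrite nm_adj; lra.
pose U := spectralmx h; pose d := spectral_diag h.
have hE := hermitian_spectral hh; rewrite -/U -/d in hE.
have UU : U *m map_mx Num.conj U^T = 1%:M by apply/unitarymxP/spectral_unitarymx.
have UU' : map_mx Num.conj U^T *m U = 1%:M by apply: mulmx1C.
pose w : B := mu k U; pose w' : B := mu k (map_mx Num.conj U^T).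
have ww : w * w' = 1 by rewrite -[_ * _]/(mu k _ ** mu k _) -muM UU; apply: car_one.
have ww' : w' * w = 1 by rewrite -[_ * _]/(mu k _ ** mu k _) -muM UU'; apply: car_one.
have w'E : w' = adj w by rewrite -[adj w]/(star (mu k U)) -muS map_trmx.
pose D : B := mu k (diag_mx d).
have mhE : (mu k h : B) = w' * D * w by rewrite hE !muM.
have nw : nm w = 1 by apply: nm_unitary; rewrite -w'E.
have nw' : nm w' = 1 by rewrite w'E nm_adj.
have DE : D = \sum_(i <- enum 'I_(2 ^ k)) d 0 i *: F k i i.
  rewrite big_enum /= -[LHS]/(mu k (diag_mx d)) diag_mx_sum_delta mu_sum.
  by apply: eq_bigr => i _; rewrite muZ.
have nd i : cabs (d 0 i) <= eps / 2.
  have FD : F k i i * D = d 0 i *: F k i i.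
    rewrite DE mulr_sumr (bigD1_seq i) ?mem_enum ?enum_uniq //= big1 => [|j ji].
      by rewrite addr0 -scalerAr FM eqxx.
    by rewrite -scalerAr FM eq_sym (negbTE ji) scaler0.
  have tF : tau (F k i i) = (2 ^ k)%:R^-1.
    rewrite tauE /mxtrace (bigD1 i) //= big1 => [|j ji].
      by rewrite mxE !eqxx addr0 mul1r.
    by rewrite mxE (negbTE ji).
  have := car_trace_entry_le i (D - w * a * w') ht.
  have -> : tau (F k i i * (D - w * a * w')) = d 0 i / (2 ^ k)%:R.
    rewrite mulrBr FD addrC -scaleN1r tau_lin (tauZ ht) tF.
    have -> : tau (F k i i * (w * a * w')) = 0.
      transitivity (tau (w' * (F k i i * (w * a)))); first by rewrite [RHS]tauC !mulrA.
      by rewrite -(az (w' * F k i i * w)) !mulrA.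
    by rewrite mulr0 add0r.
  have -> : (2 ^ k)%:R * cabs (d 0 i / (2 ^ k)%:R) = cabs (d 0 i).
    have c2 : cabs ((2 ^ k)%:R : R[i]) = (2 ^ k)%:R.
      by rewrite -(rmorph_nat (real_complex R)) cabsR normr_nat.
    by rewrite -{1}c2 -cabsM mulrC divfK.
  have -> : D - w * a * w' = w * ((mu k h : B) - a) * w'.
    by rewrite mulrBr mulrBl mhE !mulrA ww mul1r -(mulrA D) ww mulr1.
  have := nmM (w * ((mu k h : B) - a)) w'; have := nmM w ((mu k h : B) - a).
  by rewrite nw nw' mul1r mulr1 (nmBC (mu k h : B)); lra.
have nD : nm D <= eps / 2.
  rewrite DE; apply: nm_orth_sum; rewrite ?enum_uniq //; first lra.
    move=> i j _ _ ij; rewrite !adjZ !Fa -!scalerAl -!scalerAr !FM (negbTE ij).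
    by rewrite !scaler0.
  move=> i _; rewrite nmZ; have := nd i; have := nm_F_le i i; have := nm_ge0 (F k i i).
  by have := cabs_ge0 (d 0 i); nra.
have := nm_le_dist a (mu k h : B); rewrite mhE in nh *.
have := nmM (w' * D) w; have := nmM w' D; rewrite nw nw' !mulr1 !mul1r.
by have := nm_ge0 D; lra.
Qed.

End CARUnits.

(** * Existence of the CAR algebra *)

Definition adjmx (R : realType) n (x : 'M[R[i]]_n) : 'M[R[i]]_n := (map_mx Num.conj x)^T.

Section OperatorNorm.
Variable R : realType.
Local Notation C := R[i].
Local Notation ct := adjmx.
Local Notation "''[' u , v ]" := (dotmx u v).

Definition row_norm n (u : 'rV[C]_n) : R := complex.Re (sqrtC (dotmx u u)).

Lemma row_normE n (u : 'rV[C]_n) : (row_norm u)%:C%C = sqrtC '[u, u].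
Proof. by rewrite ReK // sqrtC_ge0 dnorm_ge0. Qed.

Opaque row_norm.

Lemma row_norm_sqr n (u : 'rV[C]_n) : ((row_norm u) ^+ 2)%:C%C = '[u, u].
Proof. by rewrite rmorphXn /= row_normE sqrtCK. Qed.

Lemma row_norm_sum n (u : 'rV[C]_n) : row_norm u ^+ 2 = \sum_i cabs (u 0 i) ^+ 2.
Proof.
apply: complexI; rewrite row_norm_sqr dotmxE mxE rmorph_sum.
by apply: eq_bigr => i _; rewrite !mxE /= -cabs_sqr.
Qed.

Lemma row_norm_ge0 n (u : 'rV[C]_n) : 0 <= row_norm u.
Proof. by rewrite -lecR row_normE sqrtC_ge0 dnorm_ge0. Qed.

Lemma row_normD n (u v : 'rV[C]_n) : row_norm (u + v) <= row_norm u + row_norm v.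
Proof.
rewrite -lecR rmorphD /= (row_normE (u + v)) (row_normE u) (row_normE v).
by have [h _] := triangle_lerif (@dotmx _ n) u v; exact: h.
Qed.

Lemma row_normZ n (a : C) (u : 'rV[C]_n) : row_norm (a *: u) = cabs a * row_norm u.
Proof.
apply/eqP; rewrite -(@eqrXn2 _ 2) ?mulr_ge0 ?row_norm_ge0 ?cabs_ge0 //; apply/eqP.
rewrite exprMn !row_norm_sum mulr_sumr; apply: eq_bigr => i _.
by rewrite mxE cabsM exprMn.
Qed.

Lemma row_norm_eq0 n (u : 'rV[C]_n) : row_norm u = 0 -> u = 0.
Proof.
move=> u0; have /esym/eqP := row_norm_sum u; rewrite u0 expr0n psumr_eq0 => [|i _]; last first.
  exact: sqr_ge0.
move=> /allP h; apply/rowP => i; rewrite mxE; apply: cabs_eq0; apply/eqP.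
by rewrite -sqrf_eq0; apply: h; rewrite mem_index_enum.
Qed.

Lemma row_norm0 n : row_norm (0 : 'rV[C]_n) = 0.
Proof. by have := row_normZ 0 (0 : 'rV[C]_n); rewrite scaler0 cabs0 mul0r. Qed.

Lemma row_cauchy_schwarz n (u v : 'rV[C]_n) : cabs '[u, v] <= row_norm u * row_norm v.
Proof.
rewrite -lecR rmorphM /= (row_normE u) (row_normE v) -cabsE.
by have [h _] := CauchySchwarz_sqrt (@dotmx _ n) u v; exact: h.
Qed.

Definition op_norm n (x : 'M[C]_n) : R :=
  inf [set c | 0 <= c /\ forall u, row_norm (u *m x) <= c * row_norm u].

Lemma op_norm_has_inf n (x : 'M[C]_n) :
  has_inf [set c | 0 <= c /\ forall u, row_norm (u *m x) <= c * row_norm u].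
Proof.
split; last by exists 0 => c [].
exists (\sum_i row_norm (row i x)); split; first by apply: sumr_ge0 => i _; apply: row_norm_ge0.
move=> u; have -> : u *m x = \sum_i u 0 i *: row i x by exact: mulmx_sum_row.
rewrite mulr_suml.
apply: (@le_trans _ _ (\sum_i cabs (u 0 i) * row_norm (row i x))).
  apply: (big_ind2 (fun a b => row_norm a <= b)) => [|a b a' b' h h'|i _].
  - by rewrite row_norm0.
  - by apply: le_trans (row_normD _ _) _; rewrite lerD.
  - by rewrite row_normZ.
apply: ler_sum => i _; rewrite mulrC ler_wpM2l ?row_norm_ge0 //.
rewrite -(@ler_pXn2r _ 2) ?nnegrE ?row_norm_ge0 ?cabs_ge0 // row_norm_sum (bigD1 i) //= lerDl.
by apply: sumr_ge0 => j _; apply: exprn_ge0; apply: cabs_ge0.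
Qed.

Lemma op_norm_ge0 n (x : 'M[C]_n) : 0 <= op_norm x.
Proof. by apply: lb_le_inf; [case: (op_norm_has_inf x)|move=> c []]. Qed.

Lemma op_normP n (x : 'M[C]_n) u : row_norm (u *m x) <= op_norm x * row_norm u.
Proof.
have [->|u0] := eqVneq u 0; first by rewrite mul0mx row_norm0 mulr0.
have pu : 0 < row_norm u.
  by rewrite lt_neqAle row_norm_ge0 andbT eq_sym; apply: contra_neq u0 => /row_norm_eq0.
rewrite -ler_pdivrMr //; apply: lb_le_inf; first by case: (op_norm_has_inf x).
by move=> c [_ h]; rewrite ler_pdivrMr.
Qed.

Lemma op_norm_le n (x : 'M[C]_n) c : 0 <= c ->
  (forall u, row_norm (u *m x) <= c * row_norm u) -> op_norm x <= c.
Proof. by move=> c0 h; apply: ge_inf; [exists 0 => d []|]. Qed.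

Opaque op_norm.

Lemma op_normD n (x y : 'M[C]_n) : op_norm (x + y) <= op_norm x + op_norm y.
Proof.
apply: op_norm_le => [|u]; first by rewrite addr_ge0 ?op_norm_ge0.
rewrite mulmxDr mulrDl; apply: le_trans (row_normD _ _) _.
by apply: lerD; apply: op_normP.
Qed.

Lemma op_normZ n (a : C) (x : 'M[C]_n) : op_norm (a *: x) = cabs a * op_norm x.
Proof.
have le b (y : 'M[C]_n) : op_norm (b *: y) <= cabs b * op_norm y.
  apply: op_norm_le => [|u]; first by rewrite mulr_ge0 ?op_norm_ge0 ?cabs_ge0.
  by rewrite -scalemxAr row_normZ -mulrA ler_wpM2l ?cabs_ge0 // op_normP.
apply/eqP; rewrite eq_le le /=; have [->|a0] := eqVneq a 0.
  by rewrite cabs0 mul0r op_norm_ge0.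
have := le a^-1 (a *: x); rewrite scalerA mulVf // scale1r => h.
have := ler_wpM2l (cabs_ge0 a) h; rewrite mulrA -cabsM divff // cabs1 mul1r.
by [].
Qed.

Lemma op_norm_eq0 n (x : 'M[C]_n) : op_norm x = 0 -> x = 0.
Proof.
move=> x0; apply/row_matrixP => i; rewrite row0 rowE; apply: row_norm_eq0.
apply/eqP; rewrite eq_le row_norm_ge0 andbT; have := op_normP x (delta_mx 0 i).
by rewrite x0 mul0r.
Qed.

Lemma op_normM n (x y : 'M[C]_n) : op_norm (x *m y) <= op_norm x * op_norm y.
Proof.
apply: op_norm_le => [|u]; first by rewrite mulr_ge0 ?op_norm_ge0.
have h1 := op_normP y (u *m x); have h2 := op_normP x u; rewrite -mulmxA in h1.
have y0 := op_norm_ge0 y; move: h1 h2 y0.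
generalize (op_norm x) (op_norm y) (row_norm u) (row_norm (u *m x)).
generalize (row_norm (u *m (x *m y))); move=> f a b c d h1 h2 b0; nra.
Qed.

Lemma adjmxK n (x : 'M[C]_n) : ct (ct x) = x.
Proof. by apply/matrixP => i j; rewrite !mxE conjCK. Qed.

Lemma adjmx1 n : ct (1%:M : 'M[C]_n) = 1%:M.
Proof. by apply/matrixP => i j; rewrite !mxE rmorph_nat eq_sym. Qed.

Let dotmx_adj n (y : 'M[C]_n) u : '[u *m (y *m ct y), u] = '[u *m y, u *m y].
Proof. by rewrite !dotmxE; congr (_ 0 0); rewrite trmx_mul map_mxM !mulmxA /adjmx map_trmx. Qed.

Opaque adjmx.

(** From |u y|^2 = <u y y^*, u> follows |y|^2 <= |y y^*| <= |y| |y^*|. Hence |y| <= |y^*|, equality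
    by symmetry, and the identity for y = x^*. *)
Lemma op_norm_cstar n (x : 'M[C]_n) : op_norm (ct x *m x) = op_norm x ^+ 2.
Proof.
have sq (y : 'M[C]_n) : op_norm y ^+ 2 <= op_norm (y *m ct y).
  rewrite -[leRHS]sqr_sqrtr ?op_norm_ge0 // ler_pXn2r ?nnegrE ?op_norm_ge0 ?sqrtr_ge0 //.
  apply: op_norm_le => [|u]; first exact: sqrtr_ge0.
  rewrite -(@ler_pXn2r _ 2) ?nnegrE ?mulr_ge0 ?row_norm_ge0 ?sqrtr_ge0 //.
  rewrite exprMn sqr_sqrtr ?op_norm_ge0 //.
  have -> : row_norm (u *m y) ^+ 2 = cabs '[u *m (y *m ct y), u].
    rewrite dotmx_adj.
    by rewrite -row_norm_sqr cabsR ger0_norm // sqr_ge0.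
  apply: le_trans (row_cauchy_schwarz _ _) _; rewrite expr2 mulrA.
  by rewrite ler_wpM2r ?row_norm_ge0 // op_normP.
have le (y : 'M[C]_n) : op_norm y <= op_norm (ct y).
  have := le_trans (sq y) (op_normM _ _); have := op_norm_ge0 y.
  have := op_norm_ge0 (ct y); generalize (op_norm (ct y)) (op_norm y) => a b.
  by move=> a0 b0 h; nra.
have le' (y z : 'M[C]_n) : z = ct y -> op_norm y <= op_norm z by move=> ->; exact: le.
have sq' (y z : 'M[C]_n) : z = ct y -> op_norm y ^+ 2 <= op_norm (y *m z) by move=> ->; exact: sq.
have := op_normM (ct x) x; have := le' _ _ (erefl (ct x)).
have := le' _ _ (esym (adjmxK x)); have := sq' _ _ (esym (adjmxK x)); have := op_norm_ge0 x.
generalize (op_norm (ct x *m x)) (op_norm (ct x)) (op_norm x) => a b c c0 h1 h2 h3 h4.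
have {h2 h3} bc : b = c by apply/eqP; rewrite eq_le h2.
by subst b; apply/eqP; rewrite eq_le h1 andbT expr2.
Qed.

Let sum_mxtens (V : nmodType) m n (F : 'I_(m * n) -> V) :
  \sum_k F k = \sum_i \sum_j F (mxtens_index (i, j)).
Proof.
rewrite pair_bigA /= (reindex (@mxtens_index m n)); first by apply: eq_bigr => -[].
by exists (@mxtens_unindex m n) => i _; rewrite ?mxtens_indexK ?mxtens_unindexK.
Qed.

(** A row vector splits into two halves whose squared norms add up, and the tensor product acts by x
    on each half. *)
Lemma op_norm_tens m n (e : (m * 2)%N = n) (x : 'M[C]_m) : op_norm (tens2 e x 1%:M) = op_norm x.
Proof.
case: n / e; rewrite /tens2 castmx_id.
pose part (u : 'rV[C]_(m * 2)) (b : 'I_2) : 'rV[C]_m := \row_j u 0 (mxtens_index (j, b)).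
have rn u : row_norm u ^+ 2 = \sum_b row_norm (part u b) ^+ 2.
  rewrite row_norm_sum sum_mxtens exchange_big.
  apply: eq_bigr => b _; rewrite row_norm_sum; apply: eq_bigr => j _.
  by rewrite mxE.
have part_mul u b : part (u *m tensmx x 1%:M) b = part u b *m x.
  apply/rowP => j; rewrite !mxE sum_mxtens.
  apply: eq_bigr => i _; rewrite (bigD1 b) //= big1 ?addr0 => [|c cb].
    by rewrite tensmxE !mxE eqxx mulr1.
  by rewrite tensmxE !mxE (negbTE cb) !mulr0.
apply/eqP; rewrite eq_le; apply/andP; split; apply: op_norm_le; rewrite ?op_norm_ge0 // => u.
  rewrite -(@ler_pXn2r _ 2) ?nnegrE ?mulr_ge0 ?row_norm_ge0 ?op_norm_ge0 //.
  rewrite exprMn !rn mulr_sumr; apply: ler_sum => b _; rewrite part_mul -exprMn.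
  by rewrite ler_pXn2r ?nnegrE ?mulr_ge0 ?row_norm_ge0 ?op_norm_ge0 // op_normP.
(* For the converse bound, u is placed in the first half and 0 in the second. *)
pose w : 'rV[C]_(m * 2) :=
  \row_k if (mxtens_unindex k).2 == ord0 then u 0 (mxtens_unindex k).1 else 0.
have part0 : part w ord0 = u by apply/rowP => j; rewrite !mxE mxtens_indexK.
have rw : row_norm w = row_norm u.
  apply/eqP; rewrite -(@eqrXn2 _ 2) ?row_norm_ge0 // rn (bigD1 ord0) //= big1 ?addr0 ?part0 // =>
    b b0.
  suff -> : part w b = 0 by rewrite row_norm0 expr0n.
  by apply/rowP => j; rewrite !mxE mxtens_indexK /= (negbTE b0).
rewrite -rw; apply: le_trans (op_normP _ _).
rewrite -(@ler_pXn2r _ 2) ?nnegrE ?row_norm_ge0 // rn (bigD1 ord0) //= part_mul part0 lerDl.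
by apply: sumr_ge0 => b _; apply: sqr_ge0.
Qed.

Transparent adjmx.

End OperatorNorm.

(** * The completed limit of an isometric system *)

(** The levels carry neither a unit nor completeness: the C*-laws and isometric connecting maps are
    all that the completed limit uses. *)
Record tower (R : realType) := Tower {
  level :> nat -> lmodType R[i];
  tmul : forall k, level k -> level k -> level k;
  tadj : forall k, level k -> level k;
  tnm : forall k, level k -> R;
  tup : forall k, level k -> level k.+1;
  tmulA : forall k, associative (@tmul k);
  tmulDl : forall k, left_distributive (@tmul k) +%R;
  tmulDr : forall k, right_distributive (@tmul k) +%R;
  tmulZl : forall k (a : R[i]) x y, @tmul k (a *: x) y = a *: tmul x y;
  tmulZr : forall k (a : R[i]) x y, @tmul k x (a *: y) = a *: tmul x y;
  tadjD : forall k, {morph (@tadj k) : x y / x + y};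
  tadjZ : forall k (a : R[i]) x, @tadj k (a *: x) = Num.conj a *: tadj x;
  tadjM : forall k x y, @tadj k (tmul x y) = tmul (tadj y) (tadj x);
  tadjK : forall k, involutive (@tadj k);
  tnmD : forall k x y, @tnm k (x + y) <= tnm x + tnm y;
  tnmZ : forall k (a : R[i]) x, @tnm k (a *: x) = cabs a * tnm x;
  tnm_eq0 : forall k x, @tnm k x = 0 -> x = 0;
  tnmM : forall k x y, @tnm k (tmul x y) <= tnm x * tnm y;
  tnm_cstar : forall k x, @tnm k (tmul (tadj x) x) = tnm x ^+ 2;
  tup_lin : forall k, linear (@tup k);
  tupM : forall k, {morph (@tup k) : x y / tmul x y};
  tupS : forall k, {morph (@tup k) : x / tadj x};
  tup_nm : forall k x, tnm (@tup k x) = tnm x }.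

Section TowerTheory.
Variables (R : realType) (t : tower R).
Local Notation X := (forall k, t k).
Implicit Types (x y z : X) (e : R).

Let N0 k : tnm (0 : t k) = 0.
Proof. by have := tnmZ 0 (0 : t k); rewrite scaler0 cabs0 mul0r. Qed.

Let NN k (u : t k) : tnm (- u) = tnm u.
Proof. by rewrite -scaleN1r tnmZ cabsN cabs1 mul1r. Qed.

Let Nge0 k (u : t k) : 0 <= tnm u.
Proof. by have := tnmD u (- u); rewrite subrr NN N0; lra. Qed.

Let NBC k (u w : t k) : tnm (u - w) = tnm (w - u).
Proof. by rewrite -NN opprB. Qed.

Let Ntri k (u w s : t k) : tnm (u - s) <= tnm (u - w) + tnm (w - s).
Proof. by apply: le_trans (tnmD _ _); rewrite addrA subrK. Qed.

Let Nle k (u w : t k) : tnm u <= tnm w + tnm (u - w).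
Proof. by apply: le_trans (tnmD _ _); rewrite addrC subrK. Qed.

Lemma tadj_nm k (u : t k) : tnm (tadj u) = tnm u.
Proof.
have le (w : t k) : tnm w <= tnm (tadj w).
  have := tnm_cstar w; have := tnmM (tadj w) w; have := Nge0 w; have := Nge0 (tadj w).
  by move=> h1 h2 h3 h4; rewrite h4 in h3; nra.
by apply/eqP; rewrite eq_le le andbT -{2}[u]tadjK le.
Qed.

Lemma tmulBl k (u w s : t k) : tmul (u - w) s = tmul u s - tmul w s.
Proof. by rewrite tmulDl -scaleN1r tmulZl scaleN1r. Qed.

Lemma tmulBr k (u w s : t k) : tmul s (u - w) = tmul s u - tmul s w.
Proof. by rewrite tmulDr -scaleN1r tmulZr scaleN1r. Qed.

Lemma tadjB k (u w : t k) : tadj (u - w) = tadj u - tadj w.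
Proof. by rewrite tadjD -scaleN1r tadjZ rmorphN rmorph1 scaleN1r. Qed.

(** Transport along k = m, with default 0 when the levels differ. *)
Let recast k m (u : t k) : t m := if @eqP _ k m is ReflectT e then ecast i (t i) e u else 0.

(* The image of u : t k at level m; it is 0 when m < k. *)
Fixpoint lift_to k (u : t k) m : t m :=
  if m is m'.+1 then if (k <= m')%N then tup (lift_to u m') else recast m'.+1 u
  else recast 0 u.

Lemma lift_id k (u : t k) : lift_to u k = u.
Proof.
have h : recast k u = u by rewrite /recast; case: eqP => // e; rewrite eq_axiomK.
by case: k u h => [|k] u h //=; rewrite ltnn.
Qed.

Lemma liftS k (u : t k) m : (k <= m)%N -> lift_to u m.+1 = tup (lift_to u m).
Proof. by move=> /= ->. Qed.

Lemma lift_lin k m (a : R[i]) (u w : t k) : (k <= m)%N ->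
  lift_to (a *: u + w) m = a *: lift_to u m + lift_to w m.
Proof.
elim: m => [|m ih]; rewrite leq_eqVlt => /predU1P[e|//]; try by subst k; rewrite !lift_id.
by rewrite ltnS => km; rewrite !liftS // ih // tup_lin.
Qed.

Lemma liftB k m (u w : t k) : (k <= m)%N -> lift_to (u - w) m = lift_to u m - lift_to w m.
Proof. by move=> km; rewrite addrC -scaleN1r lift_lin // scaleN1r addrC. Qed.

Lemma liftM k m (u w : t k) : (k <= m)%N ->
  lift_to (tmul u w) m = tmul (lift_to u m) (lift_to w m).
Proof.
elim: m => [|m ih]; rewrite leq_eqVlt => /predU1P[e|//]; try by subst k; rewrite !lift_id.
by rewrite ltnS => km; rewrite !liftS // ih // tupM.
Qed.

Lemma lift_adj k m (u : t k) : (k <= m)%N -> lift_to (tadj u) m = tadj (lift_to u m).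
Proof.
elim: m => [|m ih]; rewrite leq_eqVlt => /predU1P[e|//]; try by subst k; rewrite !lift_id.
by rewrite ltnS => km; rewrite !liftS // ih // tupS.
Qed.

Lemma lift_nm k m (u : t k) : (k <= m)%N -> tnm (lift_to u m) = tnm u.
Proof.
elim: m => [|m ih]; rewrite leq_eqVlt => /predU1P[e|//]; try by subst k; rewrite !lift_id.
by rewrite ltnS => km; rewrite !liftS // tup_nm ih.
Qed.

Lemma lift_lift k l m (u : t k) : (k <= l)%N -> (l <= m)%N ->
  lift_to (lift_to u l) m = lift_to u m.
Proof.
move=> kl; elim: m => [|m ih]; rewrite leq_eqVlt => /predU1P[e|//]; try by subst l; rewrite lift_id.
by rewrite ltnS => lm; rewrite !liftS // ?ih // (leq_trans kl).
Qed.

(** A point of the completion is coded by one element per level; being Cauchy means that the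
    sequence eventually follows the connecting maps up to e. Union and completion are thus taken in
    one step. *)
Definition tcauchy x := forall e, 0 < e ->
  exists K, forall m, (K <= m)%N -> tnm (x m - lift_to (x K) m) < e.

Definition tnull x := forall e, 0 < e -> exists K, forall m, (K <= m)%N -> tnm (x m) < e.

Definition tbounded x c := exists K, forall m, (K <= m)%N -> tnm (x m) <= c.

(* The limit superior of the norms. *)
Definition tlim x : R := inf [set c | tbounded x c].

Lemma tcauchy_base x e : tcauchy x -> 0 < e -> exists K0, forall K m,
  (K0 <= K)%N -> (K <= m)%N -> tnm (x m - lift_to (x K) m) < e.
Proof.
move=> cx e0; have [K0 h] := cx (e / 2) ltac:(lra); exists K0 => K m K0K Km.
have := Ntri (x m) (lift_to (x K0) m) (lift_to (x K) m).
rewrite -(lift_lift _ K0K Km) -liftB // lift_nm // lift_lift // (NBC (lift_to (x K0) K)).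
by have := h m (leq_trans K0K Km); have := h K K0K; lra.
Qed.

Lemma tcauchy_bounded x : tcauchy x -> exists c, tbounded x c.
Proof.
move=> /(_ 1 ltr01)[K h]; exists (tnm (x K) + 1), K => m Km.
by have := Nle (x m) (lift_to (x K) m); rewrite lift_nm //; have := h m Km; lra.
Qed.

Let maxK (P Q : nat -> Prop) : (exists K, forall m, (K <= m)%N -> P m) ->
  (exists K, forall m, (K <= m)%N -> Q m) -> exists K, forall m, (K <= m)%N -> P m /\ Q m.
Proof.
move=> [K h] [L h']; exists (maxn K L) => m; rewrite geq_max => /andP[Km Lm].
by split; [apply: h|apply: h'].
Qed.

Lemma tcauchy_lin (a : R[i]) x y : tcauchy x -> tcauchy y ->
  tcauchy (fun k => a *: x k + y k).
Proof.
move=> cx cy e e0; have a0 := cabs_ge0 a; have a1 : 0 < cabs a + 1 by lra.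
have d0 : 0 < e / (cabs a + 1) / 2 by rewrite divr_gt0 // divr_gt0.
have [K h] := tcauchy_base cx d0; have [L h'] := tcauchy_base cy d0; exists (maxn K L) => m Km.
rewrite lift_lin // opprD addrACA -scalerBr; apply: le_lt_trans (tnmD _ _) _.
have hx := h _ _ (leq_maxl K L) Km; have hy := h' _ _ (leq_maxr K L) Km.
rewrite tnmZ; apply: lt_le_trans (ler_ltD (ler_wpM2l a0 (ltW hx)) hy) _.
set d := e / _ / 2 in d0 *.
have -> : e = d * (cabs a + 1) * 2 by rewrite /d; field; rewrite lt0r_neq0.
by nra.
Qed.

Lemma tcauchyM x y : tcauchy x -> tcauchy y -> tcauchy (fun k => tmul (x k) (y k)).
Proof.
move=> cx cy e e0; have [b [K1 bx]] := tcauchy_bounded cx; have [c [K2 cb]] := tcauchy_bounded cy.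
have b0 : 0 <= b by apply: le_trans (bx _ (leqnn _)).
have c0 : 0 <= c by apply: le_trans (cb _ (leqnn _)).
have bc : 0 < b + c + 1 by lra.
have d0 : 0 < e / (b + c + 1) by rewrite divr_gt0.
have [K h] := tcauchy_base cx d0; have [L h'] := tcauchy_base cy d0.
pose M := maxn (maxn K1 K2) (maxn K L); exists M => m Mm.
have [K1M K2M KM LM] : [/\ (K1 <= M)%N, (K2 <= M)%N, (K <= M)%N & (L <= M)%N].
  by split; rewrite /M !leq_max leqnn ?orbT.
rewrite liftM //; have -> : tmul (x m) (y m) - tmul (lift_to (x M) m) (lift_to (y M) m) =
    tmul (x m - lift_to (x M) m) (y m) + tmul (lift_to (x M) m) (y m - lift_to (y M) m).
  by rewrite tmulBl tmulBr addrA subrK.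
apply: le_lt_trans (tnmD _ _) _.
have hx := h _ _ KM Mm; have hy := h' _ _ LM Mm.
have hb := bx _ K1M; have hc := cb _ (leq_trans K2M Mm).
apply: le_lt_trans (lerD (tnmM _ _) (tnmM _ _)) _; rewrite lift_nm //.
set d := e / _ in d0 hx hy.
apply: (@le_lt_trans _ _ (d * c + b * d)).
  by apply: lerD; apply: ler_pM; rewrite ?Nge0 // ltW.
have -> : e = d * (b + c + 1) by rewrite /d divfK // lt0r_neq0.
by nra.
Qed.

Lemma tcauchy_adj x : tcauchy x -> tcauchy (fun k => tadj (x k)).
Proof.
move=> cx e /cx[K h]; exists K => m Km.
by rewrite lift_adj // -tadjB tadj_nm h.
Qed.

Lemma tcauchy_lift k (u : t k) : tcauchy (lift_to u).
Proof.
by move=> e e0; exists k => m km; rewrite lift_id subrr N0.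
Qed.

Lemma tcauchy0 : tcauchy (fun k => 0).
Proof.
move=> e e0; exists 0%N => m _.
by rewrite sub0r NN lift_nm // N0.
Qed.

Lemma tlim_le x c : tbounded x c -> tlim x <= c.
Proof.
move=> h; apply: ge_inf => //; exists 0 => d [K hK].
exact: le_trans (hK _ (leqnn _)).
Qed.

Lemma tlim_bounded x c : tcauchy x -> tlim x < c -> tbounded x c.
Proof.
move=> /tcauchy_bounded ne lc; have [|d [K hd] dc] := @inf_lt _ _ c _ lc.
  exact: ne.
by exists K => m /hd h; lra.
Qed.

Lemma tlim_ge0 x : tcauchy x -> 0 <= tlim x.
Proof.
move=> /tcauchy_bounded ne; apply: lb_le_inf => // c [K hK].
exact: le_trans (hK _ (leqnn _)).
Qed.

Lemma tlim_lift k (u : t k) : tlim (lift_to u) = tnm u.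
Proof.
apply/eqP; rewrite eq_le; apply/andP; split.
  by apply: tlim_le; exists k => m km; rewrite lift_nm.
apply: lb_le_inf; first exact: tcauchy_bounded (tcauchy_lift u).
by move=> c [K h]; have := h (maxn K k) (leq_maxl _ _); rewrite lift_nm // leq_maxr.
Qed.

Lemma tnull_tlim x : tnull x -> tlim x <= 0.
Proof.
move=> nx; apply/ler_addgt0Pl => e /nx[K h]; rewrite addr0; apply: tlim_le.
by exists K => m /h /ltW.
Qed.

Lemma tlim0_null x : tcauchy x -> tlim x <= 0 -> tnull x.
Proof.
move=> cx l0 e e0; have [|K h] := @tlim_bounded x (e / 2) cx; first lra.
by exists K => m /h; lra.
Qed.

Lemma tlimD x y : tcauchy x -> tcauchy y -> tlim (fun k => x k + y k) <= tlim x + tlim y.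
Proof.
move=> cx cy; apply/ler_addgt0Pl => e e0.
have bx : tbounded x (tlim x + e / 2) by apply: tlim_bounded => //; lra.
have by_ : tbounded y (tlim y + e / 2) by apply: tlim_bounded => //; lra.
apply: tlim_le; have [K h] := maxK bx by_; exists K => m /h[h1 h2].
by have := tnmD (x m) (y m); lra.
Qed.

Lemma tlimM x y : tcauchy x -> tcauchy y ->
  tlim (fun k => tmul (x k) (y k)) <= tlim x * tlim y.
Proof.
move=> cx cy; apply/ler_addgt0Pl => e e0.
have x0 := tlim_ge0 cx; have y0 := tlim_ge0 cy.
pose d := Num.min 1 (e / (tlim x + tlim y + 1)).
have d0 : 0 < d by rewrite /d lt_min ltr01 divr_gt0 //; lra.
have d1 : d <= 1 by rewrite /d ge_min lexx.
have de : d * (tlim x + tlim y + 1) <= e.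
  by rewrite -ler_pdivlMr /d ?ge_min ?lexx ?orbT //; lra.
have bx : tbounded x (tlim x + d) by apply: tlim_bounded => //; lra.
have by_ : tbounded y (tlim y + d) by apply: tlim_bounded => //; lra.
apply: tlim_le; have [K h] := maxK bx by_; exists K => m /h[h1 h2].
apply: le_trans (tnmM _ _) _.
apply: le_trans (ler_pM (Nge0 _) (Nge0 _) h1 h2) _; nra.
Qed.

Lemma tlim_cstar x : tcauchy x -> tlim (fun k => tmul (tadj (x k)) (x k)) = tlim x ^+ 2.
Proof.
move=> cx; have cxx := tcauchyM (tcauchy_adj cx) cx; have x0 := tlim_ge0 cx.
have ca : tlim (fun k => tadj (x k)) = tlim x.
  by congr inf; apply/seteqP; split=> c [K h]; exists K => m /h; rewrite tadj_nm.
apply/eqP; rewrite eq_le; apply/andP; split.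
  by have := tlimM (tcauchy_adj cx) cx; rewrite ca -expr2.
apply/ler_addgt0Pl => e e0; pose l := tlim (fun k => tmul (tadj (x k)) (x k)); rewrite -/l;
  have l0 : 0 <= l by apply: tlim_ge0.
have le0 : 0 <= l + e by lra.
rewrite addrC -[leRHS]sqr_sqrtr // ler_pXn2r ?nnegrE ?sqrtr_ge0 //; apply: tlim_le.
have [|K h] := @tlim_bounded _ (l + e) cxx; first by rewrite -/l; lra.
exists K => m /h; rewrite tnm_cstar => h'.
by rewrite -(@ler_pXn2r _ 2) ?nnegrE ?sqrtr_ge0 // sqr_sqrtr.
Qed.

Lemma tlimZ (a : R[i]) x : tcauchy x -> tlim (fun k => a *: x k) = cabs a * tlim x.
Proof.
have le (b : R[i]) y : tcauchy y -> tlim (fun k => b *: y k) <= cabs b * tlim y.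
  move=> cy; have y0 := tlim_ge0 cy; apply/ler_addgt0Pl => e e0; have b0 := cabs_ge0 b.
  have b1 : 0 < cabs b + 1 by lra.
  have d0 : 0 < e / (cabs b + 1) by rewrite divr_gt0.
  have [|K h] := @tlim_bounded y (tlim y + e / (cabs b + 1)) cy; first lra.
  apply: tlim_le; exists K => m /h; rewrite tnmZ.
  set d := e / _ in d0 *; have -> : e = d * (cabs b + 1) by rewrite /d divfK // lt0r_neq0.
  by move=> h'; apply: le_trans (ler_wpM2l b0 h') _; nra.
move=> cx; have [->|a0] := eqVneq a 0.
  rewrite cabs0 mul0r; apply/eqP; rewrite eq_le; apply/andP; split.
    by apply: tlim_le; exists 0%N => m _; rewrite scale0r N0.
  apply: tlim_ge0; have := tcauchy_lin 0 cx tcauchy0.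
  by congr tcauchy; apply/functional_extensionality_dep => k; rewrite addr0.
have cax : tcauchy (fun k => a *: x k).
  have := tcauchy_lin a cx tcauchy0.
  by congr tcauchy; apply/functional_extensionality_dep => k; rewrite addr0.
apply/eqP; rewrite eq_le le //=; have := le a^-1 _ cax.
have -> : (fun k => a^-1 *: (a *: x k)) = x.
  by apply/functional_extensionality_dep => k; rewrite scalerA mulVf // scale1r.
move=> /(ler_wpM2l (cabs_ge0 a)); rewrite mulrA -cabsM divff // cabs1 mul1r.
by [].
Qed.

End TowerTheory.

Section TowerLimit.
Variables (R : realType) (t : tower R).
Local Notation X := (forall k, t k).
Implicit Types (x y z : X) (e : R).

Definition lim_class x : set X := [set y | tcauchy y /\ tnull (fun k => y k - x k)].

Definition tlimit : Type := {P : set X | exists x, tcauchy x /\ P = lim_class x}.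

HB.instance Definition _ := gen_eqMixin tlimit.
HB.instance Definition _ := gen_choiceMixin tlimit.

Definition tlimit_of x (cx : tcauchy x) : tlimit :=
  exist _ (lim_class x) (ex_intro _ x (conj cx erefl)).

Lemma tlimit_repP (a : tlimit) : {x | tcauchy x /\ projT1 a = lim_class x}.
Proof. by apply: cid; apply: projT2 a. Qed.

Definition tlimit_rep (a : tlimit) : X := sval (tlimit_repP a).

Lemma tlimit_rep_cauchy a : tcauchy (tlimit_rep a).
Proof. by rewrite /tlimit_rep; case: (tlimit_repP a) => x []. Qed.
Hint Resolve tlimit_rep_cauchy : core.

(** Total in x: a sequence that is not Cauchy is sent to the class of 0. *)
Definition cls x : tlimit :=
  if pselect (tcauchy x) is left cx then tlimit_of cx else tlimit_of (@tcauchy0 R t).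

Let ext (x y : X) : (forall k, x k = y k) -> x = y.
Proof. by move=> h; apply/functional_extensionality_dep. Qed.

Let tcB x y : tcauchy x -> tcauchy y -> tcauchy (fun k => x k - y k).
Proof.
move=> cx cy; have := tcauchy_lin (-1) cy cx; congr tcauchy; apply: ext => k.
by rewrite scaleN1r addrC.
Qed.

Let tcD x y : tcauchy x -> tcauchy y -> tcauchy (fun k => x k + y k).
Proof.
by move=> cx cy; have := tcauchy_lin 1 cx cy; congr tcauchy; apply: ext => k; rewrite scale1r.
Qed.

Let tcZ (a : R[i]) x : tcauchy x -> tcauchy (fun k => a *: x k).
Proof.
move=> cx; have := tcauchy_lin a cx (@tcauchy0 R t).
by congr tcauchy; apply: ext => k; rewrite addr0.
Qed.

Let tlim_eq0 x : tcauchy x -> tnull x <-> tlim x = 0.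
Proof.
move=> cx; split=> [/tnull_tlim h|h]; last by apply: tlim0_null => //; rewrite h.
by apply/eqP; rewrite eq_le h tlim_ge0.
Qed.

Let tlimN x : tcauchy x -> tlim (fun k => - x k) = tlim x.
Proof.
move=> cx; have := tlimZ (-1) cx; rewrite cabsN cabs1 mul1r => <-.
by congr tlim; apply: ext => k; rewrite scaleN1r.
Qed.

Definition teq x y := tlim (fun k => x k - y k) = 0.

Let teq_sym x y : tcauchy x -> tcauchy y -> teq x y -> teq y x.
Proof.
move=> cx cy xy; rewrite /teq -(tlimN (tcB cy cx)) -[RHS]xy.
by congr tlim; apply: ext => k; rewrite opprB.
Qed.

Let teq_trans x y z : tcauchy x -> tcauchy y -> tcauchy z -> teq x y -> teq y z -> teq x z.
Proof.
move=> cx cy cz xy yz; apply/eqP; rewrite eq_le tlim_ge0 ?andbT; last exact: tcB.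
have := tlimD (tcB cx cy) (tcB cy cz); rewrite xy yz addr0 => h; apply: le_trans h.
by rewrite le_eqVlt; apply/orP; left; apply/eqP; congr tlim; apply: ext => k; rewrite addrA subrK.
Qed.

Lemma cls_eq x y : tcauchy x -> tcauchy y -> teq x y -> cls x = cls y.
Proof.
move=> cx cy xy; rewrite /cls; case: pselect => // c; case: pselect => // c'.
apply: eq_exist; apply/seteqP; split=> z [cz nz]; split=> //.
  have /tlim_eq0 := nz => /(_ (tcB cz cx)) h; apply/tlim_eq0; first exact: tcB.
  exact: (teq_trans cz cx cy).
have /tlim_eq0 := nz => /(_ (tcB cz cy)) h; apply/tlim_eq0; first exact: tcB.
by apply: (teq_trans cz cy cx) => //; apply: teq_sym.
Qed.

Lemma rep_clsP x : tcauchy x -> teq (tlimit_rep (cls x)) x.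
Proof.
move=> cx; have : lim_class x (tlimit_rep (cls x)).
  rewrite /tlimit_rep; case: (tlimit_repP (cls x)) => y [cy] /=.
  rewrite /cls; case: pselect => // c /= ->; split=> //.
  apply/tlim_eq0; first exact: tcB.
  apply/eqP; rewrite eq_le tlim_ge0 ?andbT; last exact: tcB.
  by apply: tlim_le; exists 0%N => m _; rewrite subrr -[0](scale0r 0) tnmZ cabs0 mul0r.
by case=> c n; apply/tlim_eq0 => //; apply: tcB.
Qed.

Lemma clsK a : cls (tlimit_rep a) = a.
Proof.
rewrite /cls; case: pselect => [c|/(_ (tlimit_rep_cauchy a))//].
have e : projT1 a = lim_class (tlimit_rep a).
  by rewrite /tlimit_rep; case: (tlimit_repP a) => x [].
by case: a c e => P hP c /= e; apply: eq_exist.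
Qed.

Definition ladd (a b : tlimit) := cls (fun k => tlimit_rep a k + tlimit_rep b k).
Definition lscale (c : R[i]) (a : tlimit) := cls (fun k => c *: tlimit_rep a k).
Definition lmul (a b : tlimit) := cls (fun k => tmul (tlimit_rep a k) (tlimit_rep b k)).
Definition ladj (a : tlimit) := cls (fun k => tadj (tlimit_rep a k)).
Definition lnm (a : tlimit) := tlim (tlimit_rep a).

Lemma tlim_teq x y : tcauchy x -> tcauchy y -> teq x y -> tlim x = tlim y.
Proof.
have le x' y' : tcauchy x' -> tcauchy y' -> teq x' y' -> tlim x' <= tlim y'.
  move=> cx cy xy; have := tlimD (tcB cx cy) cy; rewrite xy add0r.
  by congr (tlim _ <= _); apply: ext => k; rewrite subrK.
by move=> cx cy xy; apply/eqP; rewrite eq_le !le //; apply: teq_sym.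
Qed.

Lemma lnm_cls x : tcauchy x -> lnm (cls x) = tlim x.
Proof. by move=> cx; apply: tlim_teq => //; apply: rep_clsP. Qed.

Lemma ladd_cls x y : tcauchy x -> tcauchy y -> ladd (cls x) (cls y) = cls (fun k => x k + y k).
Proof.
move=> cx cy; apply: cls_eq; [exact: tcD|exact: tcD|].
apply/eqP; rewrite eq_le tlim_ge0 ?andbT; last by apply: tcB; apply: tcD.
have := tlimD (tcB (tlimit_rep_cauchy (cls x)) cx) (tcB (tlimit_rep_cauchy (cls y)) cy).
rewrite (rep_clsP cx) (rep_clsP cy) addr0; congr (tlim _ <= _).
by apply: ext => k; rewrite opprD addrACA.
Qed.

Lemma lscale_cls (c : R[i]) x : tcauchy x -> lscale c (cls x) = cls (fun k => c *: x k).
Proof.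
move=> cx; apply: cls_eq; [exact: tcZ|exact: tcZ|].
have := tlimZ c (tcB (tlimit_rep_cauchy (cls x)) cx); rewrite (rep_clsP cx) mulr0 /teq => h;
  rewrite -[RHS]h.
by congr tlim; apply: ext => k; rewrite scalerBr.
Qed.

Lemma lmul_cls x y : tcauchy x -> tcauchy y ->
  lmul (cls x) (cls y) = cls (fun k => tmul (x k) (y k)).
Proof.
move=> cx cy; set x' := tlimit_rep (cls x); set y' := tlimit_rep (cls y).
have cx' : tcauchy x' := tlimit_rep_cauchy _.
have cy' : tcauchy y' := tlimit_rep_cauchy _.
apply: cls_eq; [exact: tcauchyM|exact: tcauchyM|].
apply/eqP; rewrite eq_le tlim_ge0 ?andbT; last by apply: tcB; apply: tcauchyM.
have h1 := tlimM (tcB cx' cx) cy'; have h2 := tlimM cx (tcB cy' cy).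
rewrite (rep_clsP cx) mul0r in h1; rewrite (rep_clsP cy) mulr0 in h2.
have := tlimD (tcauchyM (tcB cx' cx) cy') (tcauchyM cx (tcB cy' cy)).
move=> h3; have {h1 h2}h3 := le_trans h3 (lerD h1 h2); rewrite addr0 in h3; apply: le_trans h3.
rewrite le_eqVlt; apply/orP; left; apply/eqP; congr tlim; apply: ext => k.
by rewrite tmulBl tmulBr addrA subrK.
Qed.

Lemma ladj_cls x : tcauchy x -> ladj (cls x) = cls (fun k => tadj (x k)).
Proof.
move=> cx; apply: cls_eq; [exact: tcauchy_adj|exact: tcauchy_adj|].
rewrite /teq -[RHS](rep_clsP cx) /teq /tlim; congr inf.
apply/seteqP; split=> c [K h]; exists K => m /h.
  by rewrite -tadjB tadj_nm.
by rewrite -tadjB tadj_nm.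
Qed.

Lemma clsP (a : tlimit) : exists2 x, tcauchy x & a = cls x.
Proof. by exists (tlimit_rep a); rewrite ?clsK. Qed.

Definition l0 : tlimit := cls (fun k => 0).
Definition lopp (a : tlimit) := lscale (-1) a.

Let c0 : tcauchy ((fun k => 0) : X) := @tcauchy0 R t.

Lemma laddA : associative ladd.
Proof.
move=> a b c; have [x cx ->] := clsP a; have [y cy ->] := clsP b; have [z cz ->] := clsP c.
rewrite (ladd_cls cx cy) (ladd_cls cy cz) !ladd_cls //; try exact: tcD.
by congr cls; apply: ext => k; rewrite addrA.
Qed.

Lemma laddC : commutative ladd.
Proof.
move=> a b; have [x cx ->] := clsP a; have [y cy ->] := clsP b.
by rewrite !ladd_cls //; congr cls; apply: ext => k; rewrite addrC.
Qed.

Lemma ladd0 : left_id l0 ladd.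
Proof.
move=> a; have [x cx ->] := clsP a.
by rewrite ladd_cls //; congr cls; apply: ext => k; rewrite add0r.
Qed.

Lemma laddN : left_inverse l0 lopp ladd.
Proof.
move=> a; have [x cx ->] := clsP a; rewrite /lopp lscale_cls // ladd_cls //; last exact: tcZ.
by congr cls; apply: ext => k; rewrite scaleN1r addNr.
Qed.

HB.instance Definition _ := GRing.isZmodule.Build tlimit laddA laddC ladd0 laddN.

Lemma lscaleA (a b : R[i]) u : lscale a (lscale b u) = lscale (a * b) u.
Proof.
have [x cx ->] := clsP u; rewrite !lscale_cls //; last exact: tcZ.
by congr cls; apply: ext => k; rewrite scalerA.
Qed.

Lemma lscale1 : left_id 1 lscale.
Proof.
move=> a; have [x cx ->] := clsP a.
by rewrite lscale_cls //; congr cls; apply: ext => k; rewrite scale1r.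
Qed.

Lemma lscaleDr : right_distributive lscale +%R.
Proof.
move=> c a b; have [x cx ->] := clsP a; have [y cy ->] := clsP b.
rewrite -![_ + _]/(ladd _ _) ladd_cls // !lscale_cls ?ladd_cls //; try exact: tcD; try exact: tcZ.
by congr cls; apply: ext => k; rewrite scalerDr.
Qed.

Lemma lscaleDl (u : tlimit) : {morph lscale^~ u : a b / a + b}.
Proof.
move=> a b; have [x cx ->] := clsP u.
rewrite -[RHS]/(ladd _ _) !lscale_cls // ladd_cls; try exact: tcZ.
by congr cls; apply: ext => k; rewrite scalerDl.
Qed.

HB.instance Definition _ :=
  GRing.Zmodule_isLmodule.Build R[i] tlimit lscaleA lscale1 lscaleDr lscaleDl.

Let lnorm (a : tlimit) : R[i] := (lnm a)%:C%C.

Lemma lnormD a b : lnorm (a + b) <= lnorm a + lnorm b.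
Proof.
have [x cx ->] := clsP a; have [y cy ->] := clsP b.
rewrite -[cls x + _]/(ladd _ _) ladd_cls // /lnorm !lnm_cls //; last exact: tcD.
by rewrite -rmorphD lecR tlimD.
Qed.

Lemma lnormZ (c : R[i]) (a : tlimit) : lnorm (c *: a) = `|c| * lnorm a.
Proof.
have [x cx ->] := clsP a; rewrite -[_ *: _]/(lscale _ _) lscale_cls // /lnorm !lnm_cls //.
  by rewrite tlimZ // rmorphM /= -cabsE.
exact: tcZ.
Qed.

Lemma lnorm_eq0 a : lnorm a = 0 -> a = 0.
Proof.
have [x cx ->] := clsP a; rewrite /lnorm lnm_cls // => h; apply: cls_eq => //.
have {}h : tlim x = 0 by apply: complexI.
rewrite /teq -[RHS]h; congr tlim; apply: ext => k.
by rewrite subr0.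
Qed.

HB.instance Definition _ := Lmodule_isNormed.Build R[i] tlimit lnormD lnormZ lnorm_eq0.

Let lsub_cls x y : tcauchy x -> tcauchy y -> cls x - cls y = cls (fun k => x k - y k).
Proof.
move=> cx cy; rewrite -[_ - _]/(ladd _ (lopp _)) /lopp lscale_cls // ladd_cls //; last exact: tcZ.
by congr cls; apply: ext => k; rewrite scaleN1r.
Qed.

Let lmulA : associative lmul.
Proof.
move=> a b c; have [x cx ->] := clsP a; have [y cy ->] := clsP b; have [z cz ->] := clsP c.
rewrite (lmul_cls cx cy) (lmul_cls cy cz) !lmul_cls //; try exact: tcauchyM.
by congr cls; apply: ext => k; rewrite tmulA.
Qed.

Let lmulDl : left_distributive lmul +%R.
Proof.
move=> a b c; have [x cx ->] := clsP a; have [y cy ->] := clsP b; have [z cz ->] := clsP c.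
rewrite -![_ + _]/(ladd _ _) ladd_cls // !lmul_cls ?ladd_cls //; try exact: tcauchyM;
  try exact: tcD.
by congr cls; apply: ext => k; rewrite tmulDl.
Qed.

Let lmulDr : right_distributive lmul +%R.
Proof.
move=> c a b; have [x cx ->] := clsP a; have [y cy ->] := clsP b; have [z cz ->] := clsP c.
rewrite -![_ + _]/(ladd _ _) ladd_cls // !lmul_cls ?ladd_cls //; try exact: tcauchyM;
  try exact: tcD.
by congr cls; apply: ext => k; rewrite tmulDr.
Qed.

Let lmulZl (c : R[i]) a b : lmul (c *: a) b = c *: lmul a b.
Proof.
have [x cx ->] := clsP a; have [y cy ->] := clsP b.
rewrite -![_ *: _]/(lscale _ _) lscale_cls // !lmul_cls ?lscale_cls //; try exact: tcauchyM;
  try exact: tcZ.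
by congr cls; apply: ext => k; rewrite tmulZl.
Qed.

Let lmulZr (c : R[i]) a b : lmul a (c *: b) = c *: lmul a b.
Proof.
have [x cx ->] := clsP a; have [y cy ->] := clsP b.
rewrite -![_ *: _]/(lscale _ _) lscale_cls // !lmul_cls ?lscale_cls //; try exact: tcauchyM;
  try exact: tcZ.
by congr cls; apply: ext => k; rewrite tmulZr.
Qed.

Let ladjD : {morph ladj : a b / a + b}.
Proof.
move=> a b; have [x cx ->] := clsP a; have [y cy ->] := clsP b.
rewrite -![_ + _]/(ladd _ _) ladd_cls // !ladj_cls ?ladd_cls //; try exact: tcauchy_adj;
  try exact: tcD.
by congr cls; apply: ext => k; rewrite tadjD.
Qed.

Let ladjZ (c : R[i]) a : ladj (c *: a) = Num.conj c *: ladj a.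
Proof.
have [x cx ->] := clsP a.
rewrite -![_ *: _]/(lscale _ _) lscale_cls // !ladj_cls ?lscale_cls //; try exact: tcauchy_adj;
  try exact: tcZ.
by congr cls; apply: ext => k; rewrite tadjZ.
Qed.

Let ladjM a b : ladj (lmul a b) = lmul (ladj b) (ladj a).
Proof.
have [x cx ->] := clsP a; have [y cy ->] := clsP b.
rewrite lmul_cls // !ladj_cls ?lmul_cls //; try exact: tcauchy_adj; try exact: tcauchyM.
by congr cls; apply: ext => k; rewrite tadjM.
Qed.

Let ladjK : involutive ladj.
Proof.
move=> a; have [x cx ->] := clsP a; rewrite !ladj_cls //; last exact: tcauchy_adj.
by congr cls; apply: ext => k; rewrite tadjK.
Qed.

Let lnormM (a b : tlimit) : `|lmul a b| <= `|a| * `|b|.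
Proof.
have [x cx ->] := clsP a; have [y cy ->] := clsP b.
rewrite -[`|_|]/(lnorm _) -[`|cls x|]/(lnorm _) -[`|cls y|]/(lnorm _) /lnorm.
rewrite lmul_cls // !lnm_cls //; last exact: tcauchyM.
by rewrite -rmorphM lecR tlimM.
Qed.

Let lnorm_cstar (a : tlimit) : `|lmul (ladj a) a| = `|a| ^+ 2.
Proof.
have [x cx ->] := clsP a; have ca := tcauchy_adj cx.
rewrite -[`|_|]/(lnorm _) -[`|cls x|]/(lnorm _) /lnorm.
rewrite ladj_cls // lmul_cls // !lnm_cls //; last exact: tcauchyM.
by rewrite -rmorphXn /= tlim_cstar.
Qed.

Definition lmu k (u : t k) : tlimit := cls (lift_to u).

Let cl k (u : t k) : tcauchy (lift_to u) := tcauchy_lift u.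

Let teq_eventually x y k : tcauchy x -> tcauchy y ->
  (forall m, (k <= m)%N -> x m = y m) -> teq x y.
Proof.
move=> cx cy h; apply/eqP; rewrite eq_le tlim_ge0 ?andbT; last exact: tcB.
by apply: tlim_le; exists k => m /h ->; rewrite subrr -[0](scale0r 0) tnmZ cabs0 mul0r.
Qed.

Lemma lmu_lin k : linear (@lmu k).
Proof.
move=> a u w; rewrite -[RHS]/(ladd (lscale _ _) _) /lmu lscale_cls // ladd_cls //; last exact: tcZ.
apply: (cls_eq (cl _)); first by apply: tcD => //; apply: tcZ.
apply: (@teq_eventually _ _ k); rewrite ?cl //; first by apply: tcD => //; apply: tcZ.
by move=> m km; rewrite lift_lin.
Qed.

Lemma lmuM k (u w : t k) : lmu (tmul u w) = lmul (lmu u) (lmu w).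
Proof.
rewrite /lmu lmul_cls //; apply: cls_eq; [exact: cl|exact: tcauchyM|].
by apply: (@teq_eventually _ _ k); [exact: cl|exact: tcauchyM|move=> m km; rewrite liftM].
Qed.

Lemma lmuS k (u : t k) : lmu (tadj u) = ladj (lmu u).
Proof.
rewrite /lmu ladj_cls //; apply: cls_eq; [exact: cl|exact: tcauchy_adj|].
by apply: (@teq_eventually _ _ k); [exact: cl|exact: tcauchy_adj|move=> m km; rewrite lift_adj].
Qed.

Lemma lmu_nm k (u : t k) : lnm (lmu u) = tnm u.
Proof. by rewrite /lmu lnm_cls ?tlim_lift. Qed.

Lemma lmu_up k (u : t k) : lmu (tup u) = lmu u.
Proof.
apply: cls_eq => //; apply: (@teq_eventually _ _ k.+1) => // m km.
have -> : tup u = lift_to u k.+1 by rewrite liftS // lift_id.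
by rewrite lift_lift.
Qed.

Lemma lmu_lift k m (u : t k) : (k <= m)%N -> lmu (lift_to u m) = lmu u.
Proof.
move=> km; apply: cls_eq => //; apply: (@teq_eventually _ _ m) => // l ml.
by rewrite lift_lift.
Qed.

Lemma lmu_dense (a : tlimit) e : 0 < e -> exists k (u : t k), lnm (a - lmu u) < e.
Proof.
move=> e0; have [x cx ->] := clsP a; have [|K h] := cx (e / 2); first lra.
exists K, (x K); rewrite lsub_cls // lnm_cls; last exact: tcB.
apply: (@le_lt_trans _ _ (e / 2)); last lra.
by apply: tlim_le; exists K => m /h /ltW.
Qed.

Let lnmD (a b : tlimit) : lnm (a + b) <= lnm a + lnm b.
Proof. by rewrite -lecR rmorphD; apply: lnormD. Qed.

Let lnmN (a : tlimit) : lnm (- a) = lnm a.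
Proof. by apply: complexI; rewrite -[LHS]/`|- a| normrN. Qed.

Let lnm_tri (a b c : tlimit) : lnm (a - c) <= lnm (a - b) + lnm (b - c).
Proof. by have := lnmD (a - b) (b - c); rewrite addrA subrK. Qed.

Let lnmBC (a b : tlimit) : lnm (a - b) = lnm (b - a).
Proof. by rewrite -lnmN opprB. Qed.

Let lnm_ge0 (a : tlimit) : 0 <= lnm a.
Proof. by rewrite /lnm tlim_ge0. Qed.

(** An infimum over one level need not be attained there, as the levels are not assumed complete; a
    near-minimiser is enough. *)
Let near_min (T : Type) (f : T -> R) (w : T) e : (forall z : T, 0 <= f z) -> 0 < e ->
  exists z : T, forall z' : T, f z <= f z' + e.
Proof.
move=> f0 e0; have hi : has_inf (range f).
  by split; [exists (f w), w|exists 0 => _ [z _ <-]].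
have [_ [z _ <-] hz] := inf_adherent e0 hi; exists z => z'.
apply: (le_trans (ltW hz)); rewrite lerD2r; apply: ge_inf; first by case: hi.
by exists z'.
Qed.

(* Each term is approximated from its own level: the approximants form the limit. *)
Let tlimit_seq_complete (a : nat -> tlimit) :
  (forall e, 0 < e -> exists N, forall m n, (N <= m)%N -> (N <= n)%N -> lnm (a m - a n) < e) ->
  exists l, forall e, 0 < e -> exists N, forall n, (N <= n)%N -> lnm (a n - l) < e.
Proof.
move=> ca.
have /all_sig[z hz] m : {z : t m | forall w : t m,
  lnm (a m - lmu z) <= lnm (a m - lmu w) + m.+1%:R^-1}.
  by apply: cid; apply: near_min => [|z|]; [exact: 0|exact: lnm_ge0|rewrite invr_gt0 ltr0n].
have za e : 0 < e -> exists N, forall m, (N <= m)%N -> lnm (a m - lmu (z m)) < e.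
  move=> e0; have e4 : 0 < e / 4 by lra.
  have [N hN] := ca _ e4; have [k [u hu]] := lmu_dense (a N) e4; have [M hM] := invr_lt e4.
  exists (maxn (maxn N k) M) => m; rewrite !geq_max => /andP[/andP[Nm km] Mm].
  have := hz m (lift_to u m); rewrite lmu_lift //.
  have := lnm_tri (a m) (a N) (lmu u); have := hN m N Nm (leqnn N).
  have : m.+1%:R^-1 < e / 4 :> R by apply: hM.
  move: hu; generalize (lnm (a m - lmu (z m))) (lnm (a m - lmu u)) (lnm (a m - a N)).
  by generalize (lnm (a N - lmu u)) (m.+1%:R^-1 : R) => *; lra.
have cz : tcauchy z.
  move=> e e0; have e3 : 0 < e / 3 by lra.
  have [N hN] := ca _ e3; have [M hM] := za _ e3; exists (maxn N M) => m Km.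
  have [KN KM] : (N <= maxn N M)%N /\ (M <= maxn N M)%N by rewrite leq_maxl leq_maxr.
  rewrite -lmu_nm; set K := maxn N M in Km KN KM *.
  have -> : lmu (z m - lift_to (z K) m) = lmu (z m) - lmu (z K).
    by rewrite addrC -scaleN1r lmu_lin lmu_lift // scaleN1r addrC.
  have := lnm_tri (lmu (z m)) (a m) (lmu (z K)); have := lnm_tri (a m) (a K) (lmu (z K)).
  have := hN m K (leq_trans KN Km) KN; have := hM m (leq_trans KM Km); have := hM K KM.
  rewrite (lnmBC (lmu (z m)) (a m)).
  generalize (lnm (lmu (z m) - lmu (z K))) (lnm (a m - lmu (z m))) (lnm (a m - lmu (z K))).
  by generalize (lnm (a m - a K)) (lnm (a K - lmu (z K))) => *; lra.
exists (cls z) => e e0; have e2 : 0 < e / 2 by lra.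
have [N hN] := za _ e2; have [|K hK] := tcauchy_base cz (e := e / 3); first lra.
exists (maxn N K) => n; rewrite geq_max => /andP[Nn Kn].
have h : lnm (lmu (z n) - cls z) <= e / 3.
  rewrite lsub_cls // lnm_cls; last exact: tcB.
  apply: tlim_le; exists n => m nm.
  by rewrite -opprB -scaleN1r tnmZ cabsN cabs1 mul1r ltW // hK.
have := lnm_tri (a n) (lmu (z n)) (cls z); have := hN n Nn; move: h.
by generalize (lnm (lmu (z n) - cls z)) (lnm (a n - lmu (z n))) (lnm (a n - cls z)) => *; lra.
Qed.

(** Reduction to sequences: centres of balls of radius 1 / (n + 1) that belong to F form a Cauchy
    sequence, since two such balls always meet. *)
Let tlimit_complete (F : set_system tlimit) : ProperFilter F -> cauchy F -> cvg F.
Proof.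
move=> FF /cauchyP cF.
have bE (a b : tlimit) e : ball a e%:C%C b <-> lnm (a - b) < e.
  by rewrite -ball_normE /= -[`|_|]/((lnm _)%:C%C) ltcR.
have /choice[a ha] : forall n : nat, exists a, F (ball a (n.+1%:R^-1 : R)%:C%C).
  by move=> n; apply: cF; rewrite ltcR invr_gt0 ltr0n.
have aa m n : lnm (a m - a n) < m.+1%:R^-1 + n.+1%:R^-1.
  have [c [/bE h /bE h']] := filter_ex (filterI (ha m) (ha n)).
  have := lnm_tri (a m) c (a n); rewrite (lnmBC c (a n)) => h3.
  exact: le_lt_trans h3 (ltrD h h').
have [e e0|l hl] := @tlimit_seq_complete a.
  have [N hN] := invr_lt (ltac:(lra) : 0 < e / 2); exists N => m n Nm Nn.
  apply: lt_trans (aa m n) _; rewrite [e]splitr; exact: ltrD (hN m Nm) (hN n Nn).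
apply/cvg_ex; exists l; apply/cvg_ballP => _ /gt0_realC[e e0 ->].
have e2 : 0 < e / 2 by lra.
have [N hN] := hl _ e2; have [M hM] := invr_lt e2; pose n := maxn N M.
apply: filterS (ha n) => c /bE h; apply/bE.
have := lnm_tri l (a n) c; rewrite (lnmBC l (a n)) => h3; apply: le_lt_trans h3 _.
rewrite [e]splitr; apply: ltrD; first exact: hN n (leq_maxl _ _).
exact: lt_trans h (hM n (leq_maxr _ _)).
Qed.

HB.instance Definition _ := Uniform_isComplete.Build tlimit tlimit_complete.

HB.instance Definition _ := isCStar.Build R tlimit lmulA lmulDl lmulDr lmulZl lmulZr
  ladjD ladjZ ladjM ladjK lnormM lnorm_cstar.

Lemma lmu_inj k : injective (@lmu k).
Proof.
move=> u w uw; apply/eqP; rewrite -subr_eq0; apply/eqP; apply: tnm_eq0.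
rewrite -lmu_nm addrC -scaleN1r lmu_lin uw scaleN1r addNr.
by apply: complexI; rewrite -[LHS]/(`|0 : tlimit|) normr0.
Qed.

End TowerLimit.

Section CARExists.
Variable R : realType.

Definition matrix_tower : tower R.
Proof.
refine (@Tower R (fun k => 'M[R[i]]_(2 ^ k) : lmodType R[i])
  (fun k => @mulmx _ _ _ _) (fun k => @adjmx R _) (fun k => @op_norm R _)
  (fun k x => tens2 (esym (expnSr 2 k)) x 1%:M) _ _ _ _ _ _ _ _ _ _ _ _ _ _ _ _ _ _).
- by move=> k x y z; rewrite mulmxA.
- by move=> k x y z; rewrite mulmxDl.
- by move=> k x y z; rewrite mulmxDr.
- by move=> k a x y; rewrite scalemxAl.
- by move=> k a x y; rewrite scalemxAr.
- by move=> k x y; apply/matrixP => i j; rewrite !mxE rmorphD.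
- by move=> k a x; apply/matrixP => i j; rewrite !mxE rmorphM.
- by move=> k x y; rewrite /adjmx map_mxM trmx_mul.
- by move=> k x; apply: adjmxK.
- by move=> k x y; apply: op_normD.
- by move=> k a x; apply: op_normZ.
- by move=> k x; apply: op_norm_eq0.
- by move=> k x y; apply: op_normM.
- by move=> k x; apply: op_norm_cstar.
- by move=> k a x y; apply: tens2_linl.
- by move=> k x y; rewrite tens2M mul1mx.
- by move=> k x; rewrite /adjmx tens2_ct -/(adjmx 1%:M) adjmx1.
- by move=> k x; apply: op_norm_tens.
Defined.

Lemma car_exists : is_CAR (tlimit matrix_tower).
Proof.
exists (fun k => @lmu R matrix_tower k); split.
- move=> k; split; first by move=> a x y; apply: (@lmu_lin R matrix_tower k a x y).
    by move=> x y; apply: (@lmuM R matrix_tower k).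
  by move=> x; apply: (@lmuS R matrix_tower k).
- by move=> k; apply: (@lmu_inj R matrix_tower k).
- by move=> k x; apply: (@lmu_up R matrix_tower k).
apply/denseP => a e /(lmu_dense a)[k [u h]].
by exists (lmu u) => //; exists k.
Qed.

End CARExists.


(* [is_CAR] determines A up to isomorphism, so "the CAR algebra" is rendered as:
   a CAR algebra exists, and every CAR algebra has the stated property. *)
Theorem theoremA (R : realType) :
  (exists A : cstarAlgType R, is_CAR A) /\
  (forall A : cstarAlgType R, is_CAR A ->
     exists D : set A, [/\ cstar_diagonal D, cantor_spectrum D & ~ AF_diagonal D]).
Proof.
split; first by exists (tlimit (matrix_tower R)); apply: car_exists.
move=> A [mu [h mu_inj mu_raise mu_dense]].
have mu_lin k : linear (mu k) by have [] := h k.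
have muM k : {morph (mu k) : x y / x *m y >-> x ** y} by have [] := h k.
have muS k x : mu k (map_mx Num.conj x)^T = star (mu k x) by have [] := h k.
have [tau [ht tauE]] := car_trace mu_lin muM muS mu_inj mu_raise mu_dense.
have tau0 := car_trace_faithful ht tauE.
have [r [v [flip [hr hv]]]] := odometer_exists
  (car_matrix_units mu_lin muM muS mu_inj mu_raise mu_dense)
  (@car_units_generating R A mu mu_lin muM muS mu_inj mu_raise mu_dense).
exists (diagonal r); split.
- exact: diagonal_cstar_diagonal hr hv ht tau0.
- exact: diagonal_cantor hr hv ht.
- exact: diagonal_not_AF hr hv.
Qed.
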